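(* Let $\lambda>0$ and let $F$ be a probability measure on $\mathbb{R}_+=[0,\infty)$ which follows a power law with tail exponent $\alpha>d$, so that $1-F(r)=\ell(r)r^{-\alpha}$ for some slowly varying function $\ell$. Consider the thinning in which only isolated grains are retained, i.e. the weight kernel is $G_r(dw)=\delta_1(dw)$ for every $r$ (every grain has weight $1$). Then the thinned radius distribution satisfies, for all $r\ge 0$, \[ \bar F_{\rm th}(r) \le \frac{\lambda}{\lambda_{\rm th}}\, e^{-\lambda |B_1| r^d}, \] the covariance function of the thinned grain cover satisfies \[ k_{\rm th}(z) \sim \lambda\, c_{\alpha,d}\, p_{\rm th}^2\, \ell(|z|)\, |z|^{-(\alpha-d)} \quad\text{as } |z|\to\infty, \] and the two-point correlation function of the thinned grain centers satisfies \[ \xi_{\rm th}(z) \sim \lambda\, c_{\alpha,d}\, \ell(|z|)\, |z|^{-(\alpha-d)} \quad\text{as } |z|\to\infty, \] where $c_{\alpha,d} = \int_0^\infty |B_r(o)\cap B_r(e_1)|\,\alpha r^{-\alpha-1}\,dr$.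
   Context: Notation: $d\ge 1$ is the dimension, $o$ the origin and $e_1$ the first standard unit vector of $\mathbb{R}^d$; $B_r(x)$ is the closed Euclidean ball with center $x$ and radius $r$, $B_r=B_r(o)$; $|B|$ is the Lebesgue measure of a Borel set $B\subset\mathbb{R}^d$, and $|z|$ is the Euclidean norm of a vector $z$. $\mathbb{R}_+=[0,\infty)$. For a probability measure $F$ on $\mathbb{R}_+$, $F(r)=F[0,r]$ and $\bar F(r)=1-F(r)$. $f\sim g$ means $f/g\to1$. A measurable $f:\mathbb{R}_+\to\mathbb{R}$ is regularly varying with exponent $\gamma$ if it is positive for all large arguments and $f(at)/f(t)\to a^\gamma$ as $t\to\infty$ for all $a>0$; slowly varying means regularly varying with exponent $0$. $F$ follows a power law with tail exponent $\alpha$ if $\bar F$ is regularly varying with exponent $-\alpha$. Model: $\Phi$ is a Poisson random measure (identified with its random set of points) on $\mathbb{R}^d\times\mathbb{R}_+\times\mathbb{R}_+$ with intensity measure $\lambda\,dx\,F(dr)\,G_r(dw)$, where $\lambda>0$, $\int r^dF(dr)<\infty$ and $G$ is a probability kernel on $\mathbb{R}_+$. A point $(x,r,w)$ is called a grain with center $x$, radius $r$, weight $w$. For a grain configuration $\varphi$, the thinning $T(\varphi)$ is the set of those $(x,r,w)\in\varphi$ such that $w>w'$ for every other grain $(x',r',w')\in\varphi$ with $B_{r'}(x')\cap B_r(x)\ne\emptyset$. The thinned model is $\Phi^{\rm th}=T(\Phi)$, its grain cover is $X^{\rm th}=\bigcup_{(x,r,w)\in\Phi^{\rm th}}B_r(x)$,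 and $\Phi^{\rm th}_g=\{x:(x,r,w)\in\Phi^{\rm th}\}$ is the point configuration of thinned grain centers. Retention probabilities: $h(r,w)=\mathrm{P}\big((x,r,w)\in T(\Phi\cup\{(x,r,w)\})\big)$ (independent of $x$), and $h(r)=\int h(r,w)\,G_r(dw)$. For two reference grains with $|x_1-x_2|=u$, $h_2(u,r_1,w_1,r_2,w_2)=\mathrm{P}\big(\text{both } (x_i,r_i,w_i)\in T(\Phi\cup\{(x_1,r_1,w_1),(x_2,r_2,w_2)\})\big)$, which depends on $x_1,x_2$ only through $u$ (the two reference grains count as different grains), and $h_2(u,r_1,r_2)=\iint h_2(u,r_1,w_1,r_2,w_2)\,G_{r_1}(dw_1)G_{r_2}(dw_2)$. Retention covariance function: $q(u,r_1,r_2)=h_2(u,r_1,r_2)-h(r_1)h(r_2)$. Statistics of the thinned model: density of centers $\lambda_{\rm th}=\lambda\int h(r)F(dr)$; radius distribution of a typical thinned grain $F_{\rm th}(r)=1-\frac{\lambda}{\lambda_{\rm th}}\int_{(r,\infty)}h(s)F(ds)$, with $\bar F_{\rm th}=1-F_{\rm th}$; volume fraction $p_{\rm th}=\mathrm{P}(o\in X^{\rm th})=\lambda\int|B_r|h(r)F(dr)$; covariance function $k_{\rm th}(z)=\mathrm{P}(o\in X^{\rm th},z\in X^{\rm th})-\mathrm{P}(o\in X^{\rm th})\mathrm{P}(z\in X^{\rm th})$; two-point correlation function $\xi_{\rm th}$, a function with $\mathrm{Cov}(\Phi^{\rm th}_g(A),\Phi^{\rm th}_g(B))=\lambda_{\rm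 th}^2\int_A\int_B\xi_{\rm th}(x-y)\,dx\,dy$ for all disjoint bounded measurable $A,B\subset\mathbb{R}^d$, taken in the version $\xi_{\rm th}(z)=\frac{\lambda^2}{\lambda_{\rm th}^2}\iint q(|z|,r_1,r_2)F(dr_1)F(dr_2)$. *)

(* Defs.v *)
From HB Require Import structures.
From mathcomp Require Import all_boot all_order all_algebra.
From mathcomp Require Import all_classical all_reals all_analysis.
From mathcomp Require Import measurable_realfun.

Set Implicit Arguments.
Unset Strict Implicit.
Unset Printing Implicit Defensive.
Import Order.TTheory GRing.Theory Num.Theory.
Import numFieldNormedType.Exports.

Local Open Scope classical_set_scope.
Local Open Scope ring_scope.

(* The Borel sigma-algebra of R^n, generated by the coordinate maps. *)
Section rV_measurable.
Context (R : realType) (n : nat).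

Let coors (i : 'I_n) (x : 'rV[R]_n) : measurableTypeR R := x ord0 i.

Let rV_set0 : g_sigma_preimage coors set0.
Proof. exact: sigma_algebra0. Qed.

Let rV_setC A : g_sigma_preimage coors A -> g_sigma_preimage coors (~` A).
Proof. exact: sigma_algebraC. Qed.

Let rV_bigcup (F : _^nat) : (forall i, g_sigma_preimage coors (F i)) ->
  g_sigma_preimage coors (\bigcup_i (F i)).
Proof. exact: sigma_algebra_bigcup. Qed.

HB.instance Definition _ := @isMeasurable.Build default_measure_display
  'rV[R]_n (g_sigma_preimage coors) rV_set0 rV_setC rV_bigcup.

Lemma measurable_coord (i : 'I_n) :
  measurable_fun [set: 'rV[R]_n] (fun x => x ord0 i : measurableTypeR R).
Proof.
move=> _ Y mY; rewrite setTI; apply: sub_sigma_algebra => /=.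
rewrite -bigcup_seq/=; exists i => /=; first by rewrite mem_index_enum.
by exists Y => //; rewrite setTI.
Qed.

Lemma measurable_fun_coordP d (T : measurableType d) (f : T -> 'rV[R]_n) :
  (forall i, measurable_fun [set: T] (fun t => f t ord0 i : measurableTypeR R)) ->
  measurable_fun [set: T] f.
Proof.
move=> mf _ A; rewrite setTI.
suff : g_sigma_preimage coors `<=` [set A | measurable (f @^-1` A)] by apply.
apply: smallest_sub.
  split.
  - by rewrite /= preimage_set0.
  - by move=> B mB; rewrite /= setTD preimage_setC; exact: measurableC.
  - by move=> B mB; rewrite /= preimage_bigcup; exact: bigcupT_measurable.
rewrite -bigcup_seq/=; apply: bigcup_sub => i _ B [C mC <-].
by rewrite /= setTI -[X in measurable X]setTI; exact: mf.
Qed.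

End rV_measurable.


(* Lebesgue measure on R^n, by induction on n: the image of the product of the
   one-dimensional Lebesgue measure and Lebesgue measure on R^(n-1) under the
   map that adds a first coordinate. *)
Section lebesgue_rV.
Context {R : realType}.

Section step.
Variable n : nat.

Definition rV_cons (p : measurableTypeR R * 'rV[R]_n) : 'rV[R]_n.+1 :=
  \row_(i < n.+1) if unlift ord0 i is Some j then p.2 ord0 j else p.1.

Definition rV_uncons (x : 'rV[R]_n.+1) : measurableTypeR R * 'rV[R]_n :=
  (x ord0 ord0, \row_(j < n) x ord0 (lift ord0 j)).

Lemma rV_consK : cancel rV_cons rV_uncons.
Proof.
move=> [a v]; rewrite /rV_uncons; congr pair; first by rewrite mxE unlift_none.
by apply/rowP => j; rewrite !mxE liftK.
Qed.

Lemma measurable_rV_cons : measurable_fun [set: _] rV_cons.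
Proof.
apply: measurable_fun_coordP => i; rewrite /rV_cons.
under eq_fun do rewrite mxE.
case: unliftP => [j _|_]; last exact: measurable_fst.
exact: (measurableT_comp (measurable_coord j) measurable_snd).
Qed.

Lemma measurable_rV_uncons : measurable_fun [set: _] rV_uncons.
Proof.
apply/measurable_fun_pairP; split; first exact: measurable_coord.
apply: measurable_fun_coordP => j.
by under eq_fun do rewrite mxE; exact: measurable_coord.
Qed.

Variable mu : {sigma_finite_measure set 'rV[R]_n -> \bar R}.


Definition lebesgue_rV_step : set 'rV[R]_n.+1 -> \bar R :=
  pushforward (@lebesgue_measure R \x mu)%E rV_cons.

Let measurable_preimage A : measurable A -> measurable (rV_cons @^-1` A).
Proof. by move=> mA; rewrite -[X in measurable X]setTI; exact: measurable_rV_cons. Qed.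

Let step0 : lebesgue_rV_step set0 = 0%E.
Proof. by rewrite /lebesgue_rV_step /pushforward preimage_set0 measure0. Qed.

Let step_ge0 A : (0 <= lebesgue_rV_step A)%E.
Proof. by rewrite /lebesgue_rV_step /pushforward; exact: measure_ge0. Qed.

Let step_sigma_additive : semi_sigma_additive lebesgue_rV_step.
Proof.
move=> F mF tF mUF; rewrite /lebesgue_rV_step /pushforward preimage_bigcup.
apply: measure_semi_sigma_additive.
- by move=> k; exact: measurable_preimage.
- apply/trivIsetP => /= i j _ _ ij; rewrite -preimage_setI.
  by move/trivIsetP : tF => /(_ _ _ _ _ ij) ->//; rewrite preimage_set0.
- by rewrite -preimage_bigcup; exact: measurable_preimage.
Qed.

HB.instance Definition _ := isMeasure.Build _ _ _
  lebesgue_rV_step step0 step_ge0 step_sigma_additive.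

Let step_sigma_finite : sigma_finite setT lebesgue_rV_step.
Proof.
have /sigma_finiteP[F [TF ndF Foo]] := sigma_finiteT (@lebesgue_measure R).
have /sigma_finiteP[G [TG ndG Goo]] := sigma_finiteT mu.
exists (fun k => rV_uncons @^-1` (F k `*` G k)).
  rewrite -preimage_bigcup; apply/esym/seteqP; split => // x _ /=.
  have [i _ Fi] : (\bigcup_i F i) (rV_uncons x).1 by rewrite -TF.
  have [j _ Gj] : (\bigcup_i G i) (rV_uncons x).2 by rewrite -TG.
  exists (maxn i j) => //; split.
    by move: Fi; apply/subsetPset/ndF/leq_maxl.
  by move: Gj; apply/subsetPset/ndG/leq_maxr.
move=> k; have [mF Fkoo] := Foo k; have [mG Gkoo] := Goo k; split.
  rewrite -[X in measurable X]setTI; apply: measurable_rV_uncons => //.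
  exact: measurableX.
rewrite /lebesgue_rV_step /pushforward -comp_preimage.
rewrite (_ : rV_uncons \o rV_cons = id); last exact/funext/rV_consK.
by rewrite /= product_measure1E// lte_mul_pinfty// ge0_fin_numE.
Qed.

HB.instance Definition _ := Measure_isSigmaFinite.Build _ _ _
  lebesgue_rV_step step_sigma_finite.

End step.

Fixpoint lebesgue_rV (n : nat) : {sigma_finite_measure set 'rV[R]_n -> \bar R} :=
  if n is n'.+1 then lebesgue_rV_step (lebesgue_rV n') else \d_(0 : 'rV[R]_0).

Lemma measurable_box n (a b : 'I_n -> R) :
  measurable [set x : 'rV[R]_n | forall i, x ord0 i \in `[a i, b i]].
Proof.
rewrite (_ : [set _ | _] =
  \big[setI/setT]_(i < n) ((fun x : 'rV[R]_n => x ord0 i) @^-1` `[a i, b i])).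
  apply: bigsetI_measurable => i _; rewrite -[X in measurable X]setTI.
  exact: measurable_coord.
rewrite -bigcap_seq; apply/seteqP; split => x /= xab i; first by move=> _; exact: xab.
by apply: xab; exact: mem_index_enum.
Qed.

Lemma lebesgue_rV_box n (a b : 'I_n -> R) : (forall i, a i <= b i) ->
  lebesgue_rV n [set x | forall i, x ord0 i \in `[a i, b i]] =
  (\prod_(i < n) (b i - a i))%:E.
Proof.
elim: n a b => [|n IHn] a b ab.
  by rewrite big_ord0 /= diracE mem_set//=; case.
rewrite /= /lebesgue_rV_step /pushforward.
rewrite (_ : _ @^-1` _ = `[a ord0, b ord0]%classic `*`
   [set x : 'rV[R]_n |
     forall i, x ord0 i \in `[a (lift ord0 i), b (lift ord0 i)]]).
  rewrite product_measure1E//=; last exact: measurable_box.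
  rewrite IHn// lebesgue_measure_itv/= big_ord_recl EFinM; congr *%E.
  rewrite lte_fin; have := ab ord0; rewrite le_eqVlt => /orP[/eqP ->|->//].
  by rewrite ltxx subrr.
apply/seteqP; split => -[y v] /= => [yv|[y0 vi] i].
  split; first by have := yv ord0; rewrite mxE unlift_none.
  by move=> i; have := yv (lift ord0 i); rewrite mxE liftK.
by rewrite mxE; case: unliftP => [j ->|->].
Qed.

End lebesgue_rV.
Arguments lebesgue_rV R n : clear implicits.

Section euclidean.
Context {R : realType} {d : nat}.
Implicit Types (x : 'rV[R]_d) (r : R).

(* The library's norm on matrices is the sup norm. *)
Definition enorm x : R := Num.sqrt (\sum_(i < d) x ord0 i ^+ 2).

Definition cball x r : set 'rV[R]_d := [set y | enorm (y - x) <= r].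

Definition vol (B : set 'rV[R]_d) : R := fine (lebesgue_rV R d B).

(* The filter of |z| -> oo. *)
Definition enorm_pinfty : set_system 'rV[R]_d :=
  filter_from [set: R] (fun M => [set z | M < enorm z]).

Definition asymp_equiv (f g : 'rV[R]_d -> R) : Prop :=
  f z / g z @[z --> enorm_pinfty] --> (1 : R).

End euclidean.

Definition e1 (R : realType) (d : nat) : 'rV[R]_d :=
  \row_(i < d) ((i : nat) == 0)%:R.

Section regular_variation.
Context {R : realType}.
Implicit Type F : probability (measurableTypeR R) R.

(* Functions on [0, oo[ are represented by functions on R; the values at
   negative arguments are irrelevant. *)
Definition regularly_varying (gamma : R) (f : R -> R) : Prop :=
  [/\ measurable_fun (`[0, +oo[%classic : set R) f,
      \forall t \near +oo, 0 < f t &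
      forall a, 0 < a -> f (a * t) / f t @[t --> +oo] --> a `^ gamma].

Definition slowly_varying (f : R -> R) : Prop := regularly_varying 0 f.

Definition cdf0 F (r : R) : R := fine (F `[0, r]%classic).

Definition tail F (r : R) : R := 1 - cdf0 F r.

Definition power_law F (alpha : R) : Prop :=
  regularly_varying (- alpha) (tail F).

End regular_variation.

Section poisson_random_measure.
Context {R : realType} {disp : measure_display} {Omega : measurableType disp}.
Context {d : measure_display} {T : measurableType d}.
Variables (P : probability Omega R) (Phi : Omega -> set T).

Definition count_in (B : set T) (omega : Omega) : \bar R :=
  counting (Phi omega `&` B).

Local Open Scope ereal_scope.

(* The random point set Phi is identified with the random measure
   B |-> count_in B. The second argument of the library's poisson_prob plays no
   role. *)
Definition poisson_random_measure (Lambda : set T -> \bar R) : Prop :=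
  [/\ forall B, measurable B -> measurable_fun [set: Omega] (count_in B),
      forall B, measurable B -> Lambda B < +oo -> forall k : nat,
        P [set omega | count_in B omega = k%:R%:E] =
        poisson_prob (fine (Lambda B)) k [set k] &
      forall n (B : 'I_n -> set T), (forall i, measurable (B i)) ->
        trivIset [set: 'I_n] B ->
        forall A : 'I_n -> set (\bar R), (forall i, measurable (A i)) ->
        P [set omega | forall i, A i (count_in (B i) omega)] =
        \prod_(i < n) P [set omega | A i (count_in (B i) omega)]].

End poisson_random_measure.

(* Grains (x, r, w); the marks r and w are reals, and a configuration or a
   mark distribution is required to be concentrated on nonnegative marks. *)
Notation grain R d :=
  ('rV[R]_d * measurableTypeR R * measurableTypeR R)%type.

Section thinning.
Context {R : realType} {d : nat}.
Implicit Types (g : grain R d) (phi : set (grain R d)).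

Definition center g : 'rV[R]_d := g.1.1.
Definition radius g : R := g.1.2.
Definition weight g : R := g.2.

Definition grain_ball g : set 'rV[R]_d := cball (center g) (radius g).

Definition grain_configuration phi : Prop :=
  (forall g, phi g -> 0 <= radius g /\ 0 <= weight g) /\
  (forall M : R, finite_set (phi `&`
     [set g | [/\ enorm (center g) <= M, radius g <= M & weight g <= M]])).

Definition thinning phi : set (grain R d) :=
  [set g | phi g /\ forall g', phi g' -> g' <> g ->
     grain_ball g' `&` grain_ball g !=set0 -> weight g' < weight g].

Definition grain_cover phi : set 'rV[R]_d := \bigcup_(g in phi) grain_ball g.

End thinning.

Section thinned_model.
Context {R : realType} {d : nat}.
Variables (lam : R) (F : probability (measurableTypeR R) R).
Variable G : R.-pker (measurableTypeR R) ~> (measurableTypeR R).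
Context {disp : measure_display} {Omega : measurableType disp}.
Variables (P : probability Omega R) (Phi : Omega -> set (grain R d)).

Definition intensity (A : set (grain R d)) : \bar R :=
  (lam%:E * \int[lebesgue_rV R d]_x \int[F]_r G r [set w | A (x, r, w)])%E.

Definition poisson_grain_model : Prop :=
  (forall omega, grain_configuration (Phi omega)) /\
  poisson_random_measure P Phi intensity.

Definition Phi_th (omega : Omega) : set (grain R d) := thinning (Phi omega).

Definition X_th (omega : Omega) : set 'rV[R]_d := grain_cover (Phi_th omega).

(* By stationarity the reference grain may be centered at the origin. *)
Definition h_rw (r w : R) : R :=
  fine (P [set omega | thinning (Phi omega `|` [set (0, r, w)]) (0, r, w)]).

Definition h (r : R) : R := \int[G r]_w h_rw r w.

(* By stationarity and isotropy the reference grains may be centered at o and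
   u e_1. They count as two grains: if they coincide as points, they meet and
   neither outweighs the other, so that they are not both retained. *)
Definition h2_rw (u r1 w1 r2 w2 : R) : R :=
  let g1 : grain R d := (0, r1, w1) in
  let g2 : grain R d := (u *: e1 R d, r2, w2) in
  fine (P [set omega | [/\ g1 <> g2,
    thinning (Phi omega `|` [set g1; g2]) g1 &
    thinning (Phi omega `|` [set g1; g2]) g2]]).

Definition h2 (u r1 r2 : R) : R :=
  \int[G r1]_w1 \int[G r2]_w2 h2_rw u r1 w1 r2 w2.

Definition q (u r1 r2 : R) : R := h2 u r1 r2 - h r1 * h r2.

Definition lam_th : R := lam * \int[F]_r h r.

Definition F_th (r : R) : R :=
  1 - lam / lam_th * \int[F]_(s in `]r, +oo[) h s.

Definition tail_th (r : R) : R := 1 - F_th r.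

Definition p_th : R := fine (P [set omega | X_th omega 0]).

Definition k_th (z : 'rV[R]_d) : R :=
  fine (P [set omega | X_th omega 0 /\ X_th omega z]) -
  fine (P [set omega | X_th omega 0]) * fine (P [set omega | X_th omega z]).

Definition xi_th (z : 'rV[R]_d) : R :=
  lam ^+ 2 / lam_th ^+ 2 * \int[F]_r1 \int[F]_r2 q (enorm z) r1 r2.

End thinned_model.

Definition c_ad {R : realType} (alpha : R) (d : nat) : R :=
  \int[lebesgue_measure]_(r in `]0, +oo[)
    (vol (cball 0 r `&` cball (e1 R d) r) * (alpha * r `^ (- alpha - 1))).

(* Main.v *)
From HB Require Import structures.
Require Import Defs.
From mathcomp Require Import all_boot all_order all_algebra finmap.
From mathcomp Require Import all_classical all_reals all_analysis.
From mathcomp Require Import measurable_realfun.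
From mathcomp Require Import ring lra.

Set Implicit Arguments.
Unset Strict Implicit.
Unset Printing Implicit Defensive.
Import Order.TTheory GRing.Theory Num.Theory.
Import numFieldNormedType.Exports.

Local Open Scope classical_set_scope.
Local Open Scope ring_scope.

(** All weights being equal, a grain is retained iff no other grain meets it. The
    grains that meet a given ball of radius [r] are Poisson distributed with mean
    [lam * disc_mass F r], so the retention probability is
    [retain r = expR (- lam * disc_mass F r)] ([h_retain]). A ball of radius [r] is
    met by all grains centered in it, hence [disc_mass F r >= vol (cball 0 r)],
    and this gives the bound on the thinned radius distribution ([tail_th_le]).

    Two disjoint balls are both retained if no grain meets their union. Counting
    the grains that meet both of them only once gives the probability
    [retain r1 * retain r2 * expR (lam * overlap)] ([h2_retain]), where [overlap]
    is the mean number, per unit intensity, of grains that meet both. So the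
    covariance of the two retentions ([excess]) is of the order of [overlap]. For
    balls of fixed radii at distance [|z|], the overlap is asymptotically
    the mean volume of a lens, the intersection of two balls of random radius
    around [0] and [z]. Scaling by [|z|] turns this mean volume into
    [|z| ^ d] times the integral over [x] of the probability that the radius
    exceeds [|z| * tau x] ([lens_mass_tau]). By regular variation and dominated
    convergence, with a Potter bound as the dominating function, it is equivalent
    to [c_ad alpha d * rho |z|], where [rho u = u ^ d * tail F u]
    ([lens_mass_cvg]); and [rho u = ell u * u `^ (- (alpha - d))]. If one of the
    balls has a radius comparable to [|z|], its retention is exponentially
    unlikely, and that is negligible against a power of [|z|] ([excess_bound]).
    Consequently the average of the excess over two marks with respect to a
    finite measure, divided by [rho |z|], tends to
    [lam * c_ad alpha d] times the squared mean of [retain] ([excess_average]).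

    For the two-point correlation function this average is taken over radii
    only, and the squared mean is [(lam_th / lam) ^ 2]. For the cover, it is
    taken over the balls that contain a given point, and the squared mean is
    [(p_th / lam) ^ 2]; what remains is the probability that a single retained
    ball contains both [0] and [z] ([k_thE]), and such a ball has a radius of at
    least [|z| / 2], which is again exponentially unlikely.

    The cover probabilities come from a Mecke-type formula for isolated points
    ([P_isolated_in], [P_isolated_pair]). It is proved by discretization: points
    are sorted into cells of a refining sequence of countable partitions, being
    alone in the neighbourhood of one's cell is an event about finitely many
    Poisson counts in disjoint sets, and refining the partitions recovers
    isolation by monotone convergence. Any two balls that contain a given point
    meet, so at most one of them is retained; this is why the formula for an
    expected number of isolated points gives a probability. *)

(* Both names also denote operations on balls in pseudometric spaces. *)
Local Notation center := Defs.center.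
Local Notation radius := Defs.radius.

(** * Counts of a Poisson process *)

Section counting_facts.
Context {R : realType} {T : choiceType}.
Implicit Types A : set T.
Local Open Scope ereal_scope.

Lemma counting_eq0 A : (counting A = 0 :> \bar R) <-> A = set0.
Proof.
split=> [|->]; last by rewrite /counting asboolT// fset_set0.
rewrite /counting; case: asboolP => // fA [] /eqP.
by rewrite pnatr_eq0 cardfs_eq0 => /eqP/fset_set_set0; apply.
Qed.

Lemma counting_eq1 A : (counting A = 1 :> \bar R) <-> exists x, A = [set x].
Proof.
split=> [|[x ->]]; last by rewrite /counting asboolT// fset_set1 cardfs1.
rewrite /counting; case: asboolP => // fA [] /eqP.
rewrite pnatr_eq1 => /cardfs1P[x xA]; exists x.
by rewrite -(fset_setK fA) xA set_fset1.
Qed.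

Lemma counting_lty A : ~ finite_set A -> counting A = +oo :> \bar R.
Proof. by rewrite /counting; case: asboolP. Qed.

Lemma counting_fin A : finite_set A -> exists k : nat, counting A = k%:R%:E :> \bar R.
Proof. by rewrite /counting; case: asboolP => // ? _; eexists. Qed.

End counting_facts.

Section poisson_counts.
Context {R : realType} {disp : measure_display} {Omega : measurableType disp}.
Context {d : measure_display} {T : measurableType d}.
Variables (P : probability Omega R) (Phi : Omega -> set T).
Variable Lam : {measure set T -> \bar R}.
Hypothesis Phi_poisson : poisson_random_measure P Phi Lam.
Local Open Scope ereal_scope.

Lemma measurable_count_eq B (y : \bar R) : measurable B ->
  measurable [set w | count_in (R:=R) Phi B w = y].
Proof.
move=> mB; case: Phi_poisson => mc _ _.
by rewrite -[X in measurable X]setTI; exact: (mc B mB measurableT [set y]).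
Qed.

Lemma poisson_void B : measurable B -> Lam B < +oo ->
  P [set w | count_in (R:=R) Phi B w = 0] = (expR (- fine (Lam B)))%:E.
Proof.
move=> mB Boo; case: Phi_poisson => _ /(_ B mB Boo 0%N) -> _.
rewrite /poisson_prob; case: ifPn => [r0|].
  rewrite esum_set1 /poisson_pmf ?r0 ?expr0 ?fact0 ?invr1 ?mul1r//.
rewrite -leNgt => r0; have -> : fine (Lam B) = 0%R.
  by apply/eqP; rewrite eq_le r0 fine_ge0.
by rewrite oppr0 expR0 diracE mem_set.
Qed.

Lemma poisson_single B : measurable B -> Lam B < +oo ->
  P [set w | count_in (R:=R) Phi B w = 1] = Lam B * (expR (- fine (Lam B)))%:E.
Proof.
move=> mB Boo; case: Phi_poisson => _ /(_ B mB Boo 1%N) -> _.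
have fB : Lam B = (fine (Lam B))%:E by rewrite fineK// ge0_fin_numE.
rewrite /poisson_prob; case: ifPn => [r0|].
  rewrite esum_set1 /poisson_pmf ?r0 ?expr1 ?fact1 ?invr1 ?mulr1//.
    by rewrite [in RHS]fB -EFinM /= .
rewrite -leNgt => r0; have r00 : fine (Lam B) = 0%R.
  by apply/eqP; rewrite eq_le r0 fine_ge0.
by rewrite fB r00 mul0e diracE memNset.
Qed.

(** The Poisson weights of the finite counts already add up to one. *)
Lemma poisson_finite B : measurable B -> Lam B < +oo ->
  P [set w | count_in (R:=R) Phi B w = +oo] = 0.
Proof.
move=> mB Boo.
pose E k := [set w | count_in (R:=R) Phi B w = k%:R%:E :> \bar R].
have mE k : measurable (E k) by exact: measurable_count_eq.
have tE : trivIset setT E.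
  apply/trivIsetP => i j _ _ ij; apply/seteqP; split=> // w [] /=.
  rewrite /E /= => -> [] /eqP; by rewrite eqr_nat => /eqP /eqP; rewrite (negbTE ij).
have PE : P (\bigcup_k E k) = 1.
  rewrite measure_bigcup//= (@eq_eseriesr _ _
      (fun k => poisson_prob (fine (Lam B)) 0 [set k])); last first.
    by move=> k _; case: Phi_poisson => _ /(_ B mB Boo k) -> _.
  rewrite -(_ : poisson_prob (fine (Lam B)) 0 setT = 1); last first.
    exact: (@probability_setT _ _ R (poisson_prob (fine (Lam B)) 0)).
  rewrite (_ : setT = \bigcup_k [set k]); last first.
    by apply/seteqP; split=> // k _; exists k.
  rewrite measure_bigcup//=; first by apply: eq_eseriesl => k; congr (_ \in _); apply/seteqP; split=> // j _; exists j.
  apply/trivIsetP => i j _ _ ij; apply/seteqP; split=> // w [] /= -> h.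
  by move: ij; rewrite h eqxx.
rewrite (_ : [set w | _] = ~` (\bigcup_k E k)).
  rewrite probability_setC//; last exact: bigcup_measurable.
  by rewrite PE subee.
apply/seteqP; split=> [w /= h [k _]|w /= h]; first by rewrite /E /= h.
case: (pselect (finite_set (Phi w `&` B))) => [/(@counting_fin R)[k hk]|].
  by case: h; exists k.
exact: counting_lty.
Qed.

Lemma poisson_indep n (B : 'I_n -> set T) (k : 'I_n -> \bar R) :
  (forall i, measurable (B i)) -> trivIset setT B ->
  P [set w | forall i, count_in (R:=R) Phi (B i) w = k i] =
  \prod_(i < n) P [set w | count_in (R:=R) Phi (B i) w = k i].
Proof.
move=> mB tB; case: Phi_poisson => _ _ /(_ n B mB tB (fun i => [set k i])).
by apply => i.
Qed.

(** Adding the two exponents turns the three factors into a single void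
    probability of the union. *)
Lemma poisson_single_void A B : measurable A -> measurable B -> A `<=` B ->
  Lam B < +oo ->
  P [set w | count_in (R:=R) Phi A w = 1 /\ count_in (R:=R) Phi (B `\` A) w = 0] =
  Lam A * (expR (- fine (Lam B)))%:E.
Proof.
move=> mA mB AB Boo; have mBA : measurable (B `\` A) by exact: measurableD.
have Aoo : Lam A < +oo by apply: le_lt_trans Boo; apply: le_measure; rewrite ?inE.
have BAoo : Lam (B `\` A) < +oo.
  by apply: le_lt_trans Boo; apply: le_measure; rewrite ?inE.
have LE : (fine (Lam A) + fine (Lam (B `\` A)) = fine (Lam B))%R.
  rewrite -fineD ?ge0_fin_numE// -measureU ?setDIK//.
  by rewrite setDUK.
pose D (i : 'I_2) := if i == ord0 then A else B `\` A.
pose k (i : 'I_2) : \bar R := if i == ord0 then 1 else 0.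
have := @poisson_indep 2 D k; rewrite !big_ord_recl big_ord0 /= mule1.
rewrite /D /k /= poisson_single// poisson_void// -muleA -EFinM -expRD.
rewrite -opprD LE => <-.
- congr (P _); apply/seteqP; split=> w /=.
    by move=> [h1 h2] i; case: ifPn.
  by move=> h; have /= := h ord0; have /= := h (lift ord0 ord0).
- by move=> i; case: ifPn.
- apply/trivIsetP => i j _ _; case: ifPn => [/eqP->|i0]; case: ifPn => [/eqP->|j0].
  + by rewrite eqxx.
  + by move=> _; rewrite setDIK.
  + by move=> _; rewrite setIC setDIK.
  + by move: i j i0 j0 => [[|[|?]] ?] [[|[|?]] ?].
Qed.

Lemma poisson_pair_void A1 A2 B : measurable A1 -> measurable A2 ->
  measurable B -> A1 `<=` B -> A2 `<=` B -> A1 `&` A2 = set0 -> Lam B < +oo ->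
  P [set w | [/\ count_in (R:=R) Phi A1 w = 1, count_in (R:=R) Phi A2 w = 1 &
     count_in (R:=R) Phi (B `\` (A1 `|` A2)) w = 0]] =
  Lam A1 * Lam A2 * (expR (- fine (Lam B)))%:E.
Proof.
move=> mA1 mA2 mB A1B A2B A12 Boo.
have mU : measurable (A1 `|` A2) by exact: measurableU.
have mBA : measurable (B `\` (A1 `|` A2)) by exact: measurableD.
have A1oo : Lam A1 < +oo by apply: le_lt_trans Boo; apply: le_measure; rewrite ?inE.
have A2oo : Lam A2 < +oo by apply: le_lt_trans Boo; apply: le_measure; rewrite ?inE.
have BAoo : Lam (B `\` (A1 `|` A2)) < +oo.
  by apply: le_lt_trans Boo; apply: le_measure; rewrite ?inE.
have AB : A1 `|` A2 `<=` B by rewrite subUset.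
have LE : (fine (Lam A1) + (fine (Lam A2) + fine (Lam (B `\` (A1 `|` A2))))
          = fine (Lam B))%R.
  have Uoo : Lam (A1 `|` A2) < +oo.
    by apply: le_lt_trans Boo; apply: le_measure; rewrite ?inE.
  rewrite addrA -fineD ?ge0_fin_numE// -measureU// -fineD ?ge0_fin_numE//.
  by rewrite -measureU ?setDIK// setDUK.
pose D (i : 'I_3) := nth set0 [:: A1; A2; B `\` (A1 `|` A2)] i.
pose k (i : 'I_3) : \bar R := nth 0 [:: 1; 1; 0] i.
have := @poisson_indep 3 D k; rewrite !big_ord_recl big_ord0 /= mule1.
rewrite /D /k /= !poisson_single// poisson_void// => H.
have fB A : Lam A < +oo -> Lam A = (fine (Lam A))%:E.
  by move=> ?; rewrite fineK// ge0_fin_numE.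
transitivity (Lam A1 * (expR (- fine (Lam A1)))%:E *
    (Lam A2 * (expR (- fine (Lam A2)))%:E *
     (expR (- fine (Lam (B `\` (A1 `|` A2)))))%:E)); last first.
  rewrite -LE !opprD !expRD (fB A1)// (fB A2)// -!EFinM; congr EFin; rewrite /=; ring.
rewrite -H.
- congr (P _); apply/seteqP; split=> w /=.
    by move=> [h1 h2 h3] [[|[|[|?]]] ?].
  move=> h; have /= := h ord0; have /= := h (lift ord0 ord0).
  by have /= := h (lift ord0 (lift ord0 ord0)).
- by move=> [[|[|[|?]]] ?].
- have E1 : A1 `&` (B `\` (A1 `|` A2)) = set0.
    by rewrite -subset0 => x [a [_]]; apply; left.
  have E2 : A2 `&` (B `\` (A1 `|` A2)) = set0.
    by rewrite -subset0 => x [a [_]]; apply; right.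
  by apply/trivIsetP => -[[|[|[|i]]] ilt] [[|[|[|j]]] jlt] _ _ //= _ //;
    rewrite setIC.
Qed.

End poisson_counts.

(** * Isolated points of a Poisson process *)

Section retention.
Context {R : realType} {disp : measure_display} {Omega : measurableType disp}.
Context {d : measure_display} {T : measurableType d}.
Variables (P : probability Omega R) (Phi : Omega -> set T).
Variable Lam : {measure set T -> \bar R}.
Hypothesis Phi_poisson : poisson_random_measure P Phi Lam.

(* Configurations are finite in each window [K n]. The sets of points with the
   same [cell n] form countable partitions that refine each other, and [M x y]
   says that [y] prevents [x] from being isolated. *)
Variable K : nat -> set T.
Hypothesis mK : forall n, measurable (K n).
Hypothesis K_nd : forall m n, (m <= n)%N -> K m `<=` K n.
Hypothesis K_cover : forall x, exists n, K n x.
Hypothesis K_fin : forall w n, finite_set (Phi w `&` K n).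

Variable cell : nat -> T -> nat.
Hypothesis mcell : forall n k, measurable [set x | cell n x = k].
Hypothesis cell_nested : forall m n x y, (m <= n)%N ->
  cell n x = cell n y -> cell m x = cell m y.

(* [M] can be recovered from the pairs of cells that it links. *)
Variable M : T -> T -> Prop.
Hypothesis M_closed : forall x y,
  (forall n, exists x' y', [/\ cell n x' = cell n x, cell n y' = cell n y & M x' y']) ->
  M x y.

Definition linked n k l := exists x y, [/\ cell n x = k, cell n y = l & M x y].

(** An outer approximation of [M x] that only depends on the cell of [x], so that
    its emptiness is a statement about countably many counts. *)
Definition nbhood n k : set T := [set y | linked n k (cell n y)].

Hypothesis Lam_fin : forall n k, (Lam (nbhood n k) < +oo)%E.

Definition isolated w x := Phi w x /\ forall y, Phi w y -> M x y -> y = x.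

Definition isolated_in B : set Omega := [set w | exists x, B x /\ isolated w x].

Definition clique B := forall x y, B x -> B y -> M x y \/ M y x.

Let cell_set n k : set T := [set x | cell n x = k].

Lemma measurable_cell_pred n (D : nat -> Prop) : measurable [set x | D (cell n x)].
Proof.
rewrite (_ : [set _ | _] = \bigcup_(k in [set k | D k]) cell_set n k).
  by apply: bigcup_measurable => k _; exact: mcell.
by apply/seteqP; split=> [x Dx|x [k Dk /= ->]]; first by exists (cell n x).
Qed.

Lemma measurable_nbhood n k : measurable (nbhood n k).
Proof. exact: (measurable_cell_pred n (linked n k)). Qed.

Lemma nbhood_sub x y n : M x y -> nbhood n (cell n x) y.
Proof. by move=> xy; exists x, y. Qed.

Lemma linked_anti m n x y : (m <= n)%N -> linked n (cell n x) (cell n y) ->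
  linked m (cell m x) (cell m y).
Proof.
move=> mn [x' [y' [hx hy xy]]]; exists x', y'; split=> //.
  exact: cell_nested hx.
exact: cell_nested hy.
Qed.

Lemma bigcap_nbhood x : \bigcap_n nbhood n (cell n x) = M x.
Proof.
apply/seteqP; split=> y; last by move=> xy n _; exact: nbhood_sub.
by move=> h; apply: M_closed => n; have [x' [y' ?]] := h n Logic.I; exists x', y'.
Qed.

Lemma measurable_blocking x : measurable (M x).
Proof.
by rewrite -bigcap_nbhood; apply: bigcap_measurable => [|n _];
  [exists 0%N|exact: measurable_nbhood].
Qed.

Lemma nbhood_ni x m n : (m <= n)%N ->
  nbhood n (cell n x) `<=` nbhood m (cell m x).
Proof. by move=> mn y; exact: linked_anti. Qed.

(** Only finitely many points have to be told apart from [x], so a fine enough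
    level does it. *)
Lemma finite_shrink (A : set T) x : finite_set A ->
  exists n, forall y, A y -> nbhood n (cell n x) y -> M x y.
Proof.
move=> /finite_seqP[s ->]; elim: s => [|a s [n IH]]; first by exists 0%N.
case: (pselect (M x a)) => [xa|xa].
  exists n => y /=; rewrite inE => /orP[/eqP-> //|]; exact: IH.
have [m am] : exists m, ~ nbhood m (cell m x) a.
  apply: contrapT => h; apply: xa; rewrite -bigcap_nbhood => m _.
  by apply: contrapT => ?; apply: h; exists m.
exists (maxn m n) => y /=; rewrite inE => /orP[/eqP->|ys] h.
  by case: am; apply: nbhood_ni h; exact: leq_maxl.
by apply: IH => //; apply: nbhood_ni h; exact: leq_maxr.
Qed.

(** The events observable at level [n]: a point of [B] is alone, among the points
    in [A], in the neighbourhood of its cell. *)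
Definition alone n B A w x :=
  [/\ Phi w x, B x & forall y, Phi w y -> A y -> nbhood n (cell n x) y -> y = x].

Let cell_event n B A k : set Omega :=
  [set w | count_in (R:=R) Phi (cell_set n k `&` B) w = 1%E /\
    count_in (R:=R) Phi ((A `&` nbhood n k) `\` (cell_set n k `&` B)) w = 0%E].

Lemma cell_eventP n B A k w : (forall x, B x -> M x x) -> B `<=` A ->
  cell_event n B A k w <-> exists x, cell n x = k /\ alone n B A w x.
Proof.
move=> Mxx BA; split=> [[/counting_eq1[x xE] /counting_eq0 yE]|[x [<- [wx Bx xA]]]].
  have [wx [kx Bx]] : (Phi w `&` (cell_set n k `&` B)) x by rewrite xE.
  exists x; split=> //; split=> // y wy Ay; rewrite kx => ny; apply: contrapT => yx.
  have : set0 y by rewrite -yE; split=> //; split=> // By; apply: yx;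
    have : (Phi w `&` (cell_set n k `&` B)) y by []; rewrite xE.
  by [].
split.
  apply/counting_eq1; exists x; apply/seteqP; split=> [y [wy [yx By]]|_ ->//].
  apply: xA => //; first exact: BA.
  by exists y, y; rewrite yx; split=> //; exact: Mxx.
apply/counting_eq0; rewrite -subset0 => y [wy [[Ay ny] nB]]; apply: nB.
by rewrite (xA _ wy Ay ny).
Qed.

Lemma alone_cell n B A w : (forall x, B x -> M x x) -> B `<=` A ->
  (exists x, alone n B A w x) <-> exists k, cell_event n B A k w.
Proof.
move=> Mxx BA; split=> [[x ax]|[k /cell_eventP[]// x [_ ax]]]; last by exists x.
by exists (cell n x); apply/cell_eventP => //; exists x.
Qed.

Lemma measurable_cell_event n B A k : measurable B -> measurable A ->
  measurable (cell_event n B A k).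
Proof.
move=> mB mA; have mkB : measurable (cell_set n k `&` B).
  by apply: measurableI => //; exact: mcell.
apply: measurableI; apply: (measurable_count_eq Phi_poisson) => //.
by apply: measurableD => //; apply: measurableI => //; exact: measurable_nbhood.
Qed.

Lemma measurable_alone n B A : (forall x, B x -> M x x) -> B `<=` A ->
  measurable B -> measurable A -> measurable [set w | exists x, alone n B A w x].
Proof.
move=> Mxx BA mB mA; rewrite (_ : [set _ | _] = \bigcup_k cell_event n B A k).
  by apply: bigcup_measurable => k _; exact: measurable_cell_event.
by apply/seteqP; split=> w /=; rewrite alone_cell// => -[k]; [exists k|exists k].
Qed.

(** Exploring [Phi] through its finite
    restrictions to the [K n] expresses isolation by countably many observable
    events; the quantifiers over points and over [n] can be exchanged because
    the candidates form decreasing nonempty finite sets. *)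
Lemma measurable_isolated_in B : measurable B -> (forall x, B x -> M x x) ->
  measurable (isolated_in B).
Proof.
move=> mB Mxx.
rewrite (_ : isolated_in B = \bigcup_N \bigcap_m \bigcup_n
    [set w | exists x, alone n (B `&` K N) (K (N + m)) w x]).
  apply: bigcup_measurable => N _; apply: bigcap_measurable => [|m _]; first by exists 0%N.
  apply: bigcup_measurable => n _; apply: measurable_alone => //.
  - by move=> x [/Mxx].
  - by move=> x [_]; apply: K_nd; exact: leq_addr.
  - exact: measurableI.
apply/seteqP; split=> w.
  move=> [x [Bx [wx xiso]]]; have [N xN] := K_cover x; exists N => // m _.
  have [n hn] := finite_shrink x (K_fin w (N + m)%N).
  exists n => //; exists x; split=> // y wy yK ny; apply: xiso => //.
  exact: hn.
move=> [N _ h].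
pose S m := [set x | [/\ Phi w x, (B `&` K N) x &
  forall y, Phi w y -> K (N + m) y -> M x y -> y = x]].
have S0 m : S m !=set0.
  have [n _ [x [wx BKx hx]]] := h m Logic.I; exists x; split=> // y wy Ky xy.
  by apply: hx => //; exact: nbhood_sub.
have Snd m n : (m <= n)%N -> S n `<=` S m.
  move=> mn x [wx BKx hx]; split=> // y wy Ky; apply: hx => //.
  by apply: K_nd Ky; rewrite leq_add2l.
have fS : finite_set (S 0%N).
  by apply: sub_finite_set (K_fin w N) => x [wx [_ xK] _].
have [x xS] : exists x, forall m, S m x.
  apply: contrapT => hS.
  have {}hS x : exists m, ~ S m x.
    by apply: contrapT => h1; apply: hS; exists x => m; apply: contrapT => ?; apply: h1; exists m.
  have [f hf] := choice hS.
  have [n hn] : exists n, forall x, S 0%N x -> ~ S n x.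
    move/finite_seqP : fS => [s ->]; elim: s => [|a s [n IH]]; first by exists 0%N.
    exists (maxn (f a) n) => x /=; rewrite inE => /orP[/eqP->|xs] /Snd hx.
      by apply: (hf a); apply: hx; exact: leq_maxl.
    by apply: (IH _ xs); apply: hx; exact: leq_maxr.
  have [x Sx] := S0 n; apply: (hn x _ Sx); exact: Snd Sx.
have [wx [Bx _] _] := xS 0%N; exists x; split=> //; split=> // y wy xy.
have [n yn] := K_cover y; have [_ _ hx] := xS n; apply: hx => //.
by apply: K_nd yn; exact: leq_addl.
Qed.

(* Off this null event, each point has finitely many competitors at level 0, so
   that [finite_shrink] applies. *)
Let infinite_nbhood : set Omega :=
  \bigcup_k [set w | count_in (R:=R) Phi (nbhood 0 k) w = +oo%E].

Let measurable_infinite : measurable infinite_nbhood.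
Proof.
apply: bigcup_measurable => k _; apply: (measurable_count_eq Phi_poisson).
exact: measurable_nbhood.
Qed.

Let infinite_null : P infinite_nbhood = 0%E.
Proof.
apply/eqP; rewrite eq_le measure_ge0 andbT.
apply: (le_trans (measure_sigma_subadditive _ _ _ (fun w h => h))).
- by move=> k; apply: (measurable_count_eq Phi_poisson); exact: measurable_nbhood.
- exact: measurable_infinite.
- rewrite eseries0// => k _ _.
  by apply: (poisson_finite Phi_poisson); [exact: measurable_nbhood|exact: Lam_fin].
Qed.

Let shrink_alone w x : ~ infinite_nbhood w -> isolated w x ->
  exists n, forall m, (n <= m)%N -> forall y, Phi w y -> nbhood m (cell m x) y -> y = x.
Proof.
move=> fw [wx xiso].
have fin : finite_set (Phi w `&` nbhood 0 (cell 0 x)).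
  by apply: contrapT => h; apply: fw; exists (cell 0 x) => //; exact: counting_lty.
have [n hn] := finite_shrink x fin; exists n => m nm y wy ny.
apply: xiso => //; apply: hn; last exact: nbhood_ni ny.
by split=> //; exact: nbhood_ni ny.
Qed.

Lemma P_up_to_null (E E' N : set Omega) : measurable E -> measurable E' ->
  measurable N -> P N = 0%E -> E' `<=` E -> E `<=` E' `|` N -> P E = P E'.
Proof.
move=> mE mE' mN N0 E'E EE'; apply/eqP; rewrite eq_le; apply/andP; split.
  apply: (@le_trans _ _ (P (E' `|` N))).
    by apply: le_measure; rewrite ?inE//; exact: measurableU.
  by rewrite (le_trans (measureU2 _ _ _))//= N0 adde0.
by apply: le_measure; rewrite ?inE.
Qed.

(** A function of the cell is constant on each piece of a countable partition. *)
Lemma measurable_fun_cell n (f : nat -> \bar R) : measurable_fun setT (f \o cell n).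
Proof.
apply: (@measurable_comp _ _ _ _ _ _ setT) => //.
by move=> _ Y _; rewrite setTI; exact: (measurable_cell_pred n Y).
Qed.

Lemma integral_cell n (f : nat -> \bar R) B : measurable B ->
  (forall k, 0 <= f k)%E ->
  (\int[Lam]_(x in B) f (cell n x) =
   \sum_(k <oo) f k * Lam (cell_set n k `&` B))%E.
Proof.
move=> mB f0.
have BE : B = \bigcup_k (cell_set n k `&` B).
  apply/seteqP; split=> [x Bx|x [k _ []]//]; by exists (cell n x).
have mkB k : measurable (cell_set n k `&` B).
  by apply: measurableI => //; exact: mcell.
rewrite {1}BE ge0_integral_bigcup//=.
- apply: eq_eseriesr => k _.
  rewrite (eq_integral (cst (f k))) ?integral_cst//.
  by move=> x; rewrite inE => -[<-].
- by apply: measurable_funTS; exact: measurable_fun_cell.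
- apply/trivIsetP => i j _ _ ij; rewrite -subset0 => x [[xi _] [xj _]].
  by move: ij; rewrite -xi -xj eqxx.
Qed.


Let void A : \bar R := (expR (- fine (Lam A)))%:E.

Lemma void_le1 A : (0 <= void A <= 1)%E.
Proof. by rewrite !lee_fin expR_ge0/= -expR0 ler_expR oppr_le0 fine_ge0. Qed.

Lemma void_anti A B : measurable A -> measurable B -> A `<=` B ->
  (Lam B < +oo)%E -> (void B <= void A)%E.
Proof.
move=> mA mB AB Boo; have LAB : (Lam A <= Lam B)%E by apply: le_measure; rewrite ?inE.
rewrite lee_fin ler_expR lerN2 fine_le// ge0_fin_numE//.
exact: le_lt_trans Boo.
Qed.

Lemma cvg_void (A : nat -> set T) : (forall n, measurable (A n)) ->
  nonincreasing_seq A -> (Lam (A 0%N) < +oo)%E ->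
  void (A n) @[n --> \oo] --> void (\bigcap_n A n).
Proof.
move=> mA niA A0; have mI : measurable (\bigcap_n A n).
  by apply: bigcap_measurable; first by exists 0%N.
have If : Lam (\bigcap_n A n) \is a fin_num.
  rewrite ge0_fin_numE//; apply: le_lt_trans A0.
  by apply: le_measure; rewrite ?inE// => x; apply.
have /fine_cvg cA : Lam (A n) @[n --> \oo] --> (fine (Lam (\bigcap_n A n)))%:E.
  by rewrite fineK//; exact: nonincreasing_cvg_mu.
apply: cvg_EFin; first by near=> n.
apply: (@cvg_comp _ _ _ (fun n => - fine (Lam (A n))) (@expR R)); first exact: cvgN cA.
exact: continuous_expR.
Unshelve. all: by end_near. Qed.

Lemma alone_uniq n (B : set T) w x y : clique B ->
  alone n B setT w x -> alone n B setT w y -> x = y.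
Proof.
move=> cB [wx Bx hx] [wy By hy].
case: (cB x y Bx By) => /nbhood_sub h; last exact: hy.
by apply/esym/hx.
Qed.

Lemma isolated_uniq (B : set T) w x y : clique B -> B x -> B y ->
  isolated w x -> isolated w y -> x = y.
Proof.
move=> cB Bx By [wx hx] [wy hy].
by case: (cB x y Bx By) => h; [apply/esym/hx|exact: hy].
Qed.

(** Within each cell, one count equal to 1 and one empty set that is disjoint from
    it: independence gives the term of the cell, and the clique condition makes
    the events of different cells disjoint. *)
Lemma P_alone n B : measurable B -> (forall x, B x -> M x x) -> clique B ->
  P [set w | exists x, alone n B setT w x] =
  (\int[Lam]_(x in B) void (nbhood n (cell n x)))%E.
Proof.
move=> mB Mxx cB.
rewrite (@integral_cell n (fun k => void (nbhood n k)))//; last first.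
  by move=> k; rewrite lee_fin expR_ge0.
rewrite (_ : [set _ | _] = \bigcup_k cell_event n B setT k); last first.
  by apply/seteqP; split=> w /=; rewrite alone_cell// => -[k]; [exists k|exists k].
rewrite measure_semi_bigcup//=; last 3 first.
- by move=> k; exact: measurable_cell_event.
- apply/trivIsetP => i j _ _ ij; rewrite -subset0 => w [].
  move=> /cell_eventP[]// x [xi ax] /cell_eventP[]// y [yj ay].
  by move: ij; rewrite -xi -yj (alone_uniq cB ax ay) eqxx.
- by apply: bigcup_measurable => k _; exact: measurable_cell_event.
apply: eq_eseriesr => k _.
rewrite /cell_event setTI (poisson_single_void Phi_poisson)//; first by rewrite muleC.
- by apply: measurableI => //; exact: mcell.
- exact: measurable_nbhood.
- by move=> x [<- /Mxx]; exact: nbhood_sub.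
Qed.

(** For a clique [B] at most one point of [B] is isolated, so the expected number
    of isolated points of [B] is the probability that there is one; the formula
    is then the Mecke formula for the void functional. *)
Lemma P_isolated_in B : measurable B -> (forall x, B x -> M x x) -> clique B ->
  P (isolated_in B) = (\int[Lam]_(x in B) void (M x))%E.
Proof.
move=> mB Mxx cB.
pose E n := [set w | exists x, alone n B setT w x].
have mE n : measurable (E n) by exact: measurable_alone.
have ndE : nondecreasing_seq E.
  move=> m n mn; apply/subsetPset => w [x [wx Bx hx]]; exists x; split=> // y wy _ ny.
  by apply: hx => //; exact: nbhood_ni ny.
have -> : P (isolated_in B) = P (\bigcup_n E n).
  apply: (P_up_to_null _ _ measurable_infinite infinite_null).
  - exact: measurable_isolated_in.
  - exact: bigcup_measurable.
  - move=> w [n _ [x [wx Bx hx]]]; exists x; split=> //; split=> // y wy xy.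
    by apply: hx => //; exact: nbhood_sub.
  - move=> w [x [Bx ix]]; case: (pselect (infinite_nbhood w)) => fw; [by right|left].
    have [n hn] := shrink_alone fw ix; exists n => //; exists x; split=> //.
      by case: ix.
    by move=> y wy _; exact: hn.
have c1 := @nondecreasing_cvg_mu _ _ _ P E mE (bigcup_measurable (fun n _ => mE n)) ndE.
pose g n x := void (nbhood n (cell n x)).
have c2 : (\int[Lam]_(x in B) g n x)%E @[n --> \oo] -->
    (\int[Lam]_(x in B) limn (g ^~ x))%E.
  apply: cvg_monotone_convergence => //.
  - move=> n; apply: measurable_funTS.
    exact: (measurable_fun_cell n (fun k => void (nbhood n k))).
  - by move=> n x _; case/andP: (void_le1 (nbhood n (cell n x))).
  - move=> x _ m n mn; apply: void_anti => //; try exact: measurable_nbhood.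
    exact: nbhood_ni.
have -> : (\int[Lam]_(x in B) void (M x) = \int[Lam]_(x in B) limn (g ^~ x))%E.
  apply: eq_integral => x _; apply/esym/cvg_lim => //.
  rewrite -bigcap_nbhood; apply: cvg_void => //.
  - by move=> n; exact: measurable_nbhood.
  - by move=> m n mn; apply/subsetPset; exact: nbhood_ni.
apply: (cvg_unique _ c1) => //; apply: cvg_trans c2; apply: near_eq_cvg.
by apply: nearW => n; rewrite /=; apply/esym/P_alone.
Qed.


Definition unlinked n k l := ~ linked n k l /\ ~ linked n l k.

Let pair_event n B1 B2 k l : set Omega :=
  [set w | unlinked n k l /\
    [/\ count_in (R:=R) Phi (cell_set n k `&` B1) w = 1%E,
     count_in (R:=R) Phi (cell_set n l `&` B2) w = 1%E &
     count_in (R:=R) Phi ((nbhood n k `|` nbhood n l) `\`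
       ((cell_set n k `&` B1) `|` (cell_set n l `&` B2))) w = 0%E]].

Let measurable_cellI n k B : measurable B -> measurable (cell_set n k `&` B).
Proof. by move=> mB; apply: measurableI => //; exact: mcell. Qed.

Let measurable_pair_event n B1 B2 k l : measurable B1 -> measurable B2 ->
  measurable (pair_event n B1 B2 k l).
Proof.
move=> mB1 mB2; case: (pselect (unlinked n k l)) => kl; last first.
  by rewrite (_ : pair_event _ _ _ _ _ = set0)// -subset0 => w [].
rewrite (_ : pair_event n B1 B2 k l =
    [set w | count_in (R:=R) Phi (cell_set n k `&` B1) w = 1%E] `&`
    [set w | count_in (R:=R) Phi (cell_set n l `&` B2) w = 1%E] `&`
    [set w | count_in (R:=R) Phi ((nbhood n k `|` nbhood n l) `\`
       ((cell_set n k `&` B1) `|` (cell_set n l `&` B2))) w = 0%E]).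
  have mk := measurable_cellI n k mB1; have ml := measurable_cellI n l mB2.
  apply: measurableI; [apply: measurableI|];
    apply: (measurable_count_eq Phi_poisson) => //.
  by apply: measurableD; apply: measurableU => //; exact: measurable_nbhood.
by apply/seteqP; split=> [w [_ []]|w [[]]].
Qed.

Lemma pair_eventP n B1 B2 k l w :
  (forall x, B1 x -> M x x) -> (forall x, B2 x -> M x x) ->
  pair_event n B1 B2 k l w <-> exists x y, [/\ cell n x = k, cell n y = l, x <> y,
    alone n B1 setT w x & alone n B2 setT w y].
Proof.
move=> M1 M2; split.
  move=> [[kl lk] [/counting_eq1[x xE] /counting_eq1[y yE] /counting_eq0 zE]].
  have [wx [kx Bx]] : (Phi w `&` (cell_set n k `&` B1)) x by rewrite xE.
  have [wy [ly By]] : (Phi w `&` (cell_set n l `&` B2)) y by rewrite yE.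
  have xy z : Phi w z -> (nbhood n k `|` nbhood n l) z -> z = x \/ z = y.
    move=> wz nz; apply: contrapT => h.
    have : set0 z; last by [].
    rewrite -zE; split=> //; split=> // -[zk|zl]; apply: h; [left|right].
      by have : (Phi w `&` (cell_set n k `&` B1)) z by []; rewrite xE.
    by have : (Phi w `&` (cell_set n l `&` B2)) z by []; rewrite yE.
  exists x, y; split=> //.
  - by move=> h; apply: kl; exists x, x; split; [|rewrite h|exact: M1].
  - split=> // z wz _; rewrite kx => nz.
    by case: (xy z wz (or_introl nz)) => // zy; case: kl; rewrite -ly -zy.
  - split=> // z wz _; rewrite ly => nz.
    by case: (xy z wz (or_intror nz)) => // zx; case: lk; rewrite -kx -zx.
move=> [x [y [<- <- xy [wx Bx hx] [wy By hy]]]].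
split.
  split=> h; apply: xy; first exact/esym/hx.
  exact: hy.
split.
- apply/counting_eq1; exists x; apply/seteqP; split=> [z [wz [zx Bz]]|_ ->//].
  by apply: hx => //; exists z, z; rewrite zx; split=> //; exact: M1.
- apply/counting_eq1; exists y; apply/seteqP; split=> [z [wz [zx Bz]]|_ ->//].
  by apply: hy => //; exists z, z; rewrite zx; split=> //; exact: M2.
- apply/counting_eq0; rewrite -subset0 => z [wz [[nz|nz] nB]]; apply: nB.
    by left; rewrite (hx z).
  by right; rewrite (hy z).
Qed.

Let pair_void n k l : \bar R :=
  if `[< unlinked n k l >] then void (nbhood n k `|` nbhood n l) else 0%E.

Let Lam_finU n k l : (Lam (nbhood n k `|` nbhood n l) < +oo)%E.
Proof.
apply: le_lt_trans (measureU2 _ _ _) _; try exact: measurable_nbhood.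
by apply: lte_add_pinfty; exact: Lam_fin.
Qed.

Lemma pair_void_ge0 n k l : (0 <= pair_void n k l)%E.
Proof. by rewrite /pair_void; case: ifPn => // _; rewrite lee_fin expR_ge0. Qed.

(** For unlinked cells, the two points and the emptiness of the rest of both
    neighbourhoods are events about three disjoint sets. *)
Lemma P_pair_event n B1 B2 k l : measurable B1 -> measurable B2 ->
  (forall x, B1 x -> M x x) -> (forall x, B2 x -> M x x) ->
  P (pair_event n B1 B2 k l) =
  (Lam (cell_set n k `&` B1) * (pair_void n k l * Lam (cell_set n l `&` B2)))%E.
Proof.
move=> mB1 mB2 M1 M2; rewrite /pair_void; case: asboolP => kl; last first.
  rewrite mul0e mule0 (_ : pair_event _ _ _ _ _ = set0) ?measure0//.
  by rewrite -subset0 => w [].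
have s1 : cell_set n k `&` B1 `<=` nbhood n k.
  by move=> x [<- /M1]; exact: nbhood_sub.
have s2 : cell_set n l `&` B2 `<=` nbhood n l.
  by move=> x [<- /M2]; exact: nbhood_sub.
rewrite [(void _ * _)%E]muleC muleA.
rewrite -(poisson_pair_void Phi_poisson)//.
- by congr (P _); apply/seteqP; split=> [w []|].
- exact: measurable_cellI.
- exact: measurable_cellI.
- by apply: measurableU; exact: measurable_nbhood.
- by move=> x /s1; left.
- by move=> x /s2; right.
- by rewrite -subset0 => x [/s1 h [xl _]]; case: kl; rewrite -xl.
Qed.

Lemma P_two_alone n B1 B2 : measurable B1 -> measurable B2 ->
  (forall x, B1 x -> M x x) -> (forall x, B2 x -> M x x) -> clique B1 -> clique B2 ->
  P [set w | exists x y, [/\ x <> y, alone n B1 setT w x & alone n B2 setT w y]] =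
  (\int[Lam]_(x in B1) \int[Lam]_(y in B2) pair_void n (cell n x) (cell n y))%E.
Proof.
move=> mB1 mB2 M1 M2 cB1 cB2.
rewrite (@integral_cell n (fun k => \int[Lam]_(y in B2) pair_void n k (cell n y))%E)//;
  last by move=> k; apply: integral_ge0 => y _; exact: pair_void_ge0.
have mE k l := measurable_pair_event n k l mB1 mB2.
have mEE k : measurable (\bigcup_l pair_event n B1 B2 k l) by exact: bigcup_measurable.
rewrite (_ : [set _ | _] = \bigcup_k \bigcup_l pair_event n B1 B2 k l); last first.
  apply/seteqP; split=> [w [x [y [xy ax ay]]]|w [k _ [l _ /pair_eventP[]// x [y []]]]].
    by exists (cell n x) => //; exists (cell n y) => //; apply/pair_eventP => //; exists x, y.
  by move=> _ _ xy ax ay; exists x, y.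
rewrite measure_semi_bigcup//=; last 2 first.
- apply/trivIsetP => i j _ _ ij; rewrite -subset0 => w [[k _] + [l _]].
  move=> /pair_eventP[]// x [y [xi _ _ ax _]] /pair_eventP[]// x' [y' [xj _ _ ax' _]].
  by move: ij; rewrite -xi -xj (alone_uniq cB1 ax ax') eqxx.
- exact: bigcup_measurable.
apply: eq_eseriesr => k _; rewrite measure_semi_bigcup//=; last first.
- apply/trivIsetP => i j _ _ ij; rewrite -subset0 => w [].
  move=> /pair_eventP[]// x [y [_ yi _ _ ay]] /pair_eventP[]// x' [y' [_ yj _ _ ay']].
  by move: ij; rewrite -yi -yj (alone_uniq cB2 ay ay') eqxx.
rewrite (@integral_cell n (pair_void n k))//; last by move=> l; exact: pair_void_ge0.
have fk : Lam (cell_set n k `&` B1) \is a fin_num.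
  rewrite ge0_fin_numE//; apply: le_lt_trans (Lam_fin n k).
  apply: le_measure; rewrite ?inE; [exact: measurable_cellI|exact: measurable_nbhood|].
  by move=> x [<- /M1]; exact: nbhood_sub.
rewrite muleC -(fineK fk) -nneseriesZl//; last first.
  by move=> l _; apply: mule_ge0 => //; exact: pair_void_ge0.
by apply: eq_eseriesr => l _; rewrite fineK//; exact: P_pair_event.
Qed.

(** The two-point analogue: two isolated points are in particular unlinked, and
    the two cliques make the pair unique, so that again an expected number of
    pairs is a probability. *)
Lemma P_isolated_pair B1 B2 : measurable B1 -> measurable B2 ->
  (forall x, B1 x -> M x x) -> (forall x, B2 x -> M x x) -> clique B1 -> clique B2 ->
  P ((isolated_in B1 `&` isolated_in B2) `\` isolated_in (B1 `&` B2)) =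
  (\int[Lam]_(x in B1) \int[Lam]_(y in B2)
     if `[< ~ M x y /\ ~ M y x >] then void (M x `|` M y) else 0)%E.
Proof.
move=> mB1 mB2 M1 M2 cB1 cB2.
pose E n := [set w | exists x y, [/\ x <> y, alone n B1 setT w x & alone n B2 setT w y]].
have mE n : measurable (E n).
  rewrite (_ : E n = \bigcup_k \bigcup_l pair_event n B1 B2 k l).
    by apply: bigcup_measurable => k _; apply: bigcup_measurable => l _;
      exact: measurable_pair_event.
  apply/seteqP; split=> [w [x [y [xy ax ay]]]|w [k _ [l _ /pair_eventP[]// x [y []]]]].
    by exists (cell n x) => //; exists (cell n y) => //; apply/pair_eventP => //; exists x, y.
  by move=> _ _ xy ax ay; exists x, y.
have alone_nd B w x m n : (m <= n)%N -> alone m B setT w x -> alone n B setT w x.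
  move=> mn [wx Bx hx]; split=> // y wy _ ny; apply: hx => //; exact: nbhood_ni ny.
have alone_iso n B w x : alone n B setT w x -> isolated w x.
  by move=> [wx Bx hx]; split=> // y wy xy; apply: hx => //; exact: nbhood_sub.
have ndE : nondecreasing_seq E.
  move=> m n mn; apply/subsetPset => w [x [y [xy ax ay]]]; exists x, y.
  by split=> //; [exact: alone_nd ax|exact: alone_nd ay].
have -> : P ((isolated_in B1 `&` isolated_in B2) `\` isolated_in (B1 `&` B2)) =
    P (\bigcup_n E n).
  apply: (P_up_to_null _ _ measurable_infinite infinite_null).
  - apply: measurableD; last first.
      by apply: measurable_isolated_in => [|x [/M1]//]; exact: measurableI.
    by apply: measurableI; exact: measurable_isolated_in.
  - exact: bigcup_measurable.
  - move=> w [n _ [x [y [xy ax ay]]]]; have [_ B1x _] := ax; have [_ B2y _] := ay.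
    split; first by split; [exists x|exists y]; split=> //; [exact: alone_iso ax|exact: alone_iso ay].
    move=> [z [[B1z B2z] iz]]; apply: xy; transitivity z.
      exact: (isolated_uniq cB1 B1x B1z (alone_iso _ _ _ _ ax) iz).
    exact: (isolated_uniq cB2 B2z B2y iz (alone_iso _ _ _ _ ay)).
  - move=> w [[[x [B1x ix]] [y [B2y iy]]] nxy].
    case: (pselect (infinite_nbhood w)) => fw; [by right|left].
    have [n hn] := shrink_alone fw ix; have [m hm] := shrink_alone fw iy.
    exists (maxn n m) => //; exists x, y; split.
    + by move=> xy; apply: nxy; exists x; split=> //; split=> //; rewrite xy.
    + split=> //; first by case: ix.
      by move=> z wz _; apply: hn => //; exact: leq_maxl.
    + split=> //; first by case: iy.
      by move=> z wz _; apply: hm => //; exact: leq_maxr.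
have c1 := @nondecreasing_cvg_mu _ _ _ P E mE (bigcup_measurable (fun n _ => mE n)) ndE.
pose g n x y := pair_void n (cell n x) (cell n y).
have g0 n x y : (0 <= g n x y)%E by exact: pair_void_ge0.
have mg n x : measurable_fun B2 (g n x).
  by apply: measurable_funTS; exact: (measurable_fun_cell n (pair_void n (cell n x))).
have ndg x y m n : (m <= n)%N -> (g m x y <= g n x y)%E.
  move=> mn; rewrite /g /pair_void; case: asboolP => h1; last exact: pair_void_ge0.
  case: asboolP => h2; last first.
    by case: h2; case: h1 => h11 h12; split=> h; [apply: h11|apply: h12];
      exact: linked_anti h.
  apply: void_anti => //.
  - by apply: measurableU; exact: measurable_nbhood.
  - by apply: measurableU; exact: measurable_nbhood.
  - by apply: setUSS; exact: nbhood_ni.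
pose h n x := (\int[Lam]_(y in B2) g n x y)%E.
have h0 n x : (0 <= h n x)%E by exact: integral_ge0.
have ndh x m n : (m <= n)%N -> (h m x <= h n x)%E.
  by move=> mn; apply: ge0_le_integral => // y _; exact: ndg.
have c2 : (\int[Lam]_(x in B1) h n x)%E @[n --> \oo] -->
    (\int[Lam]_(x in B1) limn (h ^~ x))%E.
  apply: cvg_monotone_convergence => //; last by move=> x _ m n; exact: ndh.
  move=> n; apply: measurable_funTS.
  exact: (measurable_fun_cell n (fun k => \int[Lam]_(y in B2) pair_void n k (cell n y)))%E.
transitivity (\int[Lam]_(x in B1) limn (h ^~ x))%E.
  apply: (cvg_unique _ c1) => //; apply: cvg_trans c2; apply: near_eq_cvg.
  by apply: nearW => n; rewrite /=; apply/esym/P_two_alone.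
apply: eq_integral => x _; apply/cvg_lim => //.
rewrite (_ : (\int[Lam]_(y in B2) _ = \int[Lam]_(y in B2) limn (fun n => g n x y))%E).
  by apply: cvg_monotone_convergence => // y _ m n; exact: ndg.
apply: eq_integral => y _; apply/esym/cvg_lim => //.
case: asboolP => xy.
  have [n0 hn0] : exists n, unlinked n (cell n x) (cell n y).
    have [n1 h1] : exists n, ~ linked n (cell n x) (cell n y).
      apply: contrapT => h1; case: xy => + _; apply; rewrite -bigcap_nbhood => n _.
      by apply: contrapT => h2; apply: h1; exists n.
    have [n2 h2] : exists n, ~ linked n (cell n y) (cell n x).
      apply: contrapT => h2; case: xy => _; apply; rewrite -bigcap_nbhood => n _.
      by apply: contrapT => h3; apply: h2; exists n.
    exists (maxn n1 n2); split=> h3; [apply: h1|apply: h2]; apply: linked_anti h3;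
      [exact: leq_maxl|exact: leq_maxr].
  have gE : void (nbhood n (cell n x) `|` nbhood n (cell n y)) @[n --> \oo] -->
      void (M x `|` M y).
    rewrite (_ : M x `|` M y = \bigcap_n (nbhood n (cell n x) `|` nbhood n (cell n y))).
      apply: cvg_void => //.
      - by move=> n; apply: measurableU; exact: measurable_nbhood.
      - by move=> m n mn; apply/subsetPset; apply: setUSS; exact: nbhood_ni.
    apply/seteqP; split=> [z [xz|yz] n _|z hz]; [by left; exact: nbhood_sub|by right; exact: nbhood_sub|].
    case: (pselect (M x z)) => [|xz]; [by left|right].
    rewrite -bigcap_nbhood => n _; case: (pselect (exists m, ~ nbhood m (cell m x) z)).
      move=> [m hm]; case: (hz (maxn m n) Logic.I) => [/nbhood_ni h3|/nbhood_ni]; last first.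
        by apply; exact: leq_maxr.
      by case: hm; apply: h3; exact: leq_maxl.
    move=> hm; case: xz; rewrite -bigcap_nbhood => m _.
    by apply: contrapT => ?; apply: hm; exists m.
  apply: cvg_trans gE; apply: near_eq_cvg; near=> n.
  rewrite /g /pair_void asboolT//; have n0n : (n0 <= n)%N by near: n; exists n0.
  by case: hn0 => h1 h2; split=> h3; [apply: h1|apply: h2]; exact: linked_anti h3.
apply: cvg_near_cst; apply: nearW => n; rewrite /g /pair_void asboolF//.
by move=> [h1 h2]; apply: xy; split=> h3; [apply: h1|apply: h2]; exact: nbhood_sub.
Unshelve. all: by end_near. Qed.

End retention.

(** * Euclidean norm and Lebesgue measure *)

Section euclidean_facts.
Context {R : realType} {n : nat}.
Implicit Types x y z : 'rV[R]_n.

Definition dotv x y : R := \sum_(i < n) x ord0 i * y ord0 i.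

Lemma dotvC x y : dotv x y = dotv y x.
Proof. by apply: eq_bigr => i _; rewrite mulrC. Qed.

Lemma dotvDl x y z : dotv (x + y) z = dotv x z + dotv y z.
Proof. by rewrite -big_split; apply: eq_bigr => i _; rewrite mxE mulrDl. Qed.

Lemma dotvDr x y z : dotv x (y + z) = dotv x y + dotv x z.
Proof. by rewrite dotvC dotvDl !(dotvC x). Qed.

Lemma dotvZl a x y : dotv (a *: x) y = a * dotv x y.
Proof. by rewrite mulr_sumr; apply: eq_bigr => i _; rewrite mxE mulrA. Qed.

Lemma dotvZr a x y : dotv x (a *: y) = a * dotv x y.
Proof. by rewrite dotvC dotvZl dotvC. Qed.

Lemma dotv_ge0 x : 0 <= dotv x x.
Proof. by apply: sumr_ge0 => i _; rewrite -expr2 sqr_ge0. Qed.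

Lemma enormE x : enorm x = Num.sqrt (dotv x x).
Proof. by congr Num.sqrt; apply: eq_bigr => i _; rewrite expr2. Qed.

Lemma enorm_ge0 x : 0 <= enorm x. Proof. exact: sqrtr_ge0. Qed.

Lemma enorm_sqr x : enorm x ^+ 2 = dotv x x.
Proof. by rewrite enormE sqr_sqrtr// dotv_ge0. Qed.

Lemma enorm0 : enorm (0 : 'rV[R]_n) = 0.
Proof. by rewrite enormE -(scale0r 0) dotvZl mul0r sqrtr0. Qed.

Lemma enormZ a x : enorm (a *: x) = `|a| * enorm x.
Proof.
by rewrite !enormE dotvZl dotvZr mulrA -expr2 sqrtrM ?sqr_ge0// sqrtr_sqr.
Qed.

Lemma enormN x : enorm (- x) = enorm x.
Proof. by rewrite -scaleN1r enormZ normrN1 mul1r. Qed.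

Lemma enormB x y : enorm (x - y) = enorm (y - x).
Proof. by rewrite -enormN opprB. Qed.

Lemma enorm_eq0 x : enorm x = 0 -> x = 0.
Proof.
move=> x0; have : dotv x x = 0 by rewrite -enorm_sqr x0 expr0n.
move=> /eqP; rewrite psumr_eq0 => [/allP h|i _]; last by rewrite -expr2 sqr_ge0.
apply/rowP => i; rewrite mxE; have := h i; rewrite mem_index_enum => /(_ isT).
by rewrite -expr2 sqrf_eq0 => /eqP.
Qed.

Lemma Cauchy_Schwarz x y : dotv x y <= enorm x * enorm y.
Proof.
apply: (@le_trans _ _ `|dotv x y|); first exact: ler_norm.
rewrite -(@ler_pXn2r _ 2) ?nnegrE ?mulr_ge0 ?enorm_ge0//.
rewrite real_normK ?num_real// exprMn !enorm_sqr.
have := dotv_ge0 (dotv x x *: y + (- dotv x y) *: x).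
rewrite !dotvDl !dotvDr !dotvZl !dotvZr (dotvC y x).
set a := dotv x x; set b := dotv y y; set c := dotv x y => h.
have {h} : 0 <= a * (a * b - c ^+ 2) by move: h; rewrite [X in 0 <= X -> _](_ : _ = a * (a * b - c ^+ 2)) //; ring.
have a0 : 0 <= a by exact: dotv_ge0.
move: a0; rewrite le_eqVlt => /predU1P[a0 _|a0].
  have x0 : x = 0 by apply: enorm_eq0; apply/eqP; rewrite -sqrf_eq0 enorm_sqr -/a -a0.
  by rewrite -a0 mul0r /c x0 -(scale0r 0) dotvZl mul0r expr0n.
by rewrite pmulr_rge0// subr_ge0.
Qed.

Lemma enormD x y : enorm (x + y) <= enorm x + enorm y.
Proof.
rewrite -(@ler_pXn2r _ 2) ?nnegrE ?addr_ge0 ?enorm_ge0//.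
rewrite enorm_sqr dotvDl !dotvDr (dotvC y x) sqrrD !enorm_sqr.
by have := Cauchy_Schwarz x y; lra.
Qed.

Lemma enorm_triangle y x z : enorm (x - z) <= enorm (x - y) + enorm (y - z).
Proof. by apply: le_trans (enormD _ _); rewrite addrA subrK. Qed.

Lemma coord_le_enorm x i : `|x ord0 i| <= enorm x.
Proof.
rewrite -(@ler_pXn2r _ 2) ?nnegrE ?enorm_ge0// real_normK ?num_real// enorm_sqr.
rewrite /dotv (bigD1 i)//= expr2 lerDl; apply: sumr_ge0 => j _.
by rewrite -expr2 sqr_ge0.
Qed.

Lemma enorm_le_box x b : 0 <= b -> (forall i, `|x ord0 i| <= b) -> enorm x <= n%:R * b.
Proof.
move=> b0 xb; rewrite -(@ler_pXn2r _ 2) ?nnegrE ?enorm_ge0 ?mulr_ge0//.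
rewrite enorm_sqr; apply: (@le_trans _ _ (\sum_(i < n) b ^+ 2)).
  apply: ler_sum => i _; rewrite -expr2 -real_normK ?num_real//.
  by rewrite ler_pXn2r ?nnegrE.
rewrite sumr_const card_ord -[X in X <= _]mulr_natl exprMn; apply: ler_wpM2r; rewrite ?sqr_ge0//.
by rewrite -natrX ler_nat; case: (n) => // k; rewrite -mulnn leq_pmulr.
Qed.

Lemma measurable_enorm : measurable_fun setT (@enorm R n).
Proof.
apply: (measurableT_comp (continuous_measurable_fun (@sqrt_continuous R))).
apply: measurable_sum => i; apply: measurable_funX.
exact: measurable_coord.
Qed.

Lemma cball_sub x r y s : enorm (x - y) + r <= s -> cball x r `<=` cball y s.
Proof.
move=> h z; rewrite /cball/= => zx.
apply: le_trans (enorm_triangle x _ _) _; apply: le_trans h.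
by rewrite addrC lerD2l.
Qed.

Lemma cball_meet x y r s : (cball x r `&` cball y s !=set0) <->
  [/\ 0 <= r, 0 <= s & enorm (x - y) <= r + s].
Proof.
rewrite /cball; split=> [[z /= [xz yz]]|[r0 s0 h]].
  have r0 := le_trans (enorm_ge0 _) xz; have s0 := le_trans (enorm_ge0 _) yz.
  split=> //; apply: le_trans (enorm_triangle z _ _) _.
  by rewrite lerD// enormB.
have [rs0|rs0] := eqVneq (r + s) 0.
  have r00 : r = 0 by lra.
  have s00 : s = 0 by lra.
  exists x; rewrite /= subrr enorm0; split=> //.
  by rewrite s00 -(addr0 0) -{1}r00 -s00.
have rsp : 0 < r + s by rewrite lt_def rs0/= addr_ge0.
exists (x + (r / (r + s)) *: (y - x)); split => /=.
  rewrite addrC addKr enormZ ger0_norm ?divr_ge0 ?(ltW rsp)// enormB.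
  by rewrite mulrAC ler_pdivrMr// ler_wpM2l.
rewrite (_ : _ - y = (s / (r + s)) *: (x - y)).
  rewrite enormZ ger0_norm ?divr_ge0 ?(ltW rsp)//.
  by rewrite mulrAC ler_pdivrMr// ler_wpM2l.
apply/rowP => i; rewrite !mxE; field; exact: lt0r_neq0.
Qed.

End euclidean_facts.

Section measurable_rV.
Context {R : realType} {n : nat} {d : measure_display} {T : measurableType d}.
Implicit Types f g : T -> 'rV[R]_n.

Lemma measurable_fun_coord f i : measurable_fun setT f ->
  measurable_fun setT (fun t => f t ord0 i).
Proof. by move=> mf; exact: (measurableT_comp (measurable_coord i) mf). Qed.

Lemma measurable_rVD f g : measurable_fun setT f -> measurable_fun setT g ->
  measurable_fun setT (fun t => f t + g t).
Proof.
move=> mf mg; apply: measurable_fun_coordP => i; under eq_fun do rewrite mxE.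
by apply: measurable_funD; exact: measurable_fun_coord.
Qed.

Lemma measurable_rVZ (a : T -> R) f : measurable_fun setT a -> measurable_fun setT f ->
  measurable_fun setT (fun t => a t *: f t).
Proof.
move=> ma mf; apply: measurable_fun_coordP => i; under eq_fun do rewrite mxE.
by apply: measurable_funM => //; exact: measurable_fun_coord.
Qed.

Lemma measurable_rVB f g : measurable_fun setT f -> measurable_fun setT g ->
  measurable_fun setT (fun t => f t - g t).
Proof.
move=> mf mg; apply: measurable_rVD => //.
rewrite (_ : (fun t => - g t) = (fun t => (-1) *: g t)).
  by apply: measurable_rVZ => //; exact: measurable_cst.
by apply/funext => t; rewrite scaleN1r.
Qed.

Lemma measurable_dist f g : measurable_fun setT f -> measurable_fun setT g ->
  measurable_fun setT (fun t => enorm (f t - g t)).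
Proof.
by move=> mf mg; apply: (measurableT_comp measurable_enorm); exact: measurable_rVB.
Qed.

Lemma measurable_set_le (f g : T -> R) : measurable_fun setT f ->
  measurable_fun setT g -> measurable [set t | f t <= g t].
Proof.
by move=> mf mg; rewrite -[X in measurable X]setTI; exact: measurable_fun_le.
Qed.

End measurable_rV.

Lemma measurable_cball {R : realType} n (x : 'rV[R]_n) r : measurable (cball x r).
Proof. by apply: measurable_set_le => //; apply: measurable_dist. Qed.

Definition image_measure {R : realType} d d' (T : measurableType d)
    (T' : measurableType d') (m : {measure set T -> \bar R}) (f : T -> T')
    (mf : measurable_fun setT f) : {measure set T' -> \bar R} :=
  measure_function_pushforward__canonical__measure_function_Measure m mf.

Section lebesgue_symmetries.
Context {R : realType}.
Local Notation leb := (@lebesgue_measure R).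
Local Notation lebn := (lebesgue_rV R).

Lemma lebesgue_shift (a : R) (A : set R) : measurable A ->
  leb ((fun x => x + a) @^-1` A) = leb A.
Proof.
move=> mA; have mf : measurable_fun setT (fun x : measurableTypeR R => x + a : measurableTypeR R).
  by apply: measurable_funD.
apply/esym.
apply: (@lebesgue_measure_unique _ (image_measure leb mf)) => // _ [[b c]] _ <-.
rewrite /= /pushforward (_ : _ @^-1` _ = `]b - a, c - a]%classic).
  rewrite !lebesgue_measure_itv/= !lte_fin ltrD2r; case: ifPn => // _.
  by rewrite -!EFinB opprB addrA subrK.
by apply/seteqP; split=> x /=; rewrite !in_itv/= ltrBlDr lerBrDr.
Qed.

Lemma lebesgue_scale (a : R) (A : set R) : 0 < a -> measurable A ->
  (a%:E * leb ((fun x => (a * x)%R) @^-1` A) = leb A)%E.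
Proof.
move=> a0 mA; have mf : measurable_fun setT (fun x : measurableTypeR R => a * x : measurableTypeR R).
  by apply: measurable_funM.
have mE X : mscale (NngNum (ltW a0)) (image_measure leb mf) X =
   (a%:E * leb ((fun x => (a * x)%R) @^-1` X))%E by [].
rewrite -mE; apply/esym/lebesgue_measure_unique => // _ [[b c]] _ <-.
rewrite /= /mscale /= /pushforward (_ : _ @^-1` _ = `]b / a, c / a]%classic).
  rewrite !lebesgue_measure_itv/= !lte_fin ltr_pM2r ?invr_gt0//; case: ifPn => // _.
    rewrite -!EFinB -EFinM; congr EFin; rewrite mulrBr.
    by rewrite mulrCA divff ?mulr1 ?gt_eqF// mulrCA divff ?mulr1 ?gt_eqF.
  by rewrite mule0.
by apply/seteqP; split=> x /=; rewrite !in_itv/= ltr_pdivrMr// ler_pdivlMr// (mulrC a).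
Qed.

Lemma lebesgue_rVS n (A : set 'rV[R]_n.+1) :
  lebn n.+1 A = (leb \x lebn n)%E (@rV_cons R n @^-1` A).
Proof. by []. Qed.

Lemma measurable_preim d d' (T : measurableType d) (T' : measurableType d')
  (f : T -> T') A : measurable_fun setT f -> measurable A -> measurable (f @^-1` A).
Proof. by move=> mf mA; rewrite -[X in measurable X]setTI; exact: mf. Qed.

Lemma rV_consD n (p p' : measurableTypeR R * 'rV[R]_n) :
  rV_cons p + rV_cons p' = rV_cons (p.1 + p'.1, p.2 + p'.2).
Proof. by apply/rowP => i; rewrite !mxE; case: unlift => //= j; rewrite mxE. Qed.

Lemma rV_consZ n a (p : measurableTypeR R * 'rV[R]_n) :
  a *: rV_cons p = rV_cons (a * p.1, a *: p.2).
Proof. by apply/rowP => i; rewrite !mxE; case: unlift => //= j; rewrite mxE. Qed.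

Lemma rV_unconsK n : cancel (@rV_uncons R n) (@rV_cons R n).
Proof.
move=> x; apply/rowP => i; rewrite mxE; case: unliftP => [j ->|->] //=.
by rewrite mxE.
Qed.

Lemma dotv_cons n (p p' : measurableTypeR R * 'rV[R]_n) :
  dotv (rV_cons p) (rV_cons p') = p.1 * p'.1 + dotv p.2 p'.2.
Proof.
rewrite /dotv big_ord_recl !mxE unlift_none; congr (_ + _).
by apply: eq_bigr => j _; rewrite !mxE liftK.
Qed.

(** Fubini, one coordinate at a time. *)
Lemma lebesgue_rV_shift n (a : 'rV[R]_n) A : measurable A ->
  lebn n ((fun x => x + a) @^-1` A) = lebn n A.
Proof.
elim: n a A => [|n IH] a A mA.
  rewrite /= !diracE; congr (_%:R%:E); congr nat_of_bool.
  by apply/idP/idP; rewrite !inE/=; rewrite (_ : 0 + a = 0)//; apply/rowP => -[].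
rewrite !lebesgue_rVS.
have mA' := measurable_preim (@measurable_rV_cons R n) mA.
pose f (p : measurableTypeR R * 'rV[R]_n) : measurableTypeR R * 'rV[R]_n :=
  (p.1 + (rV_uncons a).1, p.2 + (rV_uncons a).2).
have mf1 : measurable_fun setT (fun x : measurableTypeR R => x + (rV_uncons a).1 : measurableTypeR R).
  by apply: measurable_funD.
have mf2 : measurable_fun setT (fun x : 'rV[R]_n => x + (rV_uncons a).2).
  by apply: measurable_rVD.
have mf : measurable_fun setT f.
  apply/measurable_fun_pairP; split.
    exact: (measurableT_comp mf1 measurable_fst).
  exact: (measurableT_comp mf2 measurable_snd).
rewrite (_ : _ @^-1` _ = f @^-1` (@rV_cons R n @^-1` A)); last first.
  apply/seteqP; split=> p /=;
    by rewrite -{1}(rV_unconsK a) rV_consD /f.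
apply/esym; apply: (product_measure_unique (m' := image_measure (leb \x lebn n)%E mf)) => //.
move=> X Y mX mY; rewrite /= /pushforward.
rewrite (_ : f @^-1` _ = ((fun x => x + (rV_uncons a).1) @^-1` X) `*`
  ((fun x => x + (rV_uncons a).2) @^-1` Y)) //.
rewrite product_measure1E//; [|exact: measurable_preim|exact: measurable_preim].
by congr (_ * _)%E; [exact: lebesgue_shift|exact: IH].
Qed.

Lemma lebesgue_rV_scale n (a : R) (A : set 'rV[R]_n) : 0 < a -> measurable A ->
  ((a ^+ n)%:E * lebn n ((fun x => (a *: x)%R) @^-1` A) = lebn n A)%E.
Proof.
move=> a0; elim: n A => [|n IH] A mA.
  rewrite expr0 mul1e /= !diracE; congr (_%:R%:E); congr nat_of_bool.
  by apply/idP/idP; rewrite !inE/= scaler0.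
rewrite !lebesgue_rVS.
have mA' := measurable_preim (@measurable_rV_cons R n) mA.
pose f (p : measurableTypeR R * 'rV[R]_n) : measurableTypeR R * 'rV[R]_n :=
  (a * p.1, a *: p.2).
have mf1 : measurable_fun setT (fun x : measurableTypeR R => a * x : measurableTypeR R).
  by apply: measurable_funM.
have mf2 : measurable_fun setT (fun x : 'rV[R]_n => a *: x).
  by apply: measurable_rVZ.
have mf : measurable_fun setT f.
  apply/measurable_fun_pairP; split.
    exact: (measurableT_comp mf1 measurable_fst).
  exact: (measurableT_comp mf2 measurable_snd).
rewrite (_ : _ @^-1` _ = f @^-1` (@rV_cons R n @^-1` A)); last first.
  by apply/seteqP; split=> p /=; rewrite rV_consZ /f.
have an0 : 0 < a ^+ n.+1 by exact: exprn_gt0.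
have mE X : mscale (NngNum (ltW an0)) (image_measure (leb \x lebn n)%E mf) X =
   ((a ^+ n.+1)%:E * (leb \x lebn n) (f @^-1` X))%E by [].
rewrite -mE; apply/esym/product_measure_unique => // X Y mX mY.
rewrite /= /mscale /= /pushforward (_ : f @^-1` _ = ((fun x => (a * x)%R) @^-1` X) `*`
  ((fun x => (a *: x)%R) @^-1` Y)) //.
rewrite product_measure1E//; [|exact: measurable_preim|exact: measurable_preim].
by rewrite exprS EFinM muleACA; congr (_ * _)%E; [exact: lebesgue_scale|exact: IH].
Qed.

(** Shears preserve the product measure since each section is translated. *)
Lemma shear_fst n (f : 'rV[R]_n -> measurableTypeR R) A : measurable_fun setT f -> measurable A ->
  (leb \x lebn n)%E ((fun p => (p.1 + f p.2, p.2)%R) @^-1` A) = (leb \x lebn n)%E A.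
Proof.
move=> mf mA.
have mg : measurable_fun setT (fun p : measurableTypeR R * 'rV[R]_n =>
    (p.1 + f p.2, p.2) : measurableTypeR R * 'rV[R]_n).
  apply/measurable_fun_pairP; split; last exact: measurable_snd.
  apply: (@measurable_funD _ _ R setT fst (f \o snd)); first exact: measurable_fst.
  exact: (measurableT_comp mf measurable_snd).
have swap X : measurable X -> (leb \x lebn n)%E X = (leb \x^ lebn n)%E X.
  move=> mX; apply: product_measure_unique => // Y Z mY mZ.
  exact: product_measure2E.
rewrite !swap//; last exact: measurable_preim.
apply: eq_integral => y _ /=.
rewrite -(lebesgue_shift (f y) (measurable_ysection y mA)).
congr (leb _); apply/seteqP; split=> x; rewrite /ysection /= !inE/= .
Qed.

Lemma shear_snd n (v : 'rV[R]_n) A : measurable A ->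
  (leb \x lebn n)%E ((fun p => (p.1, p.2 + p.1 *: v)%R) @^-1` A) = (leb \x lebn n)%E A.
Proof.
move=> mA; apply: eq_integral => x _ /=.
rewrite -(lebesgue_rV_shift (x *: v) (measurable_xsection x mA)).
congr (lebn n _); apply/seteqP; split=> y; rewrite /xsection /= !inE/= .
Qed.

End lebesgue_symmetries.

(** * Balls and lenses *)

Section balls.
Context {R : realType}.
Local Notation leb := (@lebesgue_measure R).
Local Notation lebn := (lebesgue_rV R).

Definition lens n (z : 'rV[R]_n) (r : R) : set 'rV[R]_n := cball 0 r `&` cball z r.

Lemma measurable_lens n (z : 'rV[R]_n) r : measurable (lens z r).
Proof. by apply: measurableI; exact: measurable_cball. Qed.

Lemma lens0 n (r : R) : lens (0 : 'rV[R]_n) r = cball 0 r.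
Proof. by rewrite /lens setIid. Qed.

Lemma lebesgue_cball n (x : 'rV[R]_n) r : lebn n (cball x r) = lebn n (cball 0 r).
Proof.
rewrite -(lebesgue_rV_shift x (measurable_cball x r)); congr (lebn n _).
by apply/seteqP; split=> y; rewrite /cball/= addrK subr0.
Qed.

Lemma lens_scale n (z : 'rV[R]_n) r (a : R) : 0 < a ->
  lebn n (lens (a *: z) (a * r)) = ((a ^+ n)%:E * lebn n (lens z r))%E.
Proof.
move=> a0; rewrite -(lebesgue_rV_scale a0 (measurable_lens _ _)).
congr (_ * lebn n _)%E; apply/seteqP.
by split=> y; rewrite /lens /cball /= !subr0 -scalerBr !enormZ !gtr0_norm// !ler_pM2l.
Qed.

Lemma e1_cons n : e1 R n.+1 = rV_cons (1, 0).
Proof.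
apply/rowP => i; rewrite !mxE; case: unliftP => [j ->|->] //=.
by rewrite mxE.
Qed.

Lemma enorm_e1 n : enorm (e1 R n.+1) = 1.
Proof. by rewrite enormE e1_cons dotv_cons/= -(scale0r 0) dotvZl mul0r addr0 mul1r sqrtr1. Qed.

(** A unit vector [z] is rotated onto [e1] in the plane they span. The rotation
    is the composition of three shears, each of which preserves Lebesgue measure
    by Fubini; only the angle pi has no such factorization, and for it the two
    lenses are translates. *)
Lemma lens_unit n (z : 'rV[R]_n.+1) r : enorm z = 1 ->
  lebn n.+1 (lens z r) = lebn n.+1 (lens (e1 R n.+1) r).
Proof.
move=> z1; have := rV_unconsK z; case: (rV_uncons z) => c y zE.
set s := enorm y.
have cs : c ^+ 2 + s ^+ 2 = 1.
  by rewrite enorm_sqr expr2 -(dotv_cons (c, y) (c, y)) zE -enorm_sqr z1 expr1n.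
have [s0|s0] := eqVneq s 0.
  have y0 : y = 0 by exact: enorm_eq0.
  have : (c - 1) * (c + 1) = 0 by move: cs; rewrite s0; lra.
  move=> /eqP; rewrite mulf_eq0 subr_eq0 addr_eq0 => /orP[] /eqP cE.
    by rewrite -zE y0 cE e1_cons.
  have -> : z = - e1 R n.+1.
    by rewrite -zE y0 cE e1_cons -[RHS]scaleN1r rV_consZ/= mulN1r scaler0.
  rewrite -[RHS](lebesgue_rV_shift (e1 R n.+1) (measurable_lens _ _)).
  congr (lebn n.+1 _); rewrite /lens setIC; apply/seteqP.
  by split=> x; rewrite /cball/= !subr0 opprK addrK.
have sp : 0 < s by rewrite lt_def s0 enorm_ge0.
have c1 : 1 + c != 0.
  apply/eqP => c1; have cE : c = -1 by lra.
  by move: cs; rewrite cE sqrrN expr1n => h; move/eqP: s0; apply; apply/eqP;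
    rewrite -sqrf_eq0; apply/eqP; lra.
have [v [vv yE]] : exists v, dotv v v = 1 /\ y = s *: v.
  exists (s^-1 *: y); rewrite dotvZl dotvZr -enorm_sqr -/s; split; first by field.
  by rewrite scalerA divff// scale1r.
pose t := s / (1 + c).
pose T1 (p : measurableTypeR R * 'rV[R]_n) : measurableTypeR R * 'rV[R]_n :=
  (p.1 + t * dotv v p.2, p.2).
pose T2 (p : measurableTypeR R * 'rV[R]_n) : measurableTypeR R * 'rV[R]_n :=
  (p.1, p.2 + p.1 *: (- s *: v)).
pose T := T1 \o T2 \o T1.
have mdot : measurable_fun setT (fun y : 'rV[R]_n => t * dotv v y : measurableTypeR R).
  apply: measurable_funM => //; apply: measurable_sum => i.
  by apply: measurable_funM => //; exact: measurable_coord.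
have mT1 : measurable_fun setT T1.
  apply/measurable_fun_pairP; split; last exact: measurable_snd.
  apply: (@measurable_funD _ _ R setT fst ((fun y => t * dotv v y) \o snd)).
    exact: measurable_fst.
  exact: (measurableT_comp mdot measurable_snd).
have mT2 : measurable_fun setT T2.
  apply/measurable_fun_pairP; split; first exact: measurable_fst.
  by apply: measurable_rVD; [exact: measurable_snd|apply: measurable_rVZ => //; exact: measurable_fst].
have TK A : measurable A -> (leb \x lebn n)%E (T @^-1` A) = (leb \x lebn n)%E A.
  move=> mA; have mA1 := measurable_preim mT1 mA; have mA2 := measurable_preim mT2 mA1.
  transitivity ((leb \x lebn n)%E (T2 @^-1` (T1 @^-1` A))).
    exact: (shear_fst mdot mA2).
  by transitivity ((leb \x lebn n)%E (T1 @^-1` A)); [exact: shear_snd|exact: (shear_fst mdot mA)].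
have normT p : enorm (rV_cons (T p)) = enorm (rV_cons p).
  rewrite !enormE !dotv_cons; congr Num.sqrt.
  case: p => a w; rewrite /T /T1 /T2 /= !(dotvDl, dotvDr, dotvZl, dotvZr) vv (dotvC w v).
  have sE : s ^+ 2 = (1 - c) * (1 + c) by lra.
  have tE : t * (1 + c) = s by rewrite /t divfK.
  have tsE : t * s = 1 - c.
    by rewrite /t mulrAC -expr2 sE mulfK.
  set m := dotv v w; set b := a + t * m.
  have bE : t * (m - s * b) = t * m - (1 - c) * b by rewrite -tsE; ring.
  (* the identity only uses s ^ 2 + c ^ 2 = 1, through t *)
  have -> : b + t * (m + b * (- s * 1)) = c * b + t * m.
    by transitivity (b + t * (m - s * b)); [ring|rewrite bE; ring].
  have h : (c * b + t * m) ^+ 2 + s ^+ 2 * b ^+ 2 - 2 * s * b * m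
        = (b - t * m) ^+ 2.
    have -> : s ^+ 2 = 1 - c ^+ 2 by lra.
    have -> : 2 * s * b * m = 2 * (t * (1 + c)) * b * m by rewrite tE.
    ring.
  have aE : a = b - t * m by rewrite /b addrK.
  have -> : a * a = (c * b + t * m) ^+ 2 + s ^+ 2 * b ^+ 2 - 2 * s * b * m.
    by rewrite h -aE expr2.
  ring.
have linT p p' : rV_cons (T p) - rV_cons (T p') = rV_cons (T (p.1 - p'.1, p.2 - p'.2)).
  case: p p' => [a w] [a' w']; rewrite -[- rV_cons _]scaleN1r rV_consZ rV_consD.
  congr rV_cons; rewrite /T /T1 /T2 /=; congr pair.
    rewrite !(dotvDr, dotvZr) -[- w']scaleN1r !dotvZr; ring.
  rewrite -[- w']scaleN1r !(dotvDr, dotvZr).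
  apply/rowP => i; rewrite !mxE; ring.
have TzE : T (c, y) = (1, 0).
  have sE : s ^+ 2 = (1 - c) * (1 + c) by lra.
  have tsE : t * s = 1 - c by rewrite /t mulrAC -expr2 sE mulfK.
  have b1 : c + t * dotv v y = 1 by rewrite yE dotvZr vv mulr1 tsE; ring.
  have e0 : y + 1 *: (- s *: v) = 0 by rewrite scale1r scaleNr -yE subrr.
  rewrite /T /T1 /T2 /= b1 e0.
  by rewrite -(scale0r (0 : 'rV[R]_n)) dotvZr mul0r mulr0 addr0.
have LE : @rV_cons R n @^-1` lens z r = T @^-1` (@rV_cons R n @^-1` lens (e1 R n.+1) r).
  apply/seteqP; split=> p; rewrite /lens /cball /= !subr0 -zE e1_cons -TzE linT !normT;
  by rewrite -[- rV_cons _]scaleN1r rV_consZ rV_consD/= scaleN1r mulN1r.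
rewrite !lebesgue_rVS LE TK//; apply: measurable_preim; first exact: measurable_rV_cons.
exact: measurable_lens.
Qed.

Lemma lensE n (z : 'rV[R]_n.+1) r : 0 < enorm z ->
  lebn n.+1 (lens z r) =
  ((enorm z ^+ n.+1)%:E * lebn n.+1 (lens (e1 R n.+1) (r / enorm z)))%E.
Proof.
move=> z0.
have u1 : enorm ((enorm z)^-1 *: z) = 1.
  by rewrite enormZ gtr0_norm ?invr_gt0// mulVf ?gt_eqF.
rewrite -(lens_unit (r / enorm z) u1) -(lens_scale _ _ z0).
by rewrite scalerA divff ?gt_eqF// scale1r mulrCA divff ?gt_eqF// mulr1.
Qed.

Lemma cball_scaleM n (a r : R) : 0 < a ->
  lebn n (cball 0 (a * r)) = ((a ^+ n)%:E * lebn n (cball 0 r))%E.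
Proof. by move=> a0; rewrite -!lens0 -lens_scale// scaler0. Qed.

Lemma cball_scale n (r : R) : 0 < r ->
  lebn n (cball 0 r) = ((r ^+ n)%:E * lebn n (cball 0 1))%E.
Proof. by move=> r0; rewrite -cball_scaleM// mulr1. Qed.

Lemma lebesgue_cball_lty n (x : 'rV[R]_n) (r : R) : (lebn n (cball x r) < +oo)%E.
Proof.
rewrite lebesgue_cball; have [r0|r0] := ltP r 0.
  rewrite (_ : cball 0 r = set0) ?measure0// -subset0 => y /=.
  by rewrite /cball/= => yr; have := le_trans (enorm_ge0 _) yr; rewrite leNgt r0.
apply: (@le_lt_trans _ _ (lebn n [set x | forall i, x ord0 i \in `[- r, r]])).
  apply: le_measure; rewrite ?inE; [exact: measurable_cball|exact: measurable_box|].
  move=> y; rewrite /cball/= subr0 => yr i; rewrite in_itv/= -ler_norml.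
  exact: le_trans (coord_le_enorm _ _) yr.
rewrite (@lebesgue_rV_box _ n (fun=> - r) (fun=> r)) ?ltry// => i.
by rewrite -subr_ge0 opprK addr_ge0.
Qed.

Lemma lebesgue_cball_gt0 n (x : 'rV[R]_n) (r : R) : 0 < r -> (0 < lebn n (cball x r))%E.
Proof.
move=> r0; rewrite lebesgue_cball.
pose b := r / n.+1%:R; have b0 : 0 < b by rewrite divr_gt0.
apply: (@lt_le_trans _ _ (lebn n [set x | forall i, x ord0 i \in `[- b, b]])).
  rewrite (@lebesgue_rV_box _ n (fun=> - b) (fun=> b)) ?lte_fin.
    by apply: prodr_gt0 => i _; rewrite opprK addr_gt0.
  by move=> i; rewrite -subr_ge0 opprK addr_ge0 ?ltW.
apply: le_measure; rewrite ?inE; [exact: measurable_box|exact: measurable_cball|].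
move=> y; rewrite /cball/= subr0 => yb.
apply: (@le_trans _ _ (n%:R * b)).
  by apply: enorm_le_box => [|i]; [exact: ltW|have := yb i; rewrite in_itv/= ler_norml].
by rewrite /b mulrCA ger_pMr// ler_pdivrMr// mul1r ler_nat.
Qed.

Lemma lebesgue_set1 n (x : 'rV[R]_n.+1) : lebn n.+1 [set x] = 0%E.
Proof.
apply/eqP; rewrite eq_le measure_ge0 andbT.
rewrite (_ : [set x] = [set y | forall i, y ord0 i \in `[x ord0 i, x ord0 i]]).
  rewrite (@lebesgue_rV_box _ _ (fun i => x ord0 i) (fun i => x ord0 i))//.
  by rewrite big_ord_recl subrr mul0r.
apply/seteqP; split=> [y -> i|y yx]; first by rewrite in_itv/= lexx.
apply/rowP => i; have := yx i; rewrite in_itv/= => h; apply/eqP.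
by rewrite eq_le andbC.
Qed.

End balls.

(** * Powers *)

Section power_facts.
Context {R : realType}.
Implicit Types x y b : R.

Lemma powRN_anti b x y : 0 <= b -> 0 < x -> x <= y -> y `^ (- b) <= x `^ (- b).
Proof.
move=> b0 x0 xy; have y0 : 0 < y by exact: lt_le_trans xy.
rewrite !powRN lef_pV2 ?posrE ?powR_gt0//.
by apply: ge0_ler_powR => //; rewrite nnegrE ltW.
Qed.

Lemma dyadic_scale x : 1 <= x -> exists k : nat, 2 ^+ k <= x < 2 ^+ k.+1.
Proof.
move=> x1; have x0 : 0 <= x by exact: le_trans x1.
have t0 : (0 < Num.truncn x)%N by rewrite Num.Theory.truncn_ge_nat.
exists (trunc_log 2 (Num.truncn x)); have /andP[h1 h2] := Num.Theory.truncn_itv x0.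
apply/andP; split.
  by apply: le_trans h1; rewrite -natrX ler_nat trunc_logP.
by apply: lt_le_trans h2 _; rewrite -natrX ler_nat trunc_log_ltn.
Qed.

Lemma powR2_expr b k : (2 : R) `^ b ^+ k = (2 ^+ k) `^ b.
Proof. by rewrite -powR_mulrn ?powR_ge0// -powRrM -[in RHS](@powR_mulrn _ 2)// -powRrM mulrC. Qed.

Lemma continuous_powR b y : 0 < y -> {for y, continuous (fun x => x `^ b)}.
Proof.
move=> y0; apply: differentiable_continuous; apply/derivable1_diffP.
by apply: derivable_powR; rewrite in_itv/= y0.
Qed.

Lemma powR_cvg0y b : 0 < b -> x `^ (- b) @[x --> +oo] --> (0 : R).
Proof.
move=> b0; apply/cvgrPdist_lt => e e0; near=> x.
have x1 : e `^ (- b^-1) < x by near: x; exact: nbhs_pinfty_gt.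
have x0 : 0 < x by apply: le_lt_trans x1; exact: powR_ge0.
rewrite sub0r normrN ger0_norm ?powR_ge0// powRN invf_plt ?posrE ?powR_gt0//.
have -> : e^-1 = (e `^ (- b^-1)) `^ b.
  by rewrite -powRrM mulNr mulVf ?gt_eqF// powRN powRr1// ltW.
by apply: gt0_ltr_powR => //; rewrite nnegrE ?powR_ge0// ltW.
Unshelve. all: by end_near. Qed.

Lemma integral_power b (t : R) : 0 < b -> 0 < t ->
  (\int[lebesgue_measure]_(r in `[t, +oo[) (b * r `^ (- b - 1))%:E = (t `^ (- b))%:E)%E.
Proof.
move=> b0 t0.
pose Fb (r : R) := - r `^ (- b).
have dF r : 0 < r -> derivable Fb r 1.
  by move=> r0; apply: derivableN; apply: derivable_powR; rewrite in_itv/= r0.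
have cp c r : 0 < r -> {for r, continuous (fun x => c * x `^ (- b - 1))}.
  by move=> r0; apply: continuousM; [exact: cvg_cst|exact: continuous_powR].
rewrite (@ge0_continuous_FTC2y _ _ Fb _ 0).
- by rewrite /Fb EFinN oppeK add0e.
- by move=> x _; rewrite mulr_ge0 ?powR_ge0 ?ltW.
- apply: continuous_in_subspaceT => x; rewrite inE/= in_itv/= andbT => tx.
  by apply: cp; exact: lt_le_trans tx.
- by rewrite -oppr0; apply: cvgN; exact: powR_cvg0y.
- by move=> x tx; apply: dF; exact: lt_trans tx.
- apply: cvg_at_right_filter; apply: cvgN; exact: continuous_powR.
- move=> x; rewrite in_itv/= andbT => tx; have x0 : 0 < x by exact: lt_trans tx.
  rewrite derive1E deriveN; last by apply: derivable_powR; rewrite in_itv/= x0.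
  by rewrite -derive1E powR_derive1 ?in_itv/= ?x0// mulNr opprK.
Qed.

End power_facts.

(** * Regularly varying tails *)

Section tails.
Context {R : realType}.
Variables (F : probability (measurableTypeR R) R) (alpha : R).
Hypothesis F_Rplus : F `]-oo, 0[%classic = 0%E.
Hypothesis F_power_law : power_law F alpha.

Lemma F_fin_num A : measurable A -> F A \is a fin_num.
Proof. by move=> mA; rewrite ge0_fin_numE//; apply: le_lt_trans (probability_le1 F mA) _; rewrite ltry. Qed.

Lemma F_itv0y : F `[0, +oo[%classic = 1%E.
Proof.
rewrite -(setCK `[0, +oo[%classic) probability_setC; last exact: measurableC.
by rewrite setCitvr F_Rplus sube0.
Qed.

Lemma tail_itv t : 0 <= t -> (tail F t)%:E = F `]t, +oo[%classic.
Proof.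
move=> t0; rewrite /tail /cdf0 EFinB fineK ?F_fin_num//.
have -> : (1%:E = F `[0%R, t]%classic + F `]t, +oo[%classic)%E.
  rewrite -measureU//.
    rewrite -F_itv0y; congr (F _); apply/seteqP; split=> x /=; rewrite !in_itv/= !andbT.
      by move=> x0; case: (leP x t) => xt; [left; rewrite x0|right].
    by move=> [/andP[]//|tx]; apply: le_trans t0 (ltW tx).
  rewrite -subset0 => x /=; rewrite !in_itv/= andbT => -[/andP[_ xt] tx].
  by move: tx; rewrite ltNge xt.
by rewrite [X in (X - _)%E]addeC addeK// F_fin_num.
Qed.

Lemma tail_ge0 t : 0 <= t -> 0 <= tail F t.
Proof. by move=> t0; rewrite -lee_fin tail_itv. Qed.

Lemma tail_anti s t : 0 <= s -> s <= t -> tail F t <= tail F s.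
Proof.
move=> s0 st; rewrite -lee_fin !tail_itv ?(le_trans s0 st)//.
apply: le_measure; rewrite ?inE// => x /=; rewrite !in_itv/= !andbT.
exact: le_lt_trans.
Qed.

Lemma tail_gt0_near : exists2 t0 : R, 0 < t0 & forall t, t0 <= t -> 0 < tail F t.
Proof.
case: F_power_law => _ [M [Mr h]] _; exists (`|M| + 1); first by rewrite ltr_pwDr.
move=> t ht; apply: h; apply: lt_le_trans ht; rewrite (le_lt_trans (ler_norm _))// ltrDl//.
Qed.

Lemma tail_ratio a : 0 < a -> tail F (a * t) / tail F t @[t --> +oo] --> a `^ (- alpha).
Proof. by case: F_power_law => _ _; apply. Qed.

Lemma pinfty_near_ge (Q : R -> Prop) : (\forall t \near +oo, Q t) ->
  exists2 t0 : R, 0 < t0 & forall t, t0 <= t -> Q t.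
Proof.
move=> [M [Mr h]]; exists (`|M| + 1); first by rewrite ltr_pwDr.
move=> t ht; apply: h; apply: lt_le_trans ht; rewrite (le_lt_trans (ler_norm _))// ltrDl//.
Qed.

(** Potter-type bounds. As [tail F] is monotone, they follow by iterating the
    single ratio at 2 along a dyadic scale, without uniform convergence. *)
Lemma tail_upper b : 0 <= b -> b < alpha -> exists2 t0 : R, 0 < t0 &
  forall t x, t0 <= t -> 1 <= x -> tail F (x * t) <= 2 `^ b * x `^ (- b) * tail F t.
Proof.
move=> b0 ba; have [t1 t10 pos] := tail_gt0_near.
have h2 : (2 : R) `^ (- alpha) < 2 `^ (- b).
  by rewrite !powRN ltf_pV2 ?posrE ?powR_gt0// /powR gt_eqF// ltr_expR ltr_pM2r// ln_gt0// ltr1n.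
have [t2 t20 ratio] := pinfty_near_ge (cvgr_lt _ (tail_ratio (ltr0Sn R 1)) _ h2).
exists (Num.max t1 t2); first by rewrite lt_max t10.
move=> t x; rewrite ge_max => /andP[t1t t2t] x1.
have t0 : 0 < t by exact: lt_le_trans t1t.
have step k : tail F (2 ^+ k * t) <= (2 `^ (- b)) ^+ k * tail F t.
  elim: k => [|k IH]; first by rewrite !expr0 !mul1r.
  have kt : t <= 2 ^+ k * t by apply: ler_peMl; [exact: ltW|apply: exprn_ege1; rewrite ler1n].
  have := ratio (2 ^+ k * t) (le_trans t2t kt).
  rewrite ltr_pdivrMr ?(pos _ (le_trans t1t kt))// => /ltW.
  rewrite !exprS -!mulrA => /le_trans; apply; apply: ler_wpM2l => //; exact: powR_ge0.
have [k /andP[kx xk]] := dyadic_scale x1.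
apply: (@le_trans _ _ (tail F (2 ^+ k * t))).
  by apply: tail_anti; [rewrite mulr_ge0 ?exprn_ge0 ?ltW|rewrite ler_pM2r].
apply: le_trans (step k) _; apply: ler_wpM2r; first by rewrite tail_ge0 ?ltW.
rewrite powR2_expr.
have -> : (2 `^ b * x `^ (- b) = (x / 2) `^ (- b) :> R).
  rewrite powRM ?invr_ge0 ?(le_trans _ x1)// mulrC; congr (_ * _).
  by rewrite -(@powR_inv1 _ 2)// -powRrM mulrNN mul1r.
apply: powRN_anti => //; first by rewrite divr_gt0// (lt_le_trans _ x1).
by rewrite ler_pdivrMr// -exprSr ltW.
Qed.

Lemma tail_lower b : 0 <= b -> alpha < b -> exists2 t0 : R, 0 < t0 &
  forall t x, t0 <= t -> 1 <= x -> (2 * x) `^ (- b) * tail F t <= tail F (x * t).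
Proof.
move=> b0 ba; have [t1 t10 pos] := tail_gt0_near.
have h2 : (2 : R) `^ (- b) < 2 `^ (- alpha).
  by rewrite !powRN ltf_pV2 ?posrE ?powR_gt0// /powR gt_eqF// ltr_expR ltr_pM2r// ln_gt0// ltr1n.
have [t2 t20 ratio] := pinfty_near_ge (cvgr_gt _ (tail_ratio (ltr0Sn R 1)) _ h2).
exists (Num.max t1 t2); first by rewrite lt_max t10.
move=> t x; rewrite ge_max => /andP[t1t t2t] x1.
have t0 : 0 < t by exact: lt_le_trans t1t.
have step k : (2 `^ (- b)) ^+ k * tail F t <= tail F (2 ^+ k * t).
  elim: k => [|k IH]; first by rewrite !expr0 !mul1r.
  have kt : t <= 2 ^+ k * t by apply: ler_peMl; [exact: ltW|apply: exprn_ege1; rewrite ler1n].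
  have := ratio (2 ^+ k * t) (le_trans t2t kt).
  rewrite ltr_pdivlMr ?(pos _ (le_trans t1t kt))// => /ltW.
  rewrite !exprS -!mulrA; apply: le_trans; apply: ler_wpM2l => //; exact: powR_ge0.
have [k /andP[kx xk]] := dyadic_scale x1.
apply: (@le_trans _ _ (tail F (2 ^+ k.+1 * t))); last first.
  apply: tail_anti; first by rewrite mulr_ge0 ?ltW// (lt_le_trans _ x1).
  by rewrite ler_pM2r// ltW.
apply: le_trans (step k.+1); apply: ler_wpM2r; first by rewrite tail_ge0 ?ltW.
rewrite powR2_expr; apply: powRN_anti; rewrite ?exprn_gt0//.
by rewrite exprS ler_pM2l.
Qed.

(** The tail is bounded below by a negative power of degree [m], and the term of
    degree [m] of the exponential series beats it. *)
Lemma exp_tail c : 0 < c -> exists C u0 : R, [/\ 0 <= C, 0 < u0 &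
  forall u, u0 <= u -> expR (- (c * u)) <= C * tail F u].
Proof.
move=> c0; pose m := (Num.truncn (`|alpha|)).+1.
have am : alpha < m%:R by apply: le_lt_trans (ler_norm _) _; apply: Num.Theory.truncnS_gt.
have [t0 t00 low] := tail_lower (ler0n R m) am.
have [t1 t10 pos] := tail_gt0_near.
pose t := Num.max t0 t1.
have tpos : 0 < t by rewrite lt_max t00.
have Ft : 0 < tail F t by apply: pos; rewrite le_max lexx orbT.
have coef_ge0 : 0 <= m`!%:R / c ^+ m * (2 / t) ^+ m / tail F t.
  apply: divr_ge0 (ltW Ft); apply: mulr_ge0.
    by apply: divr_ge0 => //; apply: exprn_ge0; exact: ltW.
  by apply: exprn_ge0; apply: divr_ge0 => //; exact: ltW.
exists (m`!%:R / c ^+ m * (2 / t) ^+ m / tail F t), t; split => //.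
move=> u tu; have u0 : 0 < u by exact: lt_le_trans tu.
have := low t (u / t); rewrite le_max lexx orTb ler_pdivlMr// mul1r divfK ?gt_eqF//.
move=> /(_ isT tu); rewrite powR_invn; last by rewrite mulr_ge0// divr_ge0 ?ltW.
have p2 : 0 < 2 * (u / t) by rewrite mulr_gt0// divr_gt0.
rewrite ler_pdivrMl ?exprn_gt0// => h.
have h3 : (c * u) ^+ m / m`!%:R <= expR (c * u).
  have := @expR_ge1Dxn _ (c * u) (Num.truncn `|alpha|) (mulr_ge0 (ltW c0) (ltW u0)).
  by apply: le_trans; rewrite lerDr.
rewrite expRN -[leLHS]div1r ler_pdivrMr ?expR_gt0//.
have fpos : 0 < m`!%:R :> R by rewrite ltr0n fact_gt0.
apply: (@le_trans _ _ (m`!%:R / c ^+ m * (2 / t) ^+ m / tail F t * tail F u * ((c * u) ^+ m / m`!%:R))).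
  have -> : m`!%:R / c ^+ m * (2 / t) ^+ m / tail F t * tail F u * ((c * u) ^+ m / m`!%:R)
     = (2 * (u / t)) ^+ m * tail F u / tail F t.
    rewrite !exprMn !exprVn; field; rewrite !gt_eqF// exprn_gt0//.
  by rewrite ler_pdivlMr// mul1r.
apply: ler_wpM2l => //; apply: mulr_ge0; last by rewrite tail_ge0 ?ltW.
exact: coef_ge0.
Qed.

(** Shifting by [a] and closing the interval change [t * y] by less than a factor
    [r] close to 1 does, once [t] is large. *)
Lemma tail_ge_limit a y : 0 <= a -> 0 < y ->
  fine (F `[t * y - a, +oo[%classic) / tail F t @[t --> +oo] --> y `^ (- alpha).
Proof.
move=> a0 y0; have [t1 t10 pos] := tail_gt0_near.
have tl : tail F (t * y) / tail F t @[t --> +oo] --> y `^ (- alpha).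
  rewrite (_ : (fun t => _) = (fun t => tail F (y * t) / tail F t)); first exact: tail_ratio.
  by apply/funext => t; rewrite [y * t]mulrC.
apply/cvgrPdist_lt => e e0.
have [r /andP[r0 r1] hr] : exists2 r : R, 0 < r < 1 & (r * y) `^ (- alpha) < y `^ (- alpha) + e.
  have c1 : (fun r : R => (r * y) `^ (- alpha)) @ (1 : R)^'- --> (1 * y) `^ (- alpha).
    apply: cvg_at_left_filter.
    apply: (@cvg_comp _ _ _ (fun r => r * y) (fun x => x `^ (- alpha))).
      by apply: cvgMr_tmp; exact: cvg_id.
    by apply: continuous_powR; rewrite mul1r.
  rewrite mul1r in c1; have h1 : y `^ (- alpha) < y `^ (- alpha) + e by rewrite ltrDl.
  near (1:R)^'- => r; exists r; last by near: r; exact: (cvgr_lt _ c1 _ h1).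
  by apply/andP; split; near: r; [exact: nbhs_left_gt|exact: nbhs_left_lt].
have ru : tail F (t * (r * y)) / tail F t @[t --> +oo] --> (r * y) `^ (- alpha).
  rewrite (_ : (fun t => _) = (fun t => tail F (r * y * t) / tail F t)).
    by apply: tail_ratio; exact: mulr_gt0.
  by apply/funext => t; rewrite [r * y * t]mulrC.
near=> t.
have t0 : 0 < t by near: t; apply: nbhs_pinfty_gt; exact: num_real.
have Ft : 0 < tail F t.
  by apply: pos; near: t; apply: nbhs_pinfty_ge; exact: num_real.
have low : tail F (t * y) <= fine (F `[t * y - a, +oo[%classic).
  rewrite -lee_fin tail_itv; last by apply: mulr_ge0; rewrite ?mulr_ge0 ?ltW.
  rewrite fineK ?F_fin_num//.
  apply: le_measure; rewrite ?inE// => x /=; rewrite !in_itv/= !andbT => /ltW h.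
  by rewrite lerBlDr (le_trans h)// lerDl.
have at_ : a / (y * (1 - r)) < t by near: t; apply: nbhs_pinfty_gt; exact: num_real.
have up : fine (F `[t * y - a, +oo[%classic) <= tail F (t * (r * y)).
  rewrite -lee_fin tail_itv; last by apply: mulr_ge0; rewrite ?mulr_ge0 ?ltW.
  rewrite fineK ?F_fin_num//.
  apply: le_measure; rewrite ?inE// => x /=; rewrite !in_itv/= !andbT.
  apply: lt_le_trans; rewrite ltrBrDl.
  move: at_; rewrite ltr_pdivrMr ?mulr_gt0 ?subr_gt0//; lra.
have l1 : y `^ (- alpha) - e < tail F (t * y) / tail F t.
  by near: t; apply: (cvgr_gt _ tl); rewrite ltrBlDr ltrDl.
have l2 : tail F (t * (r * y)) / tail F t < y `^ (- alpha) + e.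
  by near: t; exact: (cvgr_lt _ ru _ hr).
rewrite distrC ltr_distl; apply/andP; split.
  by apply: lt_le_trans l1 _; rewrite ler_pM2r ?invr_gt0.
by apply: le_lt_trans l2; rewrite ler_pM2r ?invr_gt0.
Unshelve. all: by end_near. Qed.

End tails.

(** * The constant of the covariance asymptotics *)

Section tau.
Context {R : realType} {n : nat}.
Local Notation leb := (@lebesgue_measure R).
Local Notation lebn := (lebesgue_rV R n.+1).
Local Notation e1 := (e1 R n.+1).

(** The smallest radius for which both balls of the reference lens reach [x]. *)
Definition tau (x : 'rV[R]_n.+1) : R := Num.max (enorm x) (enorm (x - e1)).

Lemma lens_tau x r : lens e1 r x <-> tau x <= r.
Proof. by rewrite /lens /cball /tau /= subr0 ge_max; split=> [[-> ->]|/andP[]]. Qed.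

Lemma tau_ge_half x : 2^-1 <= tau x.
Proof.
have : enorm e1 <= enorm x + enorm (x - e1).
  have := enorm_triangle x e1 0; rewrite !subr0 enormB; lra.
rewrite enorm_e1 /tau => h; rewrite le_max; case: (leP 2^-1 (enorm x)) => //= hx; lra.
Qed.

Lemma tau_gt0 x : 0 < tau x.
Proof. by apply: lt_le_trans (tau_ge_half x). Qed.

Lemma measurable_tau : measurable_fun setT tau.
Proof.
apply: measurable_maxr; first exact: measurable_enorm.
exact: measurable_dist.
Qed.

(** Tonelli: [tau x `^ (- b)] is the mass of [`[tau x, +oo[] for the density
    [b * r `^ (- b - 1)]. *)
Lemma integral_tau b : 0 < b ->
  (\int[lebn]_x (tau x `^ (- b))%:E =
   \int[leb]_(r in `]0%R, +oo[) (lebn (lens e1 r) * (b * r `^ (- b - 1))%:E))%E.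
Proof.
move=> b0.
pose f (p : 'rV[R]_n.+1 * measurableTypeR R) : \bar R :=
  ((\1_[set p | tau p.1 <= p.2] p)%:E * (b * p.2 `^ (- b - 1))%:E)%E.
have mS : measurable [set p : 'rV[R]_n.+1 * measurableTypeR R | tau p.1 <= p.2].
  apply: measurable_set_le; last exact: measurable_snd.
  exact: (measurableT_comp measurable_tau measurable_fst).
have mpow : measurable_fun setT (fun r : measurableTypeR R => (b * r `^ (- b - 1))%:E).
  by apply/measurable_EFinP; apply: measurable_funM => //; exact: measurable_powR.
have mf : measurable_fun setT f.
  apply: emeasurable_funM; first by apply/measurable_EFinP; exact: measurable_indic.
  exact: (measurableT_comp mpow measurable_snd).
have pow_ge0 r : 0 <= b * r `^ (- b - 1) by rewrite mulr_ge0 ?powR_ge0 ?ltW.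
have f0 p : (0 <= f p)%E by apply: mule_ge0; rewrite lee_fin// indicE ler0n.
transitivity (\int[lebn]_x \int[leb]_r f (x, r))%E.
  apply: eq_integral => x _; rewrite -(integral_power b0 (tau_gt0 x)) integral_mkcond.
  apply: eq_integral => r _; rewrite /f /patch indicE.
  have -> : ((x, r) \in [set p : 'rV[R]_n.+1 * measurableTypeR R | tau p.1 <= p.2]) =
      (r \in `[tau x, +oo[%classic).
    by apply/idP/idP; rewrite !inE/= in_itv/= andbT.
  by case: ifPn => _; rewrite ?mul1e ?mul0e.
rewrite (fubini_tonelli f)// [RHS]integral_mkcond; apply: eq_integral => r _.
have lensE s : (\int[lebn]_x f (x, s) = lebn (lens e1 s) * (b * s `^ (- b - 1))%:E)%E.
  rewrite /f /=.
  under eq_integral => x _.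
    rewrite (_ : \1__ (x, s) = \1_(lens e1 s) x); last first.
      rewrite !indicE; congr (_%:R); congr nat_of_bool; apply/idP/idP; rewrite !inE/=;
        by move=> /lens_tau.
    over.
  rewrite ge0_integralZr//.
  - by rewrite integral_indic ?setIT//; exact: measurable_lens.
  - by apply/measurable_EFinP; apply: measurable_indic; exact: measurable_lens.
  - by rewrite lee_fin.
rewrite lensE /patch; case: ifPn => // r0.
rewrite (_ : lens e1 r = set0) ?measure0 ?mul0e// -subset0 => x /lens_tau xr.
move: r0; rewrite notin_setE/= in_itv/= andbT; apply.
exact: lt_le_trans (tau_gt0 x) xr.
Qed.

(** Lenses of radius less than [1 / 2] are empty, and in general they have at most
    the volume of a ball, so the integrand of [integral_tau] is dominated by a
    power of [r] with exponent less than -1 on [`[1 / 2, +oo[]. *)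
Lemma integral_tau_lty b : n.+1%:R < b -> (\int[lebn]_x (tau x `^ (- b))%:E < +oo)%E.
Proof.
move=> nb; have b0 : 0 < b by apply: lt_trans nb.
rewrite integral_tau//.
pose v := lebn (cball 0 1); have vfin : v \is a fin_num.
  by rewrite /v ge0_fin_numE// lebesgue_cball_lty.
pose b' := b - n.+1%:R; have b'0 : 0 < b' by rewrite subr_gt0.
pose C := fine v * b / b'.
have C0 : 0 <= C.
  by apply: divr_ge0 (ltW b'0); apply: mulr_ge0 (ltW b0); apply: fine_ge0; exact: measure_ge0.
have mpow c : measurable_fun setT (fun r : measurableTypeR R => r `^ c).
  exact: measurable_powR.
have mlens : measurable_fun setT (fun r : measurableTypeR R => lebn (lens e1 r)).
  have mS : measurable [set p : 'rV[R]_n.+1 * measurableTypeR R | tau p.1 <= p.2].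
    apply: measurable_set_le; last exact: measurable_snd.
    exact: (measurableT_comp measurable_tau measurable_fst).
  have := measurable_fun_ysection lebn mS.
  congr measurable_fun; apply/funext => r /=; congr (lebn _).
  by apply/seteqP; split=> x; rewrite /ysection/= inE/= => /lens_tau.
apply: (@le_lt_trans _ _ (\int[leb]_(r in `[2^-1%R, +oo[) (C%:E * (b' * r `^ (- b' - 1))%:E))%E).
  rewrite [leLHS]integral_mkcond [leRHS]integral_mkcond; apply: ge0_le_integral => //.
  - move=> r _; rewrite /patch; case: ifPn => // _; apply: mule_ge0 => //.
    by rewrite lee_fin mulr_ge0 ?powR_ge0 ?ltW.
  - apply/(measurable_restrictT _ _).1 => //; apply: measurable_funTS.
    apply: emeasurable_funM => //; apply/measurable_EFinP.
    by apply: measurable_funM.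
  - apply/(measurable_restrictT _ _).1 => //; apply: measurable_funTS.
    apply/measurable_EFinP; apply: measurable_funM => //.
    by apply: measurable_funM.
  move=> r _; rewrite /patch; case: ifPn => [|_]; last first.
    case: ifPn => // _; rewrite lee_fin; apply: mulr_ge0 => //; apply: mulr_ge0; [exact: ltW|exact: powR_ge0].
  rewrite inE/= in_itv/= andbT => r0.
  have [r2|r2] := leP 2^-1 r; last first.
    rewrite (_ : lens e1 r = set0) ?measure0 ?mul0e//.
      by case: ifPn => // _; rewrite lee_fin; apply: mulr_ge0 => //; apply: mulr_ge0; [exact: ltW|exact: powR_ge0].
    rewrite -subset0 => x /lens_tau xr; have := tau_ge_half x; lra.
  rewrite mem_set/=; last by rewrite in_itv/= r2.
  apply: (@le_trans _ _ (lebn (cball 0 r) * (b * r `^ (- b - 1))%:E)%E).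
    apply: lee_wpmul2r; first by rewrite lee_fin mulr_ge0 ?powR_ge0 ?ltW.
    apply: le_measure; rewrite ?inE; [exact: measurable_lens|exact: measurable_cball|].
    by move=> x [].
  rewrite cball_scale// -/v -(fineK vfin) -!EFinM lee_fin.
  have -> : r `^ (- b' - 1) = r ^+ n.+1 * r `^ (- b - 1).
    rewrite -powR_mulrn ?ltW// -powRD; last by rewrite (gt_eqF r0) implybT.
    by congr powR; rewrite /b'; ring.
  rewrite le_eqVlt; apply/orP; left; apply/eqP; rewrite /C /=; field.
  exact: lt0r_neq0.
rewrite ge0_integralZl//.
- rewrite integral_power//.
  by rewrite -EFinM ltry.
- by apply/measurable_EFinP; apply: measurable_funTS; apply: measurable_funM.
- by move=> r _; rewrite lee_fin mulr_ge0 ?powR_ge0 ?ltW.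
Qed.

Lemma c_ad_tau b : n.+1%:R < b ->
  (c_ad b n.+1)%:E = (\int[lebn]_x (tau x `^ (- b))%:E)%E.
Proof.
move=> nb; have b0 : 0 < b by apply: lt_trans nb.
have tE := integral_tau b0; rewrite tE /c_ad /Rintegral.
set I := (X in (fine X)%:E = _); set J := RHS.
have -> : I = J.
  apply: eq_integral => r _; rewrite EFinM /vol fineK//.
  rewrite ge0_fin_numE//; apply: le_lt_trans (lebesgue_cball_lty 0 r).
  apply: le_measure; rewrite ?inE; [exact: measurable_lens|exact: measurable_cball|].
  by move=> x [].
rewrite fineK// ge0_fin_numE; first by rewrite /J -tE; exact: integral_tau_lty.
apply: integral_ge0 => r _; apply: mule_ge0 => //.
by rewrite lee_fin mulr_ge0 ?powR_ge0 ?ltW.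
Qed.

(** On the unit ball [tau] is at most 2. *)
Lemma c_ad_gt0 b : n.+1%:R < b -> 0 < c_ad b n.+1 :> R.
Proof.
move=> nb; have b0 : 0 < b by apply: lt_trans nb.
rewrite -lte_fin c_ad_tau//.
apply: (@lt_le_trans _ _ (\int[lebn]_(x in cball 0 1) (2 `^ (- b))%:E))%E.
  rewrite integral_cst ?measurable_cball//; last exact: measurable_cball.
  by apply: mule_gt0; [rewrite lte_fin powR_gt0|exact: lebesgue_cball_gt0].
rewrite integral_mkcond; apply: ge0_le_integral => //.
- by move=> x _; rewrite /patch; case: ifPn => // _; rewrite lee_fin powR_ge0.
- apply/(measurable_restrictT _ _).1 => //; exact: measurable_cball.
- apply/measurable_EFinP; exact: (measurableT_comp (@measurable_powR R (- b)) measurable_tau).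
move=> x _; rewrite /patch; case: ifPn => [|_]; last by rewrite lee_fin powR_ge0.
rewrite inE /cball/= subr0 => x1; rewrite lee_fin; apply: powRN_anti => //; first exact: ltW.
  exact: tau_gt0.
rewrite /tau ge_max; apply/andP; split; first by apply: le_trans x1 _; rewrite ler1n.
apply: le_trans (enormD _ _) _; rewrite enormN enorm_e1; lra.
Qed.

End tau.

(** * Mean lens volumes *)

Lemma fineZr {R : realType} (x : \bar R) (c : R) : 0 < c -> fine (x * c%:E)%E = fine x * c.
Proof.
move=> c0; case: x => [x| |] //=.
  by rewrite gt0_mulye ?lte_fin//= mul0r.
by rewrite gt0_mulNye ?lte_fin//= mul0r.
Qed.

Lemma fineZl {R : realType} (x : \bar R) (c : R) : 0 < c -> fine (c%:E * x)%E = c * fine x.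
Proof. by move=> c0; rewrite muleC fineZr// mulrC. Qed.

Section lens_mass.
Context {R : realType} {n : nat}.
Local Notation lebn := (lebesgue_rV R n.+1).
Local Notation e1 := (e1 R n.+1).
Variables (F : probability (measurableTypeR R) R) (alpha : R).
Hypothesis F_Rplus : F `]-oo, 0[%classic = 0%E.
Hypothesis F_power_law : power_law F alpha.
Hypothesis alpha_gt : n.+1%:R < alpha.

(** The mean number, per unit intensity, of grains that meet both of two balls
    of radius [a] whose centers differ by [z]. *)
Definition lens_mass (a : R) (z : 'rV[R]_n.+1) : \bar R :=
  (\int[F]_s lebn (lens z (s + a)))%E.

Let measurable_lens_leb a (z : 'rV[R]_n.+1) :
  measurable_fun setT (fun s : measurableTypeR R => lebn (lens z (s + a))).
Proof.
have mS : measurable [set p : 'rV[R]_n.+1 * measurableTypeR R |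
    Num.max (enorm p.1) (enorm (p.1 - z)) <= p.2 + a].
  apply: measurable_set_le; last first.
    by apply: (@measurable_funD _ _ R setT snd (cst a)) => //; exact: measurable_snd.
  apply: measurable_maxr; first exact: (measurableT_comp measurable_enorm measurable_fst).
  by apply: measurable_dist => //; exact: measurable_fst.
have := measurable_fun_ysection lebn mS.
congr measurable_fun; apply/funext => s /=; congr (lebn _).
apply/seteqP; split=> x; rewrite /ysection/= inE/= ge_max /lens /cball/= subr0.
  by move=> /andP[].
by move=> [-> ->].
Qed.

(** Scaling by [enorm z] and Tonelli. *)
Lemma lens_mass_tau a z : 0 < enorm z ->
  (lens_mass a z = (enorm z ^+ n.+1)%:E *
     \int[lebn]_x F `[(enorm z * tau x - a)%R, +oo[%classic)%E.
Proof.
move=> z0; set u := enorm z.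
pose S := [set p : measurableTypeR R * 'rV[R]_n.+1 | u * tau p.2 - a <= p.1].
have mS : measurable S.
  apply: measurable_set_le; last exact: measurable_fst.
  apply: measurable_funB => //; apply: measurable_funM => //.
  exact: (measurableT_comp measurable_tau measurable_snd).
have mf : measurable_fun setT (fun p => (\1_S p)%:E : \bar R).
  by apply/measurable_EFinP; exact: measurable_indic.
have f0 p : (0 <= (\1_S p)%:E :> \bar R)%E by rewrite lee_fin.
transitivity (\int[F]_s ((u ^+ n.+1)%:E * \int[lebn]_x (\1_S (s, x))%:E))%E.
  apply: eq_integral => s _; rewrite lensE// -/u; congr (_ * _)%E.
  rewrite (_ : (fun x => (\1_S (s, x))%:E) =
      (fun x => (\1_(lens e1 ((s + a) / u)) x)%:E)); last first.
    apply/funext => x; rewrite !indicE; congr (_%:R%:E); congr nat_of_bool.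
    apply/idP/idP; rewrite !inE /S/= lerBlDr.
      by move=> h; apply/lens_tau; rewrite ler_pdivlMr// mulrC.
    by move=> /lens_tau; rewrite ler_pdivlMr// mulrC.
  by rewrite integral_indic ?setIT//; exact: measurable_lens.
rewrite ge0_integralZl//; last 3 first.
- exact: (measurable_fun_fubini_tonelli_F (fun p => (\1_S p)%:E)).
- by move=> s _; apply: integral_ge0.
- by rewrite lee_fin exprn_ge0// enorm_ge0.
congr (_ * _)%E; rewrite (fubini_tonelli (fun p => (\1_S p)%:E))//.
apply: eq_integral => x _.
rewrite (_ : (fun s => (\1_S (s, x))%:E) =
    (fun s => (\1_(`[u * tau x - a, +oo[%classic) s)%:E)); last first.
  apply/funext => s; rewrite !indicE; congr (_%:R%:E); congr nat_of_bool.
  by apply/idP/idP; rewrite !inE /S/= in_itv/= andbT.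
by rewrite integral_indic ?setIT.
Qed.

Lemma measurable_tail_tau u a :
  measurable_fun setT (fun x : 'rV[R]_n.+1 => F `[(u * tau x - a)%R, +oo[%classic).
Proof.
have mS : measurable [set p : measurableTypeR R * 'rV[R]_n.+1 | u * tau p.2 - a <= p.1].
  apply: measurable_set_le; last exact: measurable_fst.
  apply: measurable_funB => //; apply: measurable_funM => //.
  exact: (measurableT_comp measurable_tau measurable_snd).
have := measurable_fun_ysection F mS.
congr measurable_fun; apply/funext => x /=; congr (F _).
by apply/seteqP; split=> s; rewrite /ysection/= inE/= in_itv/= andbT.
Qed.

Let beta := (n.+1%:R + alpha) / 2.
Let beta_gt : n.+1%:R < beta. Proof. exact: (midf_lt alpha_gt).1. Qed.
Let beta_lt : beta < alpha. Proof. exact: (midf_lt alpha_gt).2. Qed.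
Let beta_ge0 : 0 <= beta. Proof. by apply: ltW; apply: lt_trans beta_gt. Qed.

(** The bound that dominates both limits below; it is uniform in [a <= u / 8]
    since then [u * tau x - a >= u * tau x / 2]. *)
Lemma tau_tail_bound : exists C u0 : R, [/\ 0 <= C, 0 < u0 &
  forall u a x, u0 <= u -> a <= u / 8 ->
    fine (F `[u * tau x - a, +oo[%classic) <= C * tail F u * tau (x : 'rV[R]_n.+1) `^ (- beta)].
Proof.
have [t1 t10 up] := tail_upper F_Rplus F_power_law beta_ge0 beta_lt.
have q : (4^-1 : R) `^ (- alpha) < 4^-1 `^ (- alpha) + 1 by rewrite ltrDl.
have r4 := tail_ratio F_power_law (_ : 0 < 4^-1).
have {r4} := r4 ltac:(by rewrite invr_gt0) => r4.
have [t2 t20 h2] := pinfty_near_ge (cvgr_lt _ r4 _ q).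
have [t3 t30 pos] := tail_gt0_near F_power_law.
pose C := 2 `^ beta * 2 `^ (- beta) * (4^-1 `^ (- alpha) + 1).
exists C, (Num.max (4 * t1) (Num.max t2 t3)); split.
- by rewrite !mulr_ge0 ?powR_ge0// addr_ge0 ?powR_ge0.
- by rewrite lt_max mulr_gt0.
move=> u a x; rewrite !ge_max => /and3P[u1 u2 u3] au.
have u0 : 0 < u by exact: lt_le_trans u3.
have th := tau_ge_half x; have tp := tau_gt0 x.
apply: (@le_trans _ _ (tail F (2 * tau x * (u / 4)))).
  rewrite -lee_fin (tail_itv F_Rplus); last by rewrite !mulr_ge0// ltW.
  rewrite fineK ?F_fin_num//; apply: le_measure; rewrite ?inE// => s /=.
  rewrite !in_itv/= !andbT; apply: lt_le_trans; rewrite ltrBrDl.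
  have : u * 2^-1 <= u * tau x by rewrite ler_pM2l.
  lra.
apply: le_trans (up (u / 4) (2 * tau x) _ _) _; first lra.
  lra.
have -> : C * tail F u * tau x `^ (- beta) =
  2 `^ beta * (2 * tau x) `^ (- beta) * ((4^-1 `^ (- alpha) + 1) * tail F u).
  by rewrite /C powRM ?ltW//; ring.
apply: ler_wpM2l; first by rewrite mulr_ge0 ?powR_ge0.
by have := h2 u u2; rewrite ltr_pdivrMr ?pos// [4^-1 * u]mulrC => /ltW.
Qed.

Lemma lens_mass_bound : exists C u0 : R, [/\ 0 <= C, 0 < u0 &
  forall a z, u0 <= enorm z -> a <= enorm z / 8 ->
    (lens_mass a z <= (C * (enorm z ^+ n.+1 * tail F (enorm z)))%:E)%E].
Proof.
have [C [u0 [C0 u00 h]]] := tau_tail_bound.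
pose I := (\int[lebn]_x (tau x `^ (- beta))%:E)%E.
have I0 : (0 <= I)%E by apply: integral_ge0 => x _; rewrite lee_fin powR_ge0.
have If : I \is a fin_num by rewrite ge0_fin_numE// integral_tau_lty.
exists (C * fine I), u0; split => //; first by rewrite mulr_ge0 ?fine_ge0.
move=> a z uz az; have z0 : 0 < enorm z by exact: lt_le_trans uz.
have t0 : 0 <= tail F (enorm z) by rewrite tail_ge0 ?enorm_ge0.
rewrite lens_mass_tau//.
rewrite (_ : C * fine I * _ = enorm z ^+ n.+1 * (C * tail F (enorm z) * fine I)); last ring.
rewrite EFinM; apply: lee_wpmul2l; first by rewrite lee_fin exprn_ge0 ?enorm_ge0.
rewrite EFinM fineK// /I -ge0_integralZl//; last 3 first.
- apply/measurable_EFinP; exact: (measurableT_comp (@measurable_powR R (- beta)) measurable_tau).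
- by move=> x _; rewrite lee_fin powR_ge0.
- by rewrite lee_fin mulr_ge0.
apply: ge0_le_integral => //.
- exact: measurable_tail_tau.
- apply/measurable_EFinP; apply: measurable_funM => //.
  exact: (measurableT_comp (@measurable_powR R (- beta)) measurable_tau).
move=> x _; rewrite -[leLHS]fineK ?F_fin_num// -EFinM lee_fin.
exact: h.
Qed.

(** Divided by [tail F (enorm z)], the integrand of [lens_mass_tau] tends to
    [tau x `^ (- alpha)], whose integral is [c_ad]. *)
Lemma lens_mass_cvg a (z : nat -> 'rV[R]_n.+1) : 0 <= a ->
  enorm (z k) @[k --> \oo] --> +oo ->
  fine (lens_mass a (z k)) / (enorm (z k) ^+ n.+1 * tail F (enorm (z k))) @[k --> \oo]
    --> c_ad alpha n.+1.
Proof.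
move=> a0 zoo.
have [C [u0 [C0 u00 h]]] := tau_tail_bound.
have [t0 t00 pos] := tail_gt0_near F_power_law.
have /cvgryPge/(_ (Num.max (Num.max u0 t0) (8 * a + 1)))[N _ hN] := zoo.
pose g k x := (fine (F `[(enorm (z (k + N)%N) * tau (x : 'rV[R]_n.+1) - a)%R, +oo[%classic) /
  tail F (enorm (z (k + N)%N)))%:E.
have uk k : [/\ u0 <= enorm (z (k + N)%N), a <= enorm (z (k + N)%N) / 8,
    0 < enorm (z (k + N)%N) & 0 < tail F (enorm (z (k + N)%N))].
  have := hN (k + N)%N (leq_addl _ _); rewrite /= !ge_max => /andP[/andP[h1 h2] h3].
  by split => //; [lra|exact: lt_le_trans h1|exact: pos].
have mg k : measurable_fun setT (g k).
  apply/measurable_EFinP; apply: measurable_funM => //.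
  apply: (measurableT_comp (@fine_measurable R setT measurableT)); exact: measurable_tail_tau.
have mtau b : measurable_fun setT (fun x => (tau (x : 'rV[R]_n.+1) `^ b)%:E).
  by apply/measurable_EFinP; exact: (measurableT_comp (@measurable_powR R b) measurable_tau).
have cg : (\int[lebn]_x g k x)%E @[k --> \oo] --> (\int[lebn]_x (tau x `^ (- alpha))%:E)%E.
  have [] // := @dominated_convergence _ _ _ lebn setT measurableT g
    (fun x => (tau x `^ (- alpha))%:E) (fun x => (C * tau x `^ (- beta))%:E).
  - apply: aeW => x _; apply: cvg_EFin; first by near=> k.
    have l := tail_ge_limit F_Rplus F_power_law a0 (tau_gt0 x).
    have znoo : enorm (z (k + N)%N) @[k --> \oo] --> +oo by apply: (cvg_comp (fun k => (k + N)%N) (enorm \o z)) zoo; exact: cvg_addnr.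
    exact: (cvg_comp _ _ znoo l).
  - apply/integrableP; split.
      apply/measurable_EFinP; apply: measurable_funM; first exact: measurable_cst.
      exact: (measurableT_comp (@measurable_powR R (- beta)) measurable_tau).
    under eq_integral => x _ do rewrite gee0_abs ?lee_fin ?mulr_ge0 ?powR_ge0// EFinM.
    rewrite ge0_integralZl//; last by move=> x _; rewrite lee_fin powR_ge0.
    by rewrite lte_mul_pinfty ?lee_fin// integral_tau_lty.
  - apply: aeW => x k _; have [k1 k2 k3 k4] := uk k.
    rewrite gee0_abs; last by rewrite lee_fin divr_ge0 ?fine_ge0 ?(ltW k4).
    by rewrite lee_fin ler_pdivrMr// mulrAC; exact: h.
rewrite -(c_ad_tau alpha_gt) in cg.
rewrite -(cvg_shiftn N); move/fine_cvg : cg; apply: cvg_trans; apply: near_eq_cvg.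
near=> k; have [k1 k2 k3 k4] := uk k; rewrite /=.
rewrite lens_mass_tau// fineZl ?exprn_gt0// -mulf_div divff ?gt_eqF ?exprn_gt0// mul1r.
rewrite -fineZr ?invr_gt0// -ge0_integralZr//.
- congr fine; apply: eq_integral => x _.
  by rewrite /g EFinM fineK// F_fin_num.
- exact: measurable_tail_tau.
- by rewrite lee_fin invr_ge0 ltW.
Unshelve. all: by end_near. Qed.

(** This is finiteness of the moment of order [n.+1] of [F]. It follows from the
    bound on the lens mass at some fixed [z]: the lens of two balls of radius
    [s >= enorm z] contains a ball of radius [s / 2]. *)
Lemma lens_mass0_lty a : (lens_mass a 0 < +oo)%E.
Proof.
have [C [u0 [C0 u00 h]]] := lens_mass_bound.
pose z := u0 *: e1; have zE : enorm z = u0 by rewrite enormZ enorm_e1 mulr1 gtr0_norm.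
pose m := Num.max u0 `|a|; have m0 : 0 < m by rewrite lt_max u00.
pose K := lebn (cball 0 (2 * m)).
have Kf : K \is a fin_num by rewrite /K ge0_fin_numE// lebesgue_cball_lty.
pose D : R := 4 ^+ n.+1.
have D0 : 0 <= D by rewrite exprn_ge0.
apply: (@le_lt_trans _ _ (\int[F]_s (K + D%:E * lebn (lens z (s + 0))))%E); last first.
  rewrite ge0_integralD//; last 3 first.
  - by move=> s _; exact: measure_ge0.
  - by move=> s _; apply: mule_ge0.
  - by apply: emeasurable_funM => //; exact: measurable_lens_leb.
  rewrite integral_cst// [X in (_ * X)%E]probability_setT mule1; apply: lte_add_pinfty.
    by rewrite ltey_eq Kf.
  rewrite (@ge0_integralZl _ _ _ _ _ measurableT _ (measurable_lens_leb _ _))//.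
  rewrite lte_mul_pinfty ?lee_fin//; apply: le_lt_trans (h 0 z _ _) _; rewrite ?zE ?ltry//.
  by rewrite divr_ge0 ?ltW.
rewrite /lens_mass; apply: ge0_le_integral.
- exact: measurableT.
- by move=> s _; exact: measure_ge0.
- exact: measurable_lens_leb.
- apply: emeasurable_funD => //; apply: emeasurable_funM => //; exact: measurable_lens_leb.
move=> s _.
have step1 : (lebn (lens 0 (s + a)) <= lebn (cball 0 (s + a)))%E.
  apply: le_measure; rewrite ?inE; [exact: measurable_lens|exact: measurable_cball|].
  by move=> x [].
apply: le_trans step1 _.
have am : a <= m by rewrite le_max (ler_norm a) orbT.
have um : u0 <= m by rewrite le_max lexx.
have [sm|ms] := leP s m.
  apply: (@le_trans _ _ K); last by apply: leeDl; exact: mule_ge0.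
  apply: le_measure; rewrite ?inE; [exact: measurable_cball|exact: measurable_cball|].
  by move=> x /le_trans; apply; lra.
apply: (@le_trans _ _ (D%:E * lebn (lens z (s + 0)))%E); last first.
  by apply: leeDr; exact: measure_ge0.
have -> : lens z (s + 0) = lens z s by rewrite addr0.
have half : cball (2^-1 *: z) (s / 2) `<=` lens z s.
  have hz : enorm (2^-1 *: z) = u0 / 2 by rewrite enormZ zE gtr0_norm ?invr_gt0// mulrC.
  move=> x; rewrite /lens /cball/= subr0 => hx; split.
    have := enorm_triangle (2^-1 *: z) x 0; rewrite !subr0 hz; lra.
  have := enorm_triangle (2^-1 *: z) x z.
  have -> : enorm (2^-1 *: z - z) = u0 / 2.
    rewrite -hz -enormN; congr enorm; apply/rowP => i; rewrite !mxE; lra.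
  lra.
apply: (@le_trans _ _ (D%:E * lebn (cball (2^-1 *: z) (s / 2)))%E); last first.
  apply: lee_wpmul2l; first by rewrite lee_fin.
  by apply: le_measure; rewrite ?inE; [exact: measurable_cball|exact: measurable_lens|].
rewrite lebesgue_cball -cball_scaleM//.
apply: le_measure; rewrite ?inE; [exact: measurable_cball|exact: measurable_cball|].
by move=> x /le_trans; apply; lra.
Qed.

End lens_mass.

(** * Retention probabilities as functions of marks *)

Section retention_functions.
Context {R : realType} {n : nat}.
Local Notation lebn := (lebesgue_rV R n.+1).
Implicit Types (x y z : 'rV[R]_n.+1) (r s u : R).
Variables (F : probability (measurableTypeR R) R) (alpha lam : R).
Hypothesis F_Rplus : F `]-oo, 0[%classic = 0%E.
Hypothesis F_power_law : power_law F alpha.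
Hypothesis alpha_gt : n.+1%:R < alpha.
Hypothesis lam_gt0 : 0 < lam.

(** The mean number, per unit intensity, of grains that meet a given ball. *)
Definition disc_mass r : \bar R := (\int[F]_s lebn (cball 0 (s + r)))%E.

Definition overlap x1 r1 x2 r2 : \bar R :=
  (\int[F]_s lebn (cball x1 (s + r1) `&` cball x2 (s + r2)))%E.

Definition retain r : R := expR (- (lam * fine (disc_mass r))).

(** Balls that meet exclude each other. Otherwise the grains that meet both balls
    are counted twice in the product, and the last factor corrects for this. *)
Definition retain2 x1 r1 x2 r2 : R :=
  if r1 + r2 < enorm (x1 - x2) then
    retain r1 * retain r2 * expR (lam * fine (overlap x1 r1 x2 r2)) else 0.

Lemma measurable_ball_section d (T : measurableType d) (c : T -> 'rV[R]_n.+1) (b : T -> R) :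
  measurable_fun setT c -> measurable_fun setT b ->
  measurable [set p : T * 'rV[R]_n.+1 | cball (c p.1) (b p.1) p.2].
Proof.
move=> mc mb; apply: measurable_set_le.
  apply: measurable_dist; first exact: measurable_snd.
  exact: (measurableT_comp mc measurable_fst).
exact: (measurableT_comp mb measurable_fst).
Qed.

Lemma measurable_overlap d (T : measurableType d) (c1 c2 : T -> 'rV[R]_n.+1) (b1 b2 : T -> R) :
  measurable_fun setT c1 -> measurable_fun setT b1 ->
  measurable_fun setT c2 -> measurable_fun setT b2 ->
  measurable_fun setT (fun t => overlap (c1 t) (b1 t) (c2 t) (b2 t)).
Proof.
move=> mc1 mb1 mc2 mb2.
pose f (p : T * measurableTypeR R) : \bar R :=
  lebn (cball (c1 p.1) (p.2 + b1 p.1) `&` cball (c2 p.1) (p.2 + b2 p.1)).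
apply: (measurable_fun_fubini_tonelli_F f); last by move=> p; exact: measure_ge0.
have mB (c : T -> 'rV[R]_n.+1) (b : T -> R) : measurable_fun setT c -> measurable_fun setT b ->
    measurable [set p : (T * measurableTypeR R) * 'rV[R]_n.+1 |
      cball (c p.1.1) (p.1.2 + b p.1.1) p.2].
  move=> mc mb; apply: (@measurable_ball_section _ _ (fun q => c q.1)
    (fun q : T * measurableTypeR R => q.2 + b q.1)).
    exact: (measurableT_comp mc measurable_fst).
  apply: (@measurable_funD _ _ R setT snd (b \o fst)); first exact: measurable_snd.
  exact: (measurableT_comp mb measurable_fst).
have := measurable_fun_xsection lebn (measurableI _ _ (mB _ _ mc1 mb1) (mB _ _ mc2 mb2)).
congr measurable_fun; apply/funext => p; rewrite /f /=; congr (lebn _).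
by apply/seteqP; split=> x; rewrite /xsection/= inE.
Qed.

Lemma overlap_self x r : overlap x r x r = disc_mass r.
Proof. by apply: eq_integral => s _; rewrite setIid lebesgue_cball. Qed.

Lemma disc_mass_lens r : disc_mass r = lens_mass F r (0 : 'rV[R]_n.+1).
Proof. by apply: eq_integral => s _; rewrite /lens setIid. Qed.

Lemma disc_mass_lty r : (disc_mass r < +oo)%E.
Proof. by rewrite disc_mass_lens; exact: (lens_mass0_lty F_Rplus F_power_law alpha_gt). Qed.

Lemma disc_mass_ge0 r : (0 <= disc_mass r)%E.
Proof. by apply: integral_ge0 => s _; exact: measure_ge0. Qed.

Lemma overlap_ge0 x1 r1 x2 r2 : (0 <= overlap x1 r1 x2 r2)%E.
Proof. by apply: integral_ge0 => s _; exact: measure_ge0. Qed.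

Let measurable_cball2 x1 r1 x2 r2 : measurable (cball x1 r1 `&` cball x2 r2).
Proof. by apply: measurableI; exact: measurable_cball. Qed.

Let measurable_disc (c1 c2 : 'rV[R]_n.+1) r1 r2 :
  measurable_fun setT (fun s : measurableTypeR R =>
    lebn (cball c1 (s + r1) `&` cball c2 (s + r2))).
Proof.
have mB (c : 'rV[R]_n.+1) r : measurable [set p : measurableTypeR R * 'rV[R]_n.+1 |
    cball c (p.1 + r) p.2].
  apply: (@measurable_ball_section _ _ (fun _ => c)
    (fun q : measurableTypeR R => q + r)) => //.
  by apply: measurable_funD => //; exact: measurable_id.
have := measurable_fun_xsection lebn (measurableI _ _ (mB c1 r1) (mB c2 r2)).
congr measurable_fun; apply/funext => p; rewrite /=; congr (lebn _).
by apply/seteqP; split=> x; rewrite /xsection/= inE.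
Qed.

Lemma overlap_mono x1 r1 x2 r2 x1' r1' x2' r2' :
  enorm (x1 - x1') + r1 <= r1' -> enorm (x2 - x2') + r2 <= r2' ->
  (overlap x1 r1 x2 r2 <= overlap x1' r1' x2' r2')%E.
Proof.
move=> h1 h2; apply: ge0_le_integral.
- exact: measurableT.
- by move=> s _; exact: measure_ge0.
- exact: measurable_disc.
- exact: measurable_disc.
move=> s _; apply: le_measure; rewrite ?inE; [exact: measurable_cball2|exact: measurable_cball2|].
by apply: setISS; apply: cball_sub; rewrite addrCA lerD2l.
Qed.

Lemma overlap_lens a z : overlap 0 a z a = lens_mass F a z.
Proof. by []. Qed.

Lemma overlapC x1 r1 x2 r2 : overlap x1 r1 x2 r2 = overlap x2 r2 x1 r1.
Proof. by apply: eq_integral => s _; rewrite setIC. Qed.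

Lemma overlap_le_disc x1 r1 x2 r2 : (overlap x1 r1 x2 r2 <= disc_mass r1)%E.
Proof.
rewrite -(overlap_self x1); apply: ge0_le_integral.
- exact: measurableT.
- by move=> s _; exact: measure_ge0.
- exact: measurable_disc.
- exact: measurable_disc.
move=> s _; apply: le_measure; rewrite ?inE; [exact: measurable_cball2|exact: measurable_cball2|].
by rewrite setIid => y [].
Qed.

Lemma overlap_lty x1 r1 x2 r2 : (overlap x1 r1 x2 r2 < +oo)%E.
Proof. exact: le_lt_trans (overlap_le_disc _ _ _ _) (disc_mass_lty _). Qed.

End retention_functions.

(** * Covariance of two retained balls *)

Lemma near_cvg {R : realType} (f g : nat -> R) (l : R) :
  (\forall k \near \oo, f k = g k) ->
  f k @[k --> \oo] --> l -> g k @[k --> \oo] --> l.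
Proof. by move=> fg fl; apply: cvg_trans fl; exact: near_eq_cvg. Qed.

Section retention_asymptotics.
Context {R : realType} {n : nat}.
Local Notation lebn := (lebesgue_rV R n.+1).
Implicit Types (x y z : 'rV[R]_n.+1) (r s u : R).
Variables (F : probability (measurableTypeR R) R) (alpha lam : R).
Hypothesis F_Rplus : F `]-oo, 0[%classic = 0%E.
Hypothesis F_power_law : power_law F alpha.
Hypothesis alpha_gt : n.+1%:R < alpha.
Hypothesis lam_gt0 : 0 < lam.

Local Notation retain := (@retain R n F lam).
Local Notation retain2 := (@retain2 R n F lam).
Local Notation overlap := (@overlap R n F).
Local Notation disc_mass := (@disc_mass R n F).
Local Notation v1 := (vol (cball (0 : 'rV[R]_n.+1) 1)).

(** The common order of decay of both covariances. *)
Definition rho u : R := u ^+ n.+1 * tail F u.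

Lemma v1_gt0 : 0 < v1.
Proof. by apply: fine_gt0; rewrite lebesgue_cball_gt0//=; exact: lebesgue_cball_lty. Qed.

Lemma retain_gt0 r : 0 < retain r. Proof. exact: expR_gt0. Qed.

Lemma retain_le1 r : retain r <= 1.
Proof.
rewrite -[leRHS]expR0 ler_expR oppr_le0 mulr_ge0 ?(ltW lam_gt0)// fine_ge0//.
exact: disc_mass_ge0.
Qed.

(** Even grains of radius zero meet the ball as soon as their center is in it. *)
Lemma disc_mass_ge r : 0 <= r -> (lebn (cball 0 r) <= disc_mass r)%E.
Proof.
move=> r0; have -> : lebn (cball 0 r) = (\int[F]_(s in `[0%R, +oo[) lebn (cball 0 r))%E.
  rewrite integral_cst// [X in (_ * X)%E](_ : _ = 1%E) ?mule1//.
  exact: (F_itv0y F_Rplus).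
rewrite integral_mkcond; apply: ge0_le_integral.
- exact: measurableT.
- by move=> s _; rewrite /patch; case: ifPn => // _; exact: measure_ge0.
- by apply/(measurable_restrictT _ _).1.
- have mB := @measurable_ball_section R n _ _ (fun _ : measurableTypeR R => 0)
    (fun s : measurableTypeR R => s + r) (measurable_cst _).
  have {}mB : measurable [set p : measurableTypeR R * 'rV[R]_n.+1 | cball 0 (p.1 + r) p.2].
    by apply: mB; apply: measurable_funD => //; exact: measurable_id.
  have := measurable_fun_xsection lebn mB.
  congr measurable_fun; apply/funext => p; rewrite /=; congr (lebn _).
  by apply/seteqP; split=> x; rewrite /xsection/= inE.
move=> s _; rewrite /patch; case: ifPn => [|_]; last exact: measure_ge0.
rewrite inE/= in_itv/= andbT => s0; apply: le_measure; rewrite ?inE;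
  [exact: measurable_cball|exact: measurable_cball|].
by move=> x /le_trans; apply; rewrite lerDr.
Qed.

Lemma retain_exp r : 0 <= r -> retain r <= expR (- (lam * v1 * r ^+ n.+1)).
Proof.
move=> r0; rewrite ler_expR lerN2 -mulrA ler_pM2l//.
have v1f : lebn (cball 0 1) \is a fin_num by rewrite ge0_fin_numE ?lebesgue_cball_lty.
have -> : v1 * r ^+ n.+1 = fine (lebn (cball 0 r)).
  move: r0; rewrite le_eqVlt => /predU1P[<-|r0].
    rewrite expr0n mulr0; apply/esym; rewrite (_ : cball 0 0 = [set 0]) ?lebesgue_set1//.
    apply/seteqP; split=> [x|x ->]; rewrite /cball/= ?subr0 ?enorm0// => h.
    by apply: enorm_eq0; apply/eqP; rewrite eq_le h enorm_ge0.
  by rewrite cball_scale// fineZl ?exprn_gt0// mulrC.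
apply: fine_le; last exact: disc_mass_ge.
- by rewrite ge0_fin_numE ?lebesgue_cball_lty.
- rewrite ge0_fin_numE ?disc_mass_ge0//.
  exact: (disc_mass_lty F_Rplus F_power_law alpha_gt).
Qed.

Let overlap_fin x1 r1 x2 r2 : overlap x1 r1 x2 r2 \is a fin_num.
Proof.
rewrite ge0_fin_numE ?overlap_ge0//.
exact: (overlap_lty F_Rplus F_power_law alpha_gt).
Qed.

Let disc_fin r : disc_mass r \is a fin_num.
Proof.
rewrite ge0_fin_numE ?disc_mass_ge0//.
exact: (disc_mass_lty F_Rplus F_power_law alpha_gt).
Qed.

Lemma retain2_ge0 x1 r1 x2 r2 : 0 <= retain2 x1 r1 x2 r2.
Proof. by rewrite /retain2; case: ifPn => // _; rewrite !mulr_ge0 ?expR_ge0. Qed.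

Lemma retain_overlap_le1 x1 r1 x2 r2 :
  retain r1 * expR (lam * fine (overlap x1 r1 x2 r2)) <= 1.
Proof.
have le1 (a b : R) : b <= a -> expR (- (lam * a)) * expR (lam * b) <= 1.
  by move=> ba; rewrite -expRD -expR0 ler_expR addrC subr_le0 ler_pM2l.
by apply: le1; apply: fine_le; [exact: overlap_fin|exact: disc_fin|exact: overlap_le_disc].
Qed.

Lemma retain2_le x1 r1 x2 r2 : retain2 x1 r1 x2 r2 <= retain r1 /\
  retain2 x1 r1 x2 r2 <= retain r2.
Proof.
rewrite /retain2; case: ifPn => _; last by split; apply: ltW; exact: retain_gt0.
split; rewrite -!mulrA.
  rewrite ger_pMr ?retain_gt0// overlapC; exact: retain_overlap_le1.
rewrite mulrCA ger_pMr ?retain_gt0//; exact: retain_overlap_le1.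
Qed.

Definition excess x1 r1 x2 r2 := retain2 x1 r1 x2 r2 - retain r1 * retain r2.

Lemma rho_ge0 u : 0 <= u -> 0 <= rho u.
Proof. by move=> u0; rewrite mulr_ge0 ?exprn_ge0 ?tail_ge0. Qed.

Lemma rho_cvg0 : rho u @[u --> +oo] --> (0 : R).
Proof.
pose b := (n.+1%:R + alpha) / 2.
have nb : n.+1%:R < b by exact: (midf_lt alpha_gt).1.
have ba : b < alpha by exact: (midf_lt alpha_gt).2.
have b0 : 0 < b by apply: lt_trans nb.
have [t0 t00 up] := tail_upper F_Rplus F_power_law (ltW b0) ba.
pose C := 2 `^ b * t0^-1 `^ (- b) * tail F t0.
have p0 := powR_cvg0y (_ : 0 < b - n.+1%:R).
have {}p0 : C * x `^ (- (b - n.+1%:R)) @[x --> +oo] --> (0 : R).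
  by rewrite -(mulr0 C); apply: cvgMl_tmp; apply: p0; rewrite subr_gt0.
apply: (squeeze_cvgr _ (cvg_cst (0 : R)) p0); near=> u.
have u0 : 0 < u by near: u; apply: nbhs_pinfty_gt; exact: num_real.
have tu : t0 <= u by near: u; apply: nbhs_pinfty_ge; exact: num_real.
rewrite (rho_ge0 (ltW u0))/=; have := up t0 (u / t0) (lexx _).
rewrite ler_pdivlMr// mul1r divfK ?gt_eqF// => /(_ tu) h.
apply: (@le_trans _ _ (u ^+ n.+1 * (2 `^ b * (u / t0) `^ (- b) * tail F t0))).
  by rewrite ler_pM2l ?exprn_gt0.
rewrite powRM ?invr_ge0 ?(ltW u0) ?(ltW t00)//.
have -> : u `^ (- (b - n.+1%:R)) = u ^+ n.+1 * u `^ (- b).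
  rewrite -powR_mulrn ?(ltW u0)// -powRD; last by rewrite (gt_eqF u0) implybT.
  by congr powR; ring.
by rewrite /C le_eqVlt; apply/orP; left; apply/eqP; ring.
Unshelve. all: by end_near. Qed.

Lemma expR_sub1_le (t : R) : 0 <= t -> expR t - 1 <= t * expR t.
Proof.
move=> t0; have := expR_ge1Dx (- t); rewrite expRN => h.
have e0 := expR_gt0 t.
have : (1 - t) * expR t <= 1 by rewrite -ler_pdivlMr// mul1r.
lra.
Qed.

Lemma ler_norm_sub_max (a b t : R) : 0 <= a -> 0 <= b -> a <= t -> b <= t -> `|a - b| <= t.
Proof. by move=> a0 b0 at_ bt; rewrite ler_norml; apply/andP; split; lra. Qed.

(** When both radii are small compared with [enorm z] the excess is the effect of
    the grains that meet both balls; otherwise the retention of the larger grain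
    is exponentially unlikely, and a power law beats that. *)
Lemma excess_bound : exists C u0 : R, [/\ 0 <= C, 0 < u0 &
  forall z x1 r1 x2 r2, u0 <= enorm z -> enorm x1 <= r1 -> enorm (x2 - z) <= r2 ->
    `|excess x1 r1 x2 r2| <= C * rho (enorm z)].
Proof.
have [C1 [u1 [C10 u10 h1]]] := lens_mass_bound F_Rplus F_power_law alpha_gt.
have k0 : 0 < lam * v1 / 16 by rewrite divr_gt0// mulr_gt0// v1_gt0.
have [C2 [u2 [C20 u20 h2]]] := exp_tail F_Rplus F_power_law k0.
have [t3 t30 h3] := pinfty_near_ge (cvgr_le _ rho_cvg0 _ (ltr01 : 0 < 1 :> R)).
pose C := lam * C1 * expR (lam * C1).
have C0 : 0 <= C by rewrite mulr_ge0 ?expR_ge0// mulr_ge0 ?(ltW lam_gt0).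
exists (C + C2), (Num.max (Num.max u1 u2) (Num.max t3 16)); split.
- exact: addr_ge0.
- by rewrite !lt_max u10.
move=> z x1 r1 x2 r2; rewrite !ge_max => /andP[/andP[zu1 zu2] /andP[zt3 z16]] hx1 hx2.
set u := enorm z; have u0 : 0 < u by exact: lt_le_trans zu1.
have u16 : 16 <= u by exact: z16.
have r10 : 0 <= r1 by apply: le_trans hx1; exact: enorm_ge0.
have r20 : 0 <= r2 by apply: le_trans hx2; exact: enorm_ge0.
have rhou : 0 <= rho u by exact: (rho_ge0 (ltW u0)).
have [small|large] := leP (Num.max r1 r2) (u / 16).
  move: small; rewrite ge_max => /andP[s1 s2].
  have far : r1 + r2 < enorm (x1 - x2).
    have : u <= enorm (x1 - x2) + r1 + r2.
      have := enorm_triangle x2 z 0; rewrite !subr0 enormB -/u.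
      have := enorm_triangle x1 x2 0; rewrite !subr0 enormB; lra.
    lra.
  rewrite /excess /retain2 far.
  set L := fine (overlap x1 r1 x2 r2).
  have L0 : 0 <= L by rewrite fine_ge0 ?overlap_ge0.
  have LC : L <= C1 * rho u.
    rewrite -lee_fin /L fineK ?overlap_fin//.
    apply: le_trans (h1 (u / 8) z zu1 (lexx _)); rewrite -overlap_lens.
    by apply: overlap_mono; rewrite ?subr0; lra.
  have LC1 : L <= C1 by apply: le_trans LC _; rewrite -[leRHS]mulr1; apply: ler_wpM2l => //; exact: h3.
  rewrite -[X in _ - X]mulr1 -mulrBr ger0_norm; last first.
    rewrite mulr_ge0 ?mulr_ge0 ?(ltW (retain_gt0 _))// subr_ge0 -expR0 ler_expR.
    by rewrite mulr_ge0 ?(ltW lam_gt0).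
  have lL0 : 0 <= lam * L by rewrite mulr_ge0 ?(ltW lam_gt0).
  apply: (@le_trans _ _ (1 * (lam * L * expR (lam * L)))).
    apply: ler_pM; last exact: expR_sub1_le.
    - by rewrite mulr_ge0 ?(ltW (retain_gt0 _)).
    - by rewrite subr_ge0 -expR0 ler_expR.
    - by rewrite mulr_ile1 ?retain_le1 ?(ltW (retain_gt0 _)).
  rewrite mul1r; apply: (@le_trans _ _ (C * rho u)); last by rewrite ler_wpM2r ?lerDl.
  have -> : C * rho u = lam * (C1 * rho u) * expR (lam * C1) by rewrite /C; ring.
  apply: ler_pM; rewrite ?expR_ge0//.
    by rewrite ler_pM2l.
  by rewrite ler_expR ler_pM2l.
have [r [ru rE ret]] : exists r, [/\ u / 16 < r, 0 <= r & `|excess x1 r1 x2 r2| <= retain r].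
  have rr : 0 <= retain r1 * retain r2 by rewrite mulr_ge0 ?(ltW (retain_gt0 _)).
  have [e1 e2] := retain2_le x1 r1 x2 r2; have e0 := retain2_ge0 x1 r1 x2 r2.
  have rr1 : retain r1 * retain r2 <= retain r1 by rewrite ger_pMr ?retain_gt0 ?retain_le1.
  have rr2 : retain r1 * retain r2 <= retain r2 by rewrite ger_pMl ?retain_gt0 ?retain_le1.
  move: large; rewrite lt_max => /orP[lr|lr].
    by exists r1; split; [exact: lr|exact: r10|exact: ler_norm_sub_max].
  by exists r2; split; [exact: lr|exact: r20|exact: ler_norm_sub_max].
apply: le_trans ret _; apply: le_trans (retain_exp rE) _.
apply: (@le_trans _ _ (expR (- (lam * v1 / 16 * u)))).
  rewrite ler_expR lerN2 -!mulrA !ler_pM2l ?v1_gt0// mulrC.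
  have r1' : 1 <= r by lra.
  apply: (@le_trans _ _ r); first exact: ltW.
  by rewrite exprS ler_peMr// exprn_ege1.
apply: le_trans (h2 u zu2) _.
apply: (@le_trans _ _ (C2 * rho u)); last by rewrite ler_wpM2r ?lerDr.
apply: ler_wpM2l => //; apply: ler_peMl.
  by apply: (tail_ge0 F_Rplus); exact: ltW.
by apply: exprn_ege1; lra.
Qed.

(** The overlap lies between the lens masses for the added radii [0] and
    [2 * (r1 + r2)], which have the same asymptotics. *)
Lemma excess_cvg (z : nat -> 'rV[R]_n.+1) x1 r1 y2 r2 :
  enorm (z k) @[k --> \oo] --> +oo -> enorm x1 <= r1 -> enorm y2 <= r2 ->
  excess x1 r1 (z k + y2) r2 / rho (enorm (z k)) @[k --> \oo] -->
    lam * c_ad alpha n.+1 * (retain r1 * retain r2).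
Proof.
move=> zoo hx1 hy2.
have r10 : 0 <= r1 by apply: le_trans hx1; exact: enorm_ge0.
have r20 : 0 <= r2 by apply: le_trans hy2; exact: enorm_ge0.
pose a := 2 * (r1 + r2); have a0 : 0 <= a by rewrite mulr_ge0 ?addr_ge0.
have cl := lens_mass_cvg F_Rplus F_power_law alpha_gt (lexx 0) zoo.
have cu := lens_mass_cvg F_Rplus F_power_law alpha_gt a0 zoo.
pose L k := fine (overlap x1 r1 (z k + y2) r2).
have lens_fin b (w : 'rV[R]_n.+1) : lens_mass F b w \is a fin_num.
  exact: (overlap_fin 0 b w b).
have L_lo k : fine (lens_mass F 0 (z k)) <= L k.
  apply: fine_le; [exact: lens_fin|exact: overlap_fin|].
  rewrite -overlap_lens; apply: overlap_mono.
    by rewrite sub0r enormN addr0.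
  by rewrite opprD addrA subrr add0r enormN addr0.
have L_hi k : L k <= fine (lens_mass F a (z k)).
  apply: fine_le; [exact: overlap_fin|exact: lens_fin|].
  rewrite -overlap_lens; apply: overlap_mono.
    by rewrite subr0 /a; lra.
  by rewrite [z k + y2]addrC addrK /a; lra.
have rho0 : rho (enorm (z k)) @[k --> \oo] --> (0 : R) by exact: (cvg_comp _ _ zoo rho_cvg0).
have [t3 t30 pos] := tail_gt0_near F_power_law.
have rho_pos : \forall k \near \oo, 0 < rho (enorm (z k)).
  have /cvgryPge/(_ t3) := zoo; apply: filterS => k h.
  by rewrite mulr_gt0 ?exprn_gt0 ?pos// (lt_le_trans t30).
have cL : L k / rho (enorm (z k)) @[k --> \oo] --> c_ad alpha n.+1.
  apply: (squeeze_cvgr _ cl cu); apply: filterS rho_pos => k h.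
  have h' : 0 <= (rho (enorm (z k)))^-1 by rewrite invr_ge0 ltW.
  by apply/andP; split; apply: ler_wpM2r; [exact: h'|exact: L_lo|exact: h'|exact: L_hi].
have L0 : L k @[k --> \oo] --> (0 : R).
  have cM : L k / rho (enorm (z k)) * rho (enorm (z k)) @[k --> \oo] --> (0 : R).
    by rewrite -(mulr0 (c_ad alpha n.+1)); exact: cvgM cL rho0.
  apply: near_cvg cM.
  apply: filterS rho_pos => k h /=.
  by rewrite divfK ?gt_eqF.
have cE : (lam * (L k / rho (enorm (z k)))) * expR (lam * L k) @[k --> \oo] -->
    lam * c_ad alpha n.+1.
  have -> : lam * c_ad alpha n.+1 = lam * c_ad alpha n.+1 * expR (lam * 0).
    by rewrite mulr0 expR0 mulr1.
  apply: cvgM; first by apply: cvgMl_tmp; exact: cL.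
  apply: (@cvg_comp _ _ _ (fun k => lam * L k) (@expR R)); last exact: continuous_expR.
  by apply: cvgMl_tmp; exact: L0.
have cq : (expR (lam * L k) - 1) / rho (enorm (z k)) @[k --> \oo] --> lam * c_ad alpha n.+1.
  have cM : lam * (L k / rho (enorm (z k))) @[k --> \oo] --> lam * c_ad alpha n.+1.
    by apply: cvgMl_tmp; exact: cL.
  apply: (squeeze_cvgr _ cM cE); apply: filterS rho_pos => k h.
  have Lk : 0 <= lam * L k by rewrite mulr_ge0 ?(ltW lam_gt0)// fine_ge0 ?overlap_ge0.
  apply/andP; split.
    by rewrite mulrA ler_pM2r ?invr_gt0// lerBrDl; exact: expR_ge1Dx.
  have -> : lam * (L k / rho (enorm (z k))) * expR (lam * L k) =
     lam * L k * expR (lam * L k) / rho (enorm (z k)) by ring.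
  by rewrite ler_pM2r ?invr_gt0//; exact: expR_sub1_le.
have cM : retain r1 * retain r2 * ((expR (lam * L k) - 1) / rho (enorm (z k)))
    @[k --> \oo] --> retain r1 * retain r2 * (lam * c_ad alpha n.+1).
  by apply: cvgMl_tmp; exact: cq.
rewrite mulrC; apply: near_cvg cM; have /cvgryPge/(_ (2 * (r1 + r2) + 1)) := zoo.
apply: filterS => k hk; rewrite /excess /retain2.
have -> : r1 + r2 < enorm (x1 - (z k + y2)).
  rewrite (enormB x1); have := enorm_triangle (z k + y2) (z k) 0; rewrite !subr0.
  rewrite opprD addrA subrr add0r enormN.
  have := enorm_triangle x1 (z k + y2) 0; rewrite !subr0.
  by move: hk hx1 hy2 => /=; lra.
by rewrite -/(L k) mulrA mulrBr mulr1.
Qed.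

End retention_asymptotics.

(** * Average over pairs of marks *)

Section bounded_convergence.
Context {R : realType} {d : measure_display} {T : measurableType d}.
Variables (kappa : {sigma_finite_measure set T -> \bar R}) (D : set T).
Hypotheses (mD : measurable D) (kD : (kappa D < +oo)%E).

Lemma bounded_integrable (f : T -> R) (C : R) : measurable_fun D f ->
  (forall t, D t -> `|f t| <= C) -> kappa.-integrable D (EFin \o f).
Proof.
move=> mf fC; apply: measurable_bounded_integrable => //.
exists C; split; first exact: num_real.
by move=> x Cx t Dt; apply: ltW; apply: le_lt_trans Cx; exact: fC.
Qed.

Lemma bounded_convergence (f : nat -> T -> R) (g : T -> R) (C : R) :
  (forall k, measurable_fun D (f k)) -> measurable_fun D g ->
  (forall t, D t -> f k t @[k --> \oo] --> g t) ->
  (\forall k \near \oo, forall t, D t -> `|f k t| <= C) ->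
  \int[kappa]_(t in D) f k t @[k --> \oo] --> \int[kappa]_(t in D) g t.
Proof.
move=> mf mg fg [N _ hN].
have [] // := @dominated_convergence _ _ _ kappa D mD (fun k t => (f (k + N)%N t)%:E)
    (EFin \o g) (EFin \o cst C).
- by move=> k; exact/measurable_EFinP.
- exact/measurable_EFinP.
- apply: aeW => t Dt; apply: cvg_EFin; first by near=> k.
  by apply: (cvg_comp (fun k => (k + N)%N) (f ^~ t)) (fg t Dt); exact: cvg_addnr.
- by apply: (@bounded_integrable _ `|C|) => // t _; exact: measurable_cst.
- by apply: aeW => t k Dt /=; rewrite lee_fin; apply: hN => //; exact: leq_addl.
move=> ig _ cv; rewrite -(cvg_shiftn N) /Rintegral.
apply: fine_cvg; rewrite fineK; first exact: cv.
by apply: integrable_fin_num.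
Unshelve. all: by end_near. Qed.

Lemma measurable_integral_snd d' (S : measurableType d') (f : S * T -> \bar R) :
  measurable_fun setT f -> measurable_fun setT (fun s => (\int[kappa]_(t in D) f (s, t))%E).
Proof.
move=> mf.
have pos (g : S * T -> \bar R) : measurable_fun setT g -> (forall p, 0 <= g p)%E ->
    measurable_fun setT (fun s => (\int[kappa]_(t in D) g (s, t))%E).
  move=> mg g0.
  have mSD : measurable ([set: S] `*` D) by exact: measurableX.
  rewrite (_ : (fun s => _) = (fun s => \int[kappa]_t (g \_ ([set: S] `*` D)) (s, t))%E).
    apply: (measurable_fun_fubini_tonelli_F (g \_ ([set: S] `*` D))).
      by apply/(measurable_restrictT _ _).1 => //; exact: measurable_funTS.
    by move=> p; exact: erestrict_ge0.
  apply/funext => s; rewrite integral_mkcond; apply: eq_integral => t _.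
  rewrite /patch; congr (if _ then _ else _).
  by apply/idP/idP; rewrite !inE /=; [split|case].
have mp := pos _ (measurable_funepos mf) (funepos_ge0 f).
have mn := pos _ (measurable_funeneg mf) (funeneg_ge0 f).
have := emeasurable_funB mp mn; congr measurable_fun.
apply/funext => s /=; rewrite [RHS]integralE.
by congr (_ - _)%E; apply: eq_integral => t _; rewrite ?funeposE ?funenegE.
Qed.

Lemma norm_Rintegral_le (f : T -> R) (C : R) : measurable_fun D f -> 0 <= C ->
  (forall t, D t -> `|f t| <= C) -> `|\int[kappa]_(t in D) f t| <= C * fine (kappa D).
Proof.
move=> mf C0 fC; have fi := bounded_integrable mf fC.
apply: le_trans (le_normr_Rintegral mD fi) _.
apply: (@le_trans _ _ (\int[kappa]_(t in D) C)).
  apply: le_Rintegral => //.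
    apply: (@bounded_integrable _ C); first exact: measurableT_comp.
    by move=> t Dt; rewrite normr_id; exact: fC.
  by apply: (@bounded_integrable _ `|C|); first exact: measurable_cst.
by rewrite Rintegral_cst.
Qed.

End bounded_convergence.

Section mark_average.
Context {R : realType} {n : nat}.
Variables (F : probability (measurableTypeR R) R) (alpha lam : R).
Hypothesis F_Rplus : F `]-oo, 0[%classic = 0%E.
Hypothesis F_power_law : power_law F alpha.
Hypothesis alpha_gt : n.+1%:R < alpha.
Hypothesis lam_gt0 : 0 < lam.

Local Notation retain := (@retain R n F lam).
Local Notation retain2 := (@retain2 R n F lam).
Local Notation excess := (@excess R n F lam).
Local Notation rho := (@rho R n F).

Lemma measurable_retain d (T : measurableType d) (b : T -> R) :
  measurable_fun setT b -> measurable_fun setT (fun t => retain (b t)).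
Proof.
move=> mb; rewrite /retain.
apply: (measurableT_comp (@measurable_expR R)); apply: measurable_funN.
apply: measurable_funM => //.
apply: (measurableT_comp (@fine_measurable R setT measurableT)).
under eq_fun do rewrite -(overlap_self F (0 : 'rV[R]_n.+1)).
by apply: measurable_overlap => //; exact: measurable_cst.
Qed.

Lemma measurable_retain2 d (T : measurableType d) (c1 c2 : T -> 'rV[R]_n.+1) (b1 b2 : T -> R) :
  measurable_fun setT c1 -> measurable_fun setT b1 ->
  measurable_fun setT c2 -> measurable_fun setT b2 ->
  measurable_fun setT (fun t => retain2 (c1 t) (b1 t) (c2 t) (b2 t)).
Proof.
move=> mc1 mb1 mc2 mb2; rewrite /retain2; apply: measurable_fun_ifT => //.
  apply: measurable_fun_ltr; first exact: measurable_funD.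
  exact: measurable_dist.
apply: measurable_funM; first by apply: measurable_funM; exact: measurable_retain.
apply: (measurableT_comp (@measurable_expR R)); apply: measurable_funM => //.
apply: (measurableT_comp (@fine_measurable R setT measurableT)).
exact: measurable_overlap.
Qed.

Lemma measurable_excess d (T : measurableType d) (c1 c2 : T -> 'rV[R]_n.+1) (b1 b2 : T -> R) :
  measurable_fun setT c1 -> measurable_fun setT b1 ->
  measurable_fun setT c2 -> measurable_fun setT b2 ->
  measurable_fun setT (fun t => excess (c1 t) (b1 t) (c2 t) (b2 t)).
Proof.
move=> mc1 mb1 mc2 mb2; apply: measurable_funB; first exact: measurable_retain2.
by apply: measurable_funM; exact: measurable_retain.
Qed.

Context {d : measure_display} {T : measurableType d}.
Variables (kappa : {sigma_finite_measure set T -> \bar R}) (D : set T).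
Hypotheses (mD : measurable D) (kD : (kappa D < +oo)%E).
Variables (pos : T -> 'rV[R]_n.+1) (rad : T -> R).
Hypotheses (mpos : measurable_fun setT pos) (mrad : measurable_fun setT rad).
Hypothesis pos_rad : forall t, D t -> enorm (pos t) <= rad t.

Let ex z t1 t2 := excess (pos t1) (rad t1) (z + pos t2) (rad t2).

Let mex2 z t1 : measurable_fun D (ex z t1).
Proof.
apply: measurable_funTS; apply: measurable_excess => //.
by apply: measurable_rVD.
Qed.

Let mex1 z : measurable_fun setT (fun t1 => \int[kappa]_(t2 in D) ex z t1 t2).
Proof.
rewrite /Rintegral; apply: (measurableT_comp (@fine_measurable R setT measurableT)).
apply: (@measurable_integral_snd _ _ _ kappa D mD _ _ (fun p => (ex z p.1 p.2)%:E)).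
apply/measurable_EFinP; apply: measurable_excess.
- exact: (measurableT_comp mpos measurable_fst).
- exact: (measurableT_comp mrad measurable_fst).
- apply: measurable_rVD => //; exact: (measurableT_comp mpos measurable_snd).
- exact: (measurableT_comp mrad measurable_snd).
Qed.

(** Both statistics of the thinned model are averages of the excess over two
    independent marks, and the bound on the excess is uniform in the marks. *)
Lemma excess_average (z : nat -> 'rV[R]_n.+1) :
  enorm (z k) @[k --> \oo] --> +oo ->
  (\int[kappa]_(t1 in D) \int[kappa]_(t2 in D)
      excess (pos t1) (rad t1) (z k + pos t2) (rad t2)) / rho (enorm (z k))
    @[k --> \oo] -->
  lam * c_ad alpha n.+1 * (\int[kappa]_(t in D) retain (rad t)) ^+ 2.
Proof.
move=> zoo; pose c := lam * c_ad alpha n.+1.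
have mret : measurable_fun D (fun t => retain (rad t)).
  by apply: measurable_funTS; exact: measurable_retain.
have reti : kappa.-integrable D (EFin \o (fun t => retain (rad t))).
  apply: (@bounded_integrable _ _ _ _ _ mD kD _ 1) => // t _.
  by rewrite ger0_norm ?(retain_le1 _ lam_gt0)// ltW ?retain_gt0.
have [C [u0 [C0 u00 hC]]] := excess_bound F_Rplus F_power_law alpha_gt lam_gt0.
have [t3 t30 tpos] := tail_gt0_near F_power_law.
have rho_pos : \forall k \near \oo, 0 < rho (enorm (z k)).
  have /cvgryPge/(_ t3) := zoo; apply: filterS => k h.
  by rewrite mulr_gt0 ?exprn_gt0 ?tpos// (lt_le_trans t30).
have big : \forall k \near \oo, u0 <= enorm (z k).
  by have /cvgryPge/(_ u0) := zoo.
have exC : \forall k \near \oo, forall t1 t2, D t1 -> D t2 ->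
    `|ex (z k) t1 t2 / rho (enorm (z k))| <= C.
  apply: filterS2 rho_pos big => k rk uk t1 t2 D1 D2.
  rewrite normrM [X in _ * X]ger0_norm ?invr_ge0 ?(ltW rk)// ler_pdivrMr//.
  apply: hC => //; first exact: pos_rad.
  by rewrite [z k + _]addrC addrK; exact: pos_rad.
have inner t1 : D t1 ->
    \int[kappa]_(t2 in D) (ex (z k) t1 t2 / rho (enorm (z k))) @[k --> \oo] -->
    \int[kappa]_(t2 in D) (c * (retain (rad t1) * retain (rad t2))).
  move=> D1; apply: (@bounded_convergence _ _ _ _ _ mD kD _ _ C).
  - by move=> k; apply: measurable_funM; [exact: mex2|exact: measurable_cst].
  - apply: measurable_funM; first exact: measurable_cst.
    by apply: measurable_funM; [exact: measurable_cst|exact: mret].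
  - move=> t2 D2; apply: (excess_cvg F_Rplus F_power_law alpha_gt lam_gt0) => //; exact: pos_rad.
  - by apply: filterS exC => k h t2; exact: h.
have ex1 k t1 t : `|ex (z k) t1 t| <= 1.
  apply: ler_norm_sub_max.
  - exact: retain2_ge0.
  - by rewrite mulr_ge0 ?ltW ?retain_gt0.
  - have [e1 _] := retain2_le F_Rplus F_power_law alpha_gt lam_gt0
      (pos t1) (rad t1) (z k + pos t) (rad t).
    by apply: le_trans e1 _; exact: retain_le1.
  - by rewrite mulr_ile1 ?(retain_le1 _ lam_gt0) ?ltW ?retain_gt0.
have exi k t1 : kappa.-integrable D (EFin \o ex (z k) t1).
  by apply: (@bounded_integrable _ _ _ _ _ mD kD _ 1); [exact: mex2|move=> t _; exact: ex1].
have innerE k t1 : \int[kappa]_(t2 in D) (ex (z k) t1 t2 / rho (enorm (z k))) =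
    (\int[kappa]_(t2 in D) ex (z k) t1 t2) / rho (enorm (z k)).
  by rewrite RintegralZr.
have limE t1 : \int[kappa]_(t2 in D) (c * (retain (rad t1) * retain (rad t2))) =
    c * (\int[kappa]_(t in D) retain (rad t)) * retain (rad t1).
  under eq_Rintegral do rewrite mulrA.
  by rewrite RintegralZl// mulrAC.
have outer : \int[kappa]_(t1 in D) ((\int[kappa]_(t2 in D) ex (z k) t1 t2) / rho (enorm (z k)))
    @[k --> \oo] -->
    \int[kappa]_(t1 in D) (c * (\int[kappa]_(t in D) retain (rad t)) * retain (rad t1)).
  apply: (@bounded_convergence _ _ _ _ _ mD kD _ _ (C * fine (kappa D))).
  - move=> k; apply: measurable_funM; last exact: measurable_cst.
    exact: measurable_funTS (mex1 _).
  - by apply: measurable_funM; [exact: measurable_cst|exact: mret].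
  - move=> t1 D1; rewrite -limE; under eq_fun do rewrite -innerE; exact: inner.
  - apply: filterS exC => k h t1 D1; rewrite -innerE; apply: norm_Rintegral_le => //.
      by apply: measurable_funM; [exact: mex2|exact: measurable_cst].
    by move=> t2 D2; exact: h.
rewrite RintegralZl// -mulrA -expr2 in outer.
apply: near_cvg outer; apply: nearW => k; rewrite RintegralZr//.
apply: (@bounded_integrable _ _ _ _ _ mD kD _ (1 * fine (kappa D))).
  exact: measurable_funTS (mex1 _).
by move=> t1 D1; apply: (norm_Rintegral_le mD kD); [exact: mex2|exact: ler01|move=> t _; exact: ex1].
Qed.

End mark_average.

(** * Grains, blocking and cells *)

Section grains.
Context {R : realType} {n : nat}.
Local Notation graind := (grain R n.+1).
Implicit Types g : graind.

Lemma measurable_center : measurable_fun setT (@center R n.+1).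
Proof. exact: (measurableT_comp measurable_fst measurable_fst). Qed.

Lemma measurable_radius : measurable_fun setT (@radius R n.+1).
Proof. exact: (measurableT_comp measurable_snd measurable_fst). Qed.

Lemma measurable_weight : measurable_fun setT (@weight R n.+1).
Proof. exact: measurable_snd. Qed.

(** [g'] prevents the retention of [g], except that a grain does not block
    itself. *)
Definition blocks g g' : Prop :=
  [/\ 0 <= radius g, 0 <= radius g',
    enorm (center g - center g') <= radius g + radius g' & weight g <= weight g'].

Lemma blocksP g g' : blocks g g' <->
  grain_ball g' `&` grain_ball g !=set0 /\ ~~ (weight g' < weight g).
Proof.
rewrite -leNgt /grain_ball cball_meet; split=> [[r r' h w]|[[r' r h] w]].
  by split=> //; split=> //; rewrite enormB [radius g' + _]addrC.
by split=> //; rewrite enormB [radius g + _]addrC.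
Qed.

Definition cell_code k g : 'rV[int]_n.+1 * int * int :=
  (map_mx (fun c => Num.floor (k.+1%:R * c)) (center g),
   Num.floor (k.+1%:R * radius g), Num.floor (k.+1%:R * weight g)).

(** All scales up to [N] are recorded, so that the cells are nested. *)
Definition cell N g : nat := choice.pickle [seq cell_code k g | k <- iota 0 N.+1].

Lemma cellP N g g' : cell N g = cell N g' <->
  forall k, (k <= N)%N -> cell_code k g = cell_code k g'.
Proof.
split=> [/(pcan_inj choice.pickleK)/eq_in_map h k kN|h]; first by apply: h; rewrite mem_iota.
by congr choice.pickle; apply/eq_in_map => k; rewrite mem_iota => /andP[_]; exact: h.
Qed.

Lemma cell_nested m N g g' : (m <= N)%N -> cell N g = cell N g' -> cell m g = cell m g'.
Proof. by move=> mN /cellP h; apply/cellP => k km; apply: h; exact: leq_trans mN. Qed.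

Lemma measurable_floor_eq (f : graind -> R) (a : R) (m : int) : measurable_fun setT f ->
  measurable [set g | Num.floor (a * f g) = m].
Proof.
move=> mf; rewrite (_ : [set _ | _] = [set g | m%:~R <= a * f g] `&` ~` [set g | (m + 1)%:~R <= a * f g]).
  have ma : measurable_fun setT (fun g => a * f g) by apply: measurable_funM.
  apply: measurableI; first exact: measurable_set_le.
  by apply: measurableC; exact: measurable_set_le.
apply/seteqP; split=> g /=.
  by move=> <-; have /andP[h1 h2] := floor_itv (a * f g); split=> //; rewrite leNgt h2.
by move=> [h1 /negP]; rewrite -ltNge => h2; apply: floor_def; rewrite h1.
Qed.

Lemma measurable_cell N k : measurable [set g | cell N g = k].
Proof.
case: (pselect (exists g0, cell N g0 = k)) => [[g0 <-]|no]; last first.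
  by rewrite (_ : [set _ | _] = set0)// -subset0 => g gk; apply: no; exists g.
rewrite (_ : [set _ | _] = \bigcap_(j in [set j | (j <= N)%N]) [set g | cell_code j g = cell_code j g0]).
  apply: bigcap_measurable; first by exists 0%N.
  move=> j _; rewrite (_ : [set _ | _] =
    (\bigcap_(i in [set: 'I_n.+1]) [set g | Num.floor (j.+1%:R * center g ord0 i) =
       Num.floor (j.+1%:R * center g0 ord0 i)]) `&`
    [set g | Num.floor (j.+1%:R * radius g) = Num.floor (j.+1%:R * radius g0)] `&`
    [set g | Num.floor (j.+1%:R * weight g) = Num.floor (j.+1%:R * weight g0)]).
    apply: measurableI; first apply: measurableI.
    - apply: fin_bigcap_measurable => // i _; apply: measurable_floor_eq.
      exact: (measurableT_comp (measurable_coord i) measurable_center).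
    - by apply: measurable_floor_eq; exact: measurable_radius.
    - by apply: measurable_floor_eq; exact: measurable_weight.
  rewrite /cell_code; apply/seteqP; split=> g /=.
    move=> [/rowP hx hr hw]; split=> //; split=> // i _.
    by have := hx i; rewrite !mxE.
  move=> [[hx hr] hw]; congr (_, _, _) => //; apply/rowP => i; rewrite !mxE.
  exact: hx.
by apply/seteqP; split=> g /= => [/cellP h j jN|h]; [exact: h|apply/cellP].
Qed.

Lemma floor_close (a x y : R) : 0 < a -> Num.floor (a * x) = Num.floor (a * y) ->
  `|x - y| <= a^-1.
Proof.
move=> a0 h; rewrite -(ler_pM2l a0) mulfV ?gt_eqF// -{1}(gtr0_norm a0) -normrM mulrBr.
have aux (u v m : R) : m <= u < m + 1 -> m <= v < m + 1 -> `|u - v| <= 1.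
  by move=> /andP[h1 h2] /andP[h3 h4]; rewrite ler_norml; apply/andP; split; lra.
apply: (aux _ _ (Num.floor (a * x))%:~R).
  by have := floor_itv (a * x); rewrite intrD.
by have := floor_itv (a * y); rewrite h intrD.
Qed.

Lemma cell_close N g g' : cell N g = cell N g' ->
  [/\ enorm (center g - center g') <= n.+1%:R / N.+1%:R,
    `|radius g - radius g'| <= N.+1%:R^-1 & `|weight g - weight g'| <= N.+1%:R^-1].
Proof.
move=> /cellP/(_ N (leqnn _)) [/rowP hx hr hw]; have N0 : 0 < N.+1%:R :> R by rewrite ltr0n.
split; [|exact: floor_close|exact: floor_close].
apply: enorm_le_box; first by rewrite invr_ge0 ltW.
by move=> i; rewrite !mxE; apply: floor_close => //; have := hx i; rewrite !mxE.
Qed.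

Lemma le_archi (a b c : R) : (forall N : nat, a <= b + c / N.+1%:R) -> a <= b.
Proof.
move=> h; apply/ler_addgt0Pr => e e0.
pose N := Num.truncn (`|c| / e).
apply: le_trans (h N) _; rewrite lerD2l ler_pdivrMr ?ltr0n//.
have : `|c| / e < N.+1%:R by exact: Num.Theory.truncnS_gt.
rewrite ltr_pdivrMr// mulrC => /ltW; apply: le_trans; exact: ler_norm.
Qed.

(** The conditions in [blocks] are closed, and the diameters of the cells vanish. *)
Lemma blocks_closed g g' :
  (forall N, exists h h', [/\ cell N h = cell N g, cell N h' = cell N g' & blocks h h']) ->
  blocks g g'.
Proof.
move=> H; split.
- apply: (@le_archi _ _ 1) => N; have [h [h' [/cell_close[_ + _] _ [r0 _ _ _]]]] := H N.
  rewrite div1r ler_norml; move: (N.+1%:R^-1) r0 => e r0 /andP[_ re]. lra.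
- apply: (@le_archi _ _ 1) => N; have [h [h' [_ /cell_close[_ + _] [_ r0 _ _]]]] := H N.
  rewrite div1r ler_norml; move: (N.+1%:R^-1) r0 => e r0 /andP[_ re]. lra.
- apply: (@le_archi _ _ (2 * n.+1%:R + 2)) => N.
  have [h [h' [/cell_close[c1 r1 _] /cell_close[c2 r2 _] [_ _ hh _]]]] := H N.
  have t1 := enorm_triangle (center h) (center g) (center g').
  have t2 := enorm_triangle (center h') (center h) (center g').
  rewrite enormB in c1; move: r1 r2; rewrite !ler_norml => /andP[_ r1] /andP[_ r2].
  have -> : (2 * n.+1%:R + 2) / N.+1%:R = n.+1%:R / N.+1%:R + n.+1%:R / N.+1%:R
      + N.+1%:R^-1 + N.+1%:R^-1 :> R by ring.
  move: (n.+1%:R / N.+1%:R : R) (N.+1%:R^-1 : R) c1 c2 r1 r2 => e e' c1 c2 r1 r2; lra.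
- apply: (@le_archi _ _ 2) => N.
  have [h [h' [/cell_close[_ _ w1] /cell_close[_ _ w2] [_ _ _ hh]]]] := H N.
  move: w1 w2; rewrite !ler_norml => /andP[w1 _] /andP[_ w2].
  have -> : 2 / N.+1%:R = N.+1%:R^-1 + N.+1%:R^-1 :> R by ring.
  move: (N.+1%:R^-1 : R) w1 w2 => e w1 w2; lra.
Qed.

Definition window (m : nat) : set graind :=
  [set g | [/\ enorm (center g) <= m%:R, radius g <= m%:R & weight g <= m%:R]].

Lemma measurable_window m : measurable (window m).
Proof.
rewrite (_ : window m = [set g | enorm (center g) <= m%:R] `&` [set g | radius g <= m%:R]
  `&` [set g | weight g <= m%:R]).
  apply: measurableI; first apply: measurableI; apply: measurable_set_le => //.
  - exact: (measurableT_comp measurable_enorm measurable_center).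
  - exact: measurable_radius.
  - exact: measurable_weight.
by apply/seteqP; split=> [g []|g [[]]].
Qed.

Lemma window_nd m N : (m <= N)%N -> window m `<=` window N.
Proof.
move=> mN g [h1 h2 h3]; have mN' : m%:R <= N%:R :> R by rewrite ler_nat.
by split; [apply: le_trans h1 _|apply: le_trans h2 _|apply: le_trans h3 _].
Qed.

Lemma window_cover g : exists m, window m g.
Proof.
pose b := Num.max (enorm (center g)) (Num.max (radius g) (weight g)).
exists (Num.truncn b).+1; have /ltW h := Num.Theory.truncnS_gt b.
by split; apply: le_trans h; rewrite /b !le_max lexx ?orbT.
Qed.

Definition covering (y : 'rV[R]_n.+1) : set graind :=
  [set g | enorm (y - center g) <= radius g].

Lemma measurable_covering y : measurable (covering y).
Proof.
apply: measurable_set_le; last exact: measurable_radius.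
by apply: measurable_dist => //; exact: measurable_center.
Qed.

Lemma covering_refl y g : covering y g -> blocks g g.
Proof.
move=> h; have r0 : 0 <= radius g := le_trans (enorm_ge0 _) h.
by split=> //; rewrite subrr enorm0 addr_ge0.
Qed.

Lemma covering_clique y : clique blocks (covering y).
Proof.
move=> g g' h h'; have r := le_trans (enorm_ge0 _) h; have r' := le_trans (enorm_ge0 _) h'.
have meet : enorm (center g - center g') <= radius g + radius g'.
  apply: le_trans (enorm_triangle y _ _) _; rewrite enormB; exact: lerD.
have meet' : enorm (center g' - center g) <= radius g' + radius g by rewrite enormB [radius g' + _]addrC.
by case: (leP (weight g) (weight g')) => w; [left|right; have := ltW w].
Qed.

End grains.

(** * Null sets and limits at infinity *)

Section null_complement.
Context {R : realType} {d : measure_display} {T : measurableType d}.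
Variable mu : {measure set T -> \bar R}.
Local Open Scope ereal_scope.
Import HBNNSimple.

(** Simple functions can be cut off outside [D] without changing their integral,
    so that the equality passes to the supremum, whatever the integrand. *)
Lemma null_complement_integral (D : set T) (f : T -> \bar R) : measurable D ->
  mu (~` D) = 0 -> \int[mu]_x f x = \int[mu]_(x in D) f x.
Proof.
move=> mD D0.
have pos (g : T -> \bar R) : (forall x, 0 <= g x) ->
    \int[mu]_x g x = \int[mu]_(x in D) g x.
  move=> g0; rewrite [RHS]integral_mkcond.
  have gD0 x : 0 <= (g \_ D) x by exact: erestrict_ge0.
  rewrite !ge0_integralTE//; apply/eqP; rewrite eq_le; apply/andP; split.
    apply: ge_ereal_sup => _ [h hg <-]; apply: ereal_sup_ubound.
    exists (proj_nnsfun h mD).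
      move=> x; rewrite /= /patch mindicE; case: ifPn => xD; first by rewrite mulr1.
      by rewrite mulr0.
    rewrite -!integralT_nnsfun; apply: ge0_ae_eq_integral => //.
    - by apply/measurable_EFinP.
    - by apply/measurable_EFinP.
    - by move=> x _; rewrite lee_fin.
    - by move=> x _; rewrite lee_fin.
    exists (~` D); split => //; first exact: measurableC.
    by move=> x /=; apply: contra_not => Dx _; rewrite mindicE mem_set// mulr1.
  apply: ge_ereal_sup => _ [h hg <-]; apply: ereal_sup_ubound; exists h => // x.
  by apply: le_trans (hg x) _; rewrite /patch; case: ifPn.
by rewrite integralE [RHS]integralE; congr (_ - _); apply: pos => x;
  [exact: funepos_ge0|exact: funeneg_ge0].
Qed.

Lemma null_complement_Rintegral (D : set T) (f : T -> R) : measurable D ->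
  mu (~` D) = 0 -> (\int[mu]_x f x = \int[mu]_(x in D) f x)%R.
Proof. by move=> mD D0; rewrite /Rintegral (null_complement_integral _ mD D0). Qed.

End null_complement.

Section enorm_filter.
Context {R : realType} {n : nat}.

(** The filter has a countable base. *)
Lemma enorm_pinfty_seq (f : 'rV[R]_n -> R) (l : R) :
  (forall z : nat -> 'rV[R]_n, enorm (z k) @[k --> \oo] --> +oo ->
     f (z k) @[k --> \oo] --> l) ->
  f z @[z --> enorm_pinfty] --> l.
Proof.
move=> H.
have FF : Filter (@enorm_pinfty R n).
  apply: filter_from_filter; first by exists 0.
  move=> i j _ _; exists (Num.max i j) => // z /=.
  by rewrite gt_max => /andP[].
apply/cvgrPdist_lt => e e0; apply: contrapT => nf.
have bad (k : nat) : exists z : 'rV[R]_n, k%:R < enorm z /\ ~ (`|l - f z| < e).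
  apply: contrapT => h; apply: nf; exists k%:R => // z /= kz.
  by apply: contrapT => hz; apply: h; exists z.
have [z hz] := choice bad.
have zoo : enorm (z k) @[k --> \oo] --> +oo.
  apply/cvgryPge => A; exists (Num.truncn `|A|).+1 => // k /= kA.
  have [kz _] := hz k; apply: le_trans (ltW kz).
  apply: le_trans (ler_norm A) _; apply: le_trans (ltW (Num.Theory.truncnS_gt _)) _.
  by rewrite ler_nat.
have /cvgrPdist_lt/(_ e e0)[N _ hN] := H z zoo.
by have [_] := hz N; apply; apply: hN => /=.
Qed.

End enorm_filter.

(** * The intensity measure *)

Section grain_measure.
Context {R : realType} {n : nat}.
Local Notation lebn := (lebesgue_rV R n.+1).
Local Notation graind := (grain R n.+1).
Local Notation markT := ('rV[R]_n.+1 * measurableTypeR R)%type.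
Variables (F : probability (measurableTypeR R) R) (alpha lam : R).
Hypothesis F_Rplus : F `]-oo, 0[%classic = 0%E.
Hypothesis F_power_law : power_law F alpha.
Hypothesis alpha_gt : n.+1%:R < alpha.
Hypothesis lam_gt0 : 0 < lam.

Local Notation overlap := (@overlap R n F).
Local Notation disc_mass := (@disc_mass R n F).
Local Notation retain := (@retain R n F lam).
Local Notation retain2 := (@retain2 R n F lam).

Definition mark1 (p : markT) : graind := (p.1, p.2, 1).

Lemma measurable_mark1 : measurable_fun setT mark1.
Proof.
apply/measurable_fun_pairP; split; last exact: measurable_cst.
by apply/measurable_fun_pairP; split; [exact: measurable_fst|exact: measurable_snd].
Qed.

(** A name of its own for the product measure, to carry the structure of a
    sigma-finite measure. *)
Definition mark_law : set markT -> \bar R := (lebn \x F)%E.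

HB.instance Definition _ := Measure.on mark_law.

Local Notation mu := mark_law.

Let mu_sigma_finite : sigma_finite setT mu.
Proof.
have /sigma_finiteP[E [TE ndE Eoo]] := sigma_finiteT lebn.
exists (fun k => E k `*` setT).
  rewrite -setXTT TE; apply/seteqP; split=> [[x r] [/= [i _ Ei] _]|[x r] [i _ [/= Ei _]]].
    by exists i.
  by split => //; exists i.
move=> k; have [mE Ek] := Eoo k; split; first exact: measurableX.
rewrite /mark_law product_measure1E//; apply: lte_mul_pinfty => //.
  by rewrite ge0_fin_numE.
by apply: le_lt_trans (probability_le1 F measurableT) _; rewrite ltry.
Qed.

HB.instance Definition _ := Measure_isSigmaFinite.Build _ _ _ mark_law mu_sigma_finite.

Definition grain_intensity : {measure set graind -> \bar R} :=
  mscale (NngNum (ltW lam_gt0)) (image_measure mu measurable_mark1).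

Local Notation Lam := grain_intensity.

Lemma LamE A : Lam A = (lam%:E * mu (mark1 @^-1` A))%E.
Proof. by []. Qed.

Lemma measurable_mark1_preim A : measurable A -> measurable (mark1 @^-1` A).
Proof. exact: measurable_preim measurable_mark1. Qed.

(** Integrating over the center first, as in the definition of [overlap]. *)
Lemma mu_swap X : measurable X -> mu X = (\int[F]_s lebn (ysection X s))%E.
Proof.
move=> mX; apply: (product_measure_unique (m' := (lebn \x^ F)%E)) => // Y Z mY mZ.
exact: product_measure2E.
Qed.

Lemma intensityE (G : R.-pker (measurableTypeR R) ~> (measurableTypeR R)) A :
  (forall (r : R) (B : set (measurableTypeR R)), measurable B ->
     G r B = \d_(1 : measurableTypeR R) B) ->
  measurable A -> intensity lam F G A = Lam A.
Proof.
move=> G1 mA; rewrite LamE /intensity; congr (_ * _)%E.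
have mA1 := measurable_mark1_preim mA.
apply: eq_integral => x _.
transitivity (\int[F]_r (\1_(xsection (mark1 @^-1` A) x) r)%:E)%E.
  apply: eq_integral => r _; rewrite G1.
    rewrite diracE indicE; congr (_%:R%:E); congr nat_of_bool.
    by apply/idP/idP; rewrite !inE /xsection/= ?inE.
  have mp : measurable_fun setT (fun w : measurableTypeR R => ((x, r), w) : graind).
    exact: pair1_measurable.
  exact: (measurable_preim mp mA).
by rewrite integral_indic ?setIT//; exact: measurable_xsection.
Qed.

(** The intensity measure is carried by the grains of weight 1. *)
Lemma integral_Lam (B : set graind) (f : graind -> \bar R) (f' : markT -> \bar R) :
  measurable B -> (forall p, B (mark1 p) -> f (mark1 p) = f' p) ->
  measurable_fun setT f' -> (forall p, 0 <= f' p)%E ->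
  (\int[Lam]_(g in B) f g = lam%:E * \int[mu]_(p in mark1 @^-1` B) f' p)%E.
Proof.
move=> mB ff' mf' f'0.
pose D : set graind := [set g | weight g = 1].
have mD : measurable D.
  rewrite (_ : D = weight @^-1` [set 1])//; apply: measurable_preim => //.
  exact: measurable_weight.
have D0 : Lam (~` D) = 0%E.
  by rewrite LamE (_ : _ @^-1` _ = set0) ?measure0 ?mule0// -subset0 => p /=; apply.
have mfst : measurable_fun setT (fun g : graind => f' g.1).
  exact: (measurableT_comp mf' measurable_fst).
rewrite [LHS]integral_mkcond (null_complement_integral _ mD D0).
transitivity (\int[Lam]_(g in D) ((fun g => f' g.1) \_ B) g)%E.
  apply: eq_integral => -[[x r] w]; rewrite inE /D /weight/= => ->.
  rewrite /patch; case: ifPn => //; rewrite inE => Bg.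
  exact: (ff' (x, r)).
rewrite -(null_complement_integral _ mD D0) -integral_mkcond.
rewrite ge0_integral_mscale//; last exact: measurable_funTS.
congr (_ * _)%E.
rewrite (ge0_integral_pushforward measurable_mark1)//; last exact: measurable_funTS.
by apply: eq_integral => -[].
Qed.

Lemma mu_radius_lt0 : mu [set p | p.2 < 0] = 0%E.
Proof.
rewrite (_ : [set _ | _] = setT `*` `]-oo, (0 : R)[%classic).
  rewrite /mark_law /= product_measure1E//.
  by rewrite [X in (_ * X)%E](_ : _ = 0%E) ?mule0//; exact: F_Rplus.
by apply/seteqP; split=> [[x r]|[x r]] /=; rewrite in_itv/= => // -[].
Qed.

Definition reach (x : 'rV[R]_n.+1) (b : R) : set markT :=
  [set p | enorm (p.1 - x) <= p.2 + b].

Lemma measurable_reach x b : measurable (reach x b).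
Proof.
apply: measurable_set_le.
  by apply: measurable_dist; [exact: measurable_fst|exact: measurable_cst].
by apply: measurable_funD => //; exact: measurable_snd.
Qed.

Lemma mu_reach x1 b1 x2 b2 : mu (reach x1 b1 `&` reach x2 b2) = overlap x1 b1 x2 b2.
Proof.
rewrite mu_swap; last by apply: measurableI; exact: measurable_reach.
apply: eq_integral => s _; congr (lebn _).
by apply/seteqP; split=> x; rewrite /ysection/= inE.
Qed.

Let measurable_rad_lt0 : measurable [set p : markT | p.2 < 0].
Proof.
rewrite (_ : [set _ | _] = ~` [set p : markT | 0 <= p.2]).
  by apply: measurableC; apply: measurable_set_le => //; exact: measurable_snd.
by apply/seteqP; split=> p /=; rewrite real_ltNge ?num_real => // /negP.
Qed.

Lemma mu_eq_rad_ge0 (X Y : set markT) : measurable X -> measurable Y ->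
  (forall p : markT, 0 <= p.2 -> X p <-> Y p) -> mu X = mu Y.
Proof.
move=> mX mY XY; pose N := [set p : markT | p.2 < 0].
have cut Z : measurable Z -> mu Z = mu (Z `\` N).
  move=> mZ; rewrite (measureDI mu mZ measurable_rad_lt0).
  rewrite [X in (_ + X)%E](_ : _ = 0%E) ?adde0//.
  apply/eqP; rewrite eq_le measure_ge0 andbT -mu_radius_lt0.
  apply: le_measure; rewrite ?inE; [exact: measurableI|exact: measurable_rad_lt0|].
  by move=> p [].
rewrite (cut X)// (cut Y)//; congr (mu _).
have rad p : ~ N p -> 0 <= p.2 by move/negP; rewrite -leNgt.
by apply/seteqP; split=> p [Zp Np]; split=> //; apply/(XY p (rad p Np)).
Qed.

Lemma blocks_reach g (p : markT) : 0 <= radius g -> weight g <= 1 -> 0 <= p.2 ->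
  blocks g (mark1 p) <-> reach (center g) (radius g) p.
Proof.
move=> r0 w1 p0; split=> [[_ _ h _]|h].
  have : enorm (p.1 - center g) <= p.2 + radius g by rewrite enormB (addrC p.2).
  by [].
have h' : enorm (p.1 - center g) <= p.2 + radius g by [].
by split=> //; rewrite enormB (addrC (radius g)).
Qed.

End grain_measure.

(** * Intensity of blocking sets *)

Section retention_probabilities.
Context {R : realType} {n : nat}.
Local Notation lebn := (lebesgue_rV R n.+1).
Local Notation graind := (grain R n.+1).
Local Notation markT := ('rV[R]_n.+1 * measurableTypeR R)%type.
Variables (F : probability (measurableTypeR R) R) (alpha lam : R).
Hypothesis F_Rplus : F `]-oo, 0[%classic = 0%E.
Hypothesis F_power_law : power_law F alpha.
Hypothesis alpha_gt : n.+1%:R < alpha.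
Hypothesis lam_gt0 : 0 < lam.

Local Notation overlap := (@overlap R n F).
Local Notation disc_mass := (@disc_mass R n F).
Local Notation retain := (@retain R n F lam).
Local Notation retain2 := (@retain2 R n F lam).
Local Notation mu := (@mark_law R n F).
Local Notation Lam := (@grain_intensity R n F lam lam_gt0).

Lemma measurable_rV_set1 (x : 'rV[R]_n.+1) : measurable [set x].
Proof.
rewrite (_ : [set x] = cball x 0); first exact: measurable_cball.
apply/seteqP; split=> [y ->|y]; rewrite /cball/= ?subrr ?enorm0// => h.
by apply/subr0_eq/enorm_eq0/eqP; rewrite eq_le h enorm_ge0.
Qed.

Lemma measurable_grain_set1 (g : graind) : measurable [set g].
Proof.
case: g => -[x r] w.
rewrite (_ : [set _] = ([set x] `*` [set r]) `*` [set w]).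
  by apply: measurableX => //; apply: measurableX => //; exact: measurable_rV_set1.
by apply/seteqP; split=> [_ -> //|[[x' r'] w'] /= [[-> ->] ->]].
Qed.

Lemma measurable_blocks (g : graind) : measurable (blocks g).
Proof. exact: (measurable_blocking (@measurable_cell R n) (@blocks_closed R n)). Qed.

Lemma mu_disc x b : mu (reach x b) = disc_mass b.
Proof.
rewrite -[X in mu X]setIid -[LHS]/(mu (reach x b `&` reach x b)).
by rewrite (mu_reach F x b x b) overlap_self.
Qed.

Let blocks_mark (g : graind) (p : markT) := @blocks_reach R n g p.

Let measurable_blocks_mark (g : graind) : measurable (mark1 @^-1` blocks g).
Proof. by apply: measurable_mark1_preim; exact: measurable_blocks. Qed.

Lemma Lam_blocksI (g1 g2 : graind) : 0 <= radius g1 -> weight g1 <= 1 ->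
  0 <= radius g2 -> weight g2 <= 1 ->
  Lam (blocks g1 `&` blocks g2) =
  (lam%:E * overlap (center g1) (radius g1) (center g2) (radius g2))%E.
Proof.
move=> r1 w1 r2 w2; rewrite LamE -mu_reach; congr (_ * _)%E.
apply: (mu_eq_rad_ge0 F_Rplus).
- by apply: measurableI; exact: measurable_blocks_mark.
- by apply: measurableI; exact: measurable_reach.
move=> p p0; split=> -[h1 h2]; split.
- exact/(blocks_mark r1 w1 p0).
- exact/(blocks_mark r2 w2 p0).
- exact/(blocks_mark r1 w1 p0).
- exact/(blocks_mark r2 w2 p0).
Qed.

Lemma Lam_blocks (g : graind) : 0 <= radius g -> weight g <= 1 ->
  Lam (blocks g) = (lam%:E * disc_mass (radius g))%E.
Proof.
move=> r0 w1; rewrite -(overlap_self F (center g)) -Lam_blocksI//.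
by rewrite setIid.
Qed.

Let lamM_lty (x : \bar R) : (0 <= x)%E -> (x < +oo)%E -> (lam%:E * x < +oo)%E.
Proof. by move=> x0 xoo; apply: lte_mul_pinfty; rewrite ?lee_fin ?ltW. Qed.

Let disc_lty r : (disc_mass r < +oo)%E.
Proof. exact: (disc_mass_lty F_Rplus F_power_law alpha_gt). Qed.

Lemma Lam_blocks_lty (g : graind) : 0 <= radius g -> weight g <= 1 ->
  (Lam (blocks g) < +oo)%E.
Proof. by move=> r0 w1; rewrite Lam_blocks//; apply: lamM_lty => //; exact: disc_mass_ge0. Qed.

Lemma void_blocks (g : graind) : 0 <= radius g -> weight g <= 1 ->
  expR (- fine (Lam (blocks g))) = retain (radius g).
Proof. by move=> r0 w1; rewrite Lam_blocks// fineZl. Qed.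

Lemma void_blocksU (g1 g2 : graind) : 0 <= radius g1 -> weight g1 <= 1 ->
  0 <= radius g2 -> weight g2 <= 1 ->
  expR (- fine (Lam (blocks g1 `|` blocks g2))) =
  retain (radius g1) * retain (radius g2) *
  expR (lam * fine (overlap (center g1) (radius g1) (center g2) (radius g2))).
Proof.
move=> r1 w1 r2 w2.
have m1 := measurable_blocks g1; have m2 := measurable_blocks g2.
have f1 := Lam_blocks_lty r1 w1; have f2 := Lam_blocks_lty r2 w2.
have fI : (Lam (blocks g1 `&` blocks g2) < +oo)%E.
  by apply: le_lt_trans f2; apply: le_measure; rewrite ?inE//; exact: measurableI.
have fin A : (Lam A < +oo)%E -> Lam A \is a fin_num by move=> h; rewrite ge0_fin_numE.
have -> : fine (Lam (blocks g1 `|` blocks g2)) =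
    fine (Lam (blocks g1)) + fine (Lam (blocks g2)) - fine (Lam (blocks g1 `&` blocks g2)).
  by rewrite measureUfinr// fineB ?fineD ?fin_numD ?fin.
rewrite -(void_blocks r1 w1) -(void_blocks r2 w2) -!expRD; congr expR.
rewrite Lam_blocksI// (fineZl (overlap (center g1) (radius g1) (center g2) (radius g2)) lam_gt0).
ring.
Qed.

(** Cells are bounded, so all grains of a neighbourhood reach one and the same
    ball. *)
Lemma Lam_nbhood_lty N k : (Lam (nbhood (@cell R n) (@blocks R n) N k) < +oo)%E.
Proof.
set A := nbhood _ _ _ _.
have mA : measurable A by exact: (measurable_nbhood (@measurable_cell R n)).
case: (pselect (exists g0 : graind, cell N g0 = k)) => [[g0 g0k]|no]; last first.
  rewrite (_ : A = set0) ?measure0// -subset0 => y [a [b [ak _ _]]].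
  by apply: no; exists a.
pose C : R := radius g0 + (2 * n.+1%:R + 2) / N.+1%:R.
rewrite LamE; apply: (@le_lt_trans _ _ (lam%:E * disc_mass C)%E); last first.
  by apply: lamM_lty => //; exact: disc_mass_ge0.
apply: lee_wpmul2l; first by rewrite lee_fin ltW.
rewrite -(mu_disc (center g0)); apply: le_measure; rewrite ?inE.
- exact: measurable_mark1_preim.
- exact: measurable_reach.
move=> p [a [b [ak bp [_ _ hh _]]]].
have [c1 r1 _] := cell_close (etrans ak (esym g0k)).
have [c2 r2 _] := cell_close bp.
rewrite -[center (mark1 p)]/(p.1) in c2; rewrite -[radius (mark1 p)]/(p.2) in r2.
have t1 := enorm_triangle (center b) p.1 (center g0).
have t2 := enorm_triangle (center a) (center b) (center g0).
rewrite enormB in c2; rewrite enormB in hh.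
suff : enorm (p.1 - center g0) <= p.2 + C by [].
rewrite /C (_ : (2 * n.+1%:R + 2) / N.+1%:R = n.+1%:R / N.+1%:R + n.+1%:R / N.+1%:R
      + N.+1%:R^-1 + N.+1%:R^-1 :> R); last by ring.
move: r1 r2; rewrite !ler_norml => /andP[_ r1] /andP[_ r2].
move: (n.+1%:R / N.+1%:R : R) (N.+1%:R^-1 : R) c1 c2 r1 r2 => e e' c1 c2 r1 r2; lra.
Qed.

Lemma Lam_set1 (g : graind) : Lam [set g] = 0%E.
Proof.
rewrite LamE [X in (_ * X)%E](_ : _ = 0%E) ?mule0//.
apply/eqP; rewrite eq_le measure_ge0 andbT.
have <- : mu ([set center g] `*` setT) = 0%E.
  rewrite /mark_law product_measure1E//; last exact: measurable_rV_set1.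
  by rewrite [X in (X * _)%E](_ : _ = 0%E) ?mul0e//; exact: lebesgue_set1.
apply: le_measure; rewrite ?inE.
- by apply: measurable_mark1_preim; exact: measurable_grain_set1.
- by apply: measurableX => //; exact: measurable_rV_set1.
by move=> p /= <-.
Qed.

Lemma Lam_setD1 (A : set graind) (g : graind) : measurable A -> Lam (A `\ g) = Lam A.
Proof.
move=> mA; have m1 := measurable_grain_set1 g.
rewrite [RHS](measureDI Lam mA m1) [X in _ = (_ + X)%E](_ : _ = 0%E) ?adde0//.
apply/eqP; rewrite eq_le measure_ge0 andbT -(Lam_set1 g).
by apply: le_measure; rewrite ?inE//; exact: measurableI.
Qed.

End retention_probabilities.

(** * Retention probabilities of the grain model *)

Section poisson_grains.
Context {R : realType} {n : nat}.
Local Notation graind := (grain R n.+1).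
Variables (F : probability (measurableTypeR R) R) (alpha lam : R).
Variable G : R.-pker (measurableTypeR R) ~> (measurableTypeR R).
Context {disp : measure_display} {Omega : measurableType disp}.
Variables (P : probability Omega R) (Phi : Omega -> set graind).
Hypothesis F_Rplus : F `]-oo, 0[%classic = 0%E.
Hypothesis F_power_law : power_law F alpha.
Hypothesis alpha_gt : n.+1%:R < alpha.
Hypothesis lam_gt0 : 0 < lam.
Hypothesis G_dirac1 : forall (r : R) (A : set (measurableTypeR R)),
  measurable A -> G r A = \d_(1 : measurableTypeR R) A.
Hypothesis Phi_poisson : poisson_grain_model lam F G P Phi.

Local Notation retain := (@retain R n F lam).
Local Notation retain2 := (@retain2 R n F lam).
Local Notation mu := (@mark_law R n F).
Local Notation Lam := (@grain_intensity R n F lam lam_gt0).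

Lemma grain_poisson : poisson_random_measure P Phi Lam.
Proof.
case: Phi_poisson => _ [mc Pc indep]; split=> // B mB.
by rewrite -(intensityE F lam_gt0 G_dirac1 mB) => /(Pc B mB).
Qed.

Lemma kernel_dirac_Rintegral (f : R -> R) r : \int[G r]_w f w = f 1.
Proof.
have m1 : measurable [set (1 : measurableTypeR R)] by [].
have G0 : G r (~` [set (1 : measurableTypeR R)]) = 0%E.
  by rewrite G_dirac1; [rewrite diracE memNset//; exact|exact: measurableC].
rewrite (null_complement_Rintegral _ m1 G0).
transitivity (\int[G r]_(w in [set (1 : measurableTypeR R)]) f 1).
  by apply: eq_Rintegral => w; rewrite inE => ->.
rewrite Rintegral_cst// [X in _ * fine X](_ : _ = 1%E) ?mulr1//.
by rewrite G_dirac1// diracE mem_set.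
Qed.

Lemma thinning_add1 phi (g : graind) :
  thinning (phi `|` [set g]) g <-> phi `&` (blocks g `\ g) = set0.
Proof.
split=> [[_ h]|h].
  rewrite -subset0 => g' [pg [/blocksP[meet +] ne]].
  by rewrite h//; left.
split; first by right.
move=> g' [pg|->] ne meet; last by [].
apply: contrapT => w; suff : set0 g' by []; rewrite -h; split => //; split => //.
by apply/blocksP; split => //; exact/negP.
Qed.

Lemma thinning_add2 phi (g1 g2 : graind) :
  [/\ g1 <> g2, thinning (phi `|` [set g1; g2]) g1 & thinning (phi `|` [set g1; g2]) g2] <->
  [/\ g1 <> g2, ~ blocks g1 g2, ~ blocks g2 g1 &
    phi `&` ((blocks g1 `|` blocks g2) `\ g1 `\ g2) = set0].
Proof.
split=> [[ne [_ h1] [_ h2]]|[ne n12 n21 h]].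
  split=> //.
  - by move=> /blocksP[meet]; rewrite h1//; [right; right|exact: nesym].
  - by move=> /blocksP[meet]; rewrite h2//; right; left.
  rewrite -subset0 => g' [pg [[[b|b] ne1] ne2]]; move: b => /blocksP[meet].
    by rewrite h1//; left.
  by rewrite h2//; left.
have key g' : blocks g1 g' \/ blocks g2 g' -> phi g' -> g' <> g1 -> g' <> g2 -> False.
  by move=> b pg ne1 ne2; suff : set0 g' by []; rewrite -h.
split=> //; split; [by right; left| |by right; right|].
  move=> g' mem ne1 meet; apply: contrapT => /negP w.
  have b : blocks g1 g' by apply/blocksP.
  have ne2 : g' <> g2 by move=> e; apply: n12; rewrite -e.
  case: mem => [pg|[e|e]]; [exact: (key g' (or_introl b))|exact: (ne1 e)|exact: (ne2 e)].
move=> g' mem ne2 meet; apply: contrapT => /negP w.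
have b : blocks g2 g' by apply/blocksP.
have ne1 : g' <> g1 by move=> e; apply: n21; rewrite -e.
case: mem => [pg|[e|e]]; [exact: (key g' (or_intror b))|exact: (ne1 e)|exact: (ne2 e)].
Qed.

Let count0 (w : Omega) (B : set graind) : (Phi w `&` B = set0) = (count_in Phi B w = 0%E :> \bar R).
Proof. by apply/propext; rewrite /count_in; apply: iff_sym; exact: counting_eq0. Qed.

(** The added grain is retained iff its blocking set is empty, up to the grain
    itself, which is not charged by the intensity. *)
Lemma h_retain r : 0 <= r -> h G P Phi r = retain r.
Proof.
move=> r0; rewrite /h (kernel_dirac_Rintegral (h_rw P Phi r)) /h_rw.
set g : graind := (0, r, 1).
have mB : measurable (blocks g `\ g).
  by apply: measurableD; [exact: measurable_blocks|exact: measurable_grain_set1].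
have LB : Lam (blocks g `\ g) = Lam (blocks g) by apply: Lam_setD1; exact: measurable_blocks.
rewrite (_ : [set _ | _] = [set w | count_in Phi (blocks g `\ g) w = 0%E :> \bar R]); last first.
  by apply/funext => w; rewrite /= -count0; apply/propext; exact: thinning_add1.
rewrite (poisson_void grain_poisson mB) LB; last first.
  exact: (Lam_blocks_lty F_Rplus F_power_law alpha_gt).
exact: (@void_blocks _ _ _ _ F_Rplus lam_gt0 g).
Qed.

Lemma blocks_far (g1 g2 : graind) : 0 <= radius g1 -> 0 <= radius g2 ->
  weight g1 = weight g2 ->
  ~ blocks g1 g2 <-> radius g1 + radius g2 < enorm (center g1 - center g2).
Proof.
move=> r1 r2 w12; rewrite ltNge; split=> [h|/negP h [_ _ + _]]; last by [].
by apply/negP => h'; apply: h; split=> //; rewrite w12.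
Qed.

Lemma h2_retain u r1 r2 : 0 < u -> 0 <= r1 -> 0 <= r2 ->
  h2 G P Phi u r1 r2 = retain2 0 r1 (u *: e1 R n.+1) r2.
Proof.
move=> u0 r10 r20; rewrite /h2.
rewrite (kernel_dirac_Rintegral (fun w1 => \int[G r2]_w2 h2_rw P Phi u r1 w1 r2 w2)).
rewrite (kernel_dirac_Rintegral (fun w2 => h2_rw P Phi u r1 1 r2 w2)) /h2_rw.
set g1 : graind := (0, r1, 1); set g2 : graind := (u *: e1 R n.+1, r2, 1).
have ne : g1 <> g2.
  move=> e; have : enorm (center g1) = enorm (center g2) by rewrite e.
  rewrite /g1 /g2 /center/= enorm0 enormZ enorm_e1 mulr1 gtr0_norm// => u00.
  by move: u0; rewrite -u00 ltxx.
have m1 := measurable_blocks g1; have m2 := measurable_blocks g2.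
pose B := (blocks g1 `|` blocks g2) `\ g1 `\ g2.
have mU : measurable (blocks g1 `|` blocks g2) by exact: measurableU.
have mB : measurable B by do 2! (apply: measurableD; last exact: measurable_grain_set1).
have LB : Lam B = Lam (blocks g1 `|` blocks g2).
  by rewrite /B !Lam_setD1//; apply: measurableD => //; exact: measurable_grain_set1.
have LU : (Lam (blocks g1 `|` blocks g2) < +oo)%E.
  apply: le_lt_trans (measureU2 _ m1 m2) _; apply: lte_add_pinfty;
  exact: (Lam_blocks_lty F_Rplus F_power_law alpha_gt).
have far12 := blocks_far (g1 := g1) (g2 := g2) r10 r20 erefl.
have far21 := blocks_far (g1 := g2) (g2 := g1) r20 r10 erefl.
rewrite /retain2; case: ifPn => far.
  rewrite (_ : [set _ | _] = [set w | count_in Phi B w = 0%E :> \bar R]); last first.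
    apply/funext => w; rewrite /= -count0; apply/propext; rewrite thinning_add2.
    split=> [[]//|h]; split=> //; first exact/far12.
    by apply/far21; rewrite enormB [radius g2 + _]addrC.
  rewrite (poisson_void grain_poisson mB) LB//.
  exact: (@void_blocksU _ _ _ _ _ F_Rplus F_power_law alpha_gt lam_gt0 g1 g2).
rewrite (_ : [set _ | _] = set0) ?measure0//.
rewrite -subset0 => w /=; rewrite thinning_add2 => -[_ /far12 n12 _ _].
by move: far; rewrite n12.
Qed.

End poisson_grains.

(** * Radius distribution and two-point correlation *)

Lemma Rintegral_gt0 {R : realType} {d : measure_display} {T : measurableType d}
    (kappa : {sigma_finite_measure set T -> \bar R}) (D : set T) (f : T -> R) (C : R) :
  measurable D -> (0 < kappa D)%E -> (kappa D < +oo)%E -> measurable_fun D f ->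
  (forall t, D t -> 0 < f t) -> (forall t, D t -> f t <= C) ->
  0 < \int[kappa]_(t in D) f t.
Proof.
move=> mD D0 Doo mf f0 fC.
have fi : kappa.-integrable D (EFin \o f).
  by apply: (bounded_integrable mD Doo mf (C := C)) => t Dt; rewrite gtr0_norm ?f0 ?fC.
rewrite lt_neqAle Rintegral_ge0 ?andbT; last by move=> t Dt; exact/ltW/f0.
apply/eqP => I0; have mf' : measurable_fun D (EFin \o f) by exact/measurable_EFinP.
have /(ae_eq_integral_abs kappa mD mf') : (\int[kappa]_(t in D) `|(EFin \o f) t| = 0)%E.
  transitivity (\int[kappa]_(t in D) (f t)%:E)%E.
    by apply: eq_integral => t; rewrite inE => Dt /=; rewrite gtr0_norm ?f0.
  by rewrite -[LHS]fineK ?integrable_fin_num//; congr EFin; exact: esym I0.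
move=> [N [mN N0 DN]]; move: D0; rewrite ltNge -N0 => /negP; apply.
apply: le_measure; rewrite ?inE// => t Dt; apply: DN => /= /(_ Dt) [ft0].
by move: (f0 t Dt); rewrite ft0 ltxx.
Qed.

Section thinned_statistics.
Context {R : realType} {n : nat}.
Local Notation graind := (grain R n.+1).
Variables (F : probability (measurableTypeR R) R) (alpha lam : R).
Variable G : R.-pker (measurableTypeR R) ~> (measurableTypeR R).
Context {disp : measure_display} {Omega : measurableType disp}.
Variables (P : probability Omega R) (Phi : Omega -> set graind).
Hypothesis F_Rplus : F `]-oo, 0[%classic = 0%E.
Hypothesis F_power_law : power_law F alpha.
Hypothesis alpha_gt : n.+1%:R < alpha.
Hypothesis lam_gt0 : 0 < lam.
Hypothesis G_dirac1 : forall (r : R) (A : set (measurableTypeR R)),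
  measurable A -> G r A = \d_(1 : measurableTypeR R) A.
Hypothesis Phi_poisson : poisson_grain_model lam F G P Phi.

Local Notation retain := (@retain R n F lam).
Local Notation retain2 := (@retain2 R n F lam).
Local Notation excess := (@excess R n F lam).
Local Notation rho := (@rho R n F).

Let radii : set (measurableTypeR R) := `[0%R, +oo[%classic.

Let measurable_radii : measurable radii. Proof. exact: measurable_itv. Qed.

Let F_radiiC : F (~` radii) = 0%E.
Proof.
rewrite -F_Rplus; congr (F _); apply/seteqP; split=> x; rewrite /radii/= !in_itv/= andbT.
  by move=> /negP; rewrite -ltNge.
by rewrite ltNge => /negP.
Qed.

Let F_radii : F radii = 1%E. Proof. exact: F_itv0y. Qed.

Let radii_lty : (F radii < +oo)%E. Proof. by rewrite F_radii ltry. Qed.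

Let mretain : measurable_fun [set: measurableTypeR R] retain.
Proof. by apply: measurable_retain; exact: measurable_id. Qed.

Let J : R := \int[F]_(r in radii) retain r.

Let J_gt0 : 0 < J.
Proof.
have F0 : (0 < F radii)%E by rewrite F_radii.
apply: (@Rintegral_gt0 _ _ _ F radii retain 1) => //.
- exact: measurable_funTS.
- by move=> r _; exact: retain_gt0.
- by move=> r _; exact: retain_le1.
Qed.

Lemma lam_thE : lam_th lam F G P Phi = lam * J.
Proof.
rewrite /lam_th (null_complement_Rintegral _ measurable_radii F_radiiC); congr (_ * _).
apply: eq_Rintegral => r; rewrite inE /radii/= in_itv/= andbT => r0.
exact: (h_retain F_Rplus F_power_law alpha_gt lam_gt0 G_dirac1 Phi_poisson).
Qed.

Lemma tail_th_le r : 0 <= r -> tail_th lam F G P Phi r <=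
  lam / lam_th lam F G P Phi * expR (- (lam * vol (cball (0 : 'rV[R]_n.+1) 1) * r ^+ n.+1)).
Proof.
move=> r0; rewrite /tail_th /F_th opprB addrC subrK.
apply: ler_wpM2l; first by rewrite lam_thE divr_ge0 ?mulr_ge0 ?(ltW lam_gt0) ?(ltW J_gt0).
set e := expR _; pose D : set (measurableTypeR R) := `]r, +oo[%classic.
have mD : measurable D by exact: measurable_itv.
have FD1 : (F D <= 1)%E by exact: probability_le1.
have FD : (F D < +oo)%E by apply: le_lt_trans FD1 _; rewrite ltry.
have Dge s : D s -> r < s by rewrite /D/= in_itv/= andbT.
rewrite (_ : Rintegral _ _ _ = \int[F]_(s in D) retain s); last first.
  apply: eq_Rintegral => s; rewrite inE => /Dge rs.
  apply: (h_retain F_Rplus F_power_law alpha_gt lam_gt0 G_dirac1 Phi_poisson).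
  exact: le_trans r0 (ltW rs).
apply: le_trans (ler_norm _) _.
apply: (@le_trans _ _ (e * fine (F D))).
  apply: norm_Rintegral_le => //; first exact: measurable_funTS.
    exact: expR_ge0.
  move=> s /Dge rs; rewrite gtr0_norm ?retain_gt0//.
  have s0 : 0 <= s := le_trans r0 (ltW rs).
  apply: le_trans (retain_exp F_Rplus F_power_law alpha_gt lam_gt0 s0) _.
  rewrite ler_expR lerN2; apply: ler_wpM2l; last by rewrite lerXn2r ?nnegrE ?(ltW rs).
  by rewrite mulr_ge0 ?(ltW lam_gt0)//; apply/ltW; exact: v1_gt0.
rewrite -[leRHS]mulr1; apply: ler_wpM2l; first exact: expR_ge0.
by rewrite -lee_fin fineK// ge0_fin_numE.
Qed.

Variable ell : R -> R.
Hypothesis tailE : forall r, 0 < r -> tail F r = ell r * r `^ (- alpha).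

Lemma rho_ell u : 0 < u -> ell u * u `^ (- (alpha - n.+1%:R)) = rho u.
Proof.
move=> u0; rewrite /rho tailE// opprB powRD; last by apply/implyP => _; rewrite gt_eqF.
by rewrite powR_mulrn ?(ltW u0)// mulrCA.
Qed.

(** [rho] times a constant is the asserted asymptotics, by [rho_ell], and limits
    can be taken along sequences. *)
Lemma asymp_equiv_rho (f : 'rV[R]_n.+1 -> R) (c : R) : 0 < c ->
  (forall z : nat -> 'rV[R]_n.+1, enorm (z k) @[k --> \oo] --> +oo ->
     f (z k) / rho (enorm (z k)) @[k --> \oo] --> c) ->
  asymp_equiv f (fun z => c * ell (enorm z) * enorm z `^ (- (alpha - n.+1%:R))).
Proof.
move=> c0 H; apply: enorm_pinfty_seq => z zoo.
apply: (@near_cvg _ (fun k => f (z k) / rho (enorm (z k)) * c^-1)).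
  near=> k; have z0 : 0 < enorm (z k) by near: k; exact: (cvgry_gt zoo).
  by rewrite -[in RHS]mulrA rho_ell// [in RHS]invfM mulrA [RHS]mulrAC.
have lim : f (z k) / rho (enorm (z k)) * c^-1 @[k --> \oo] --> c * c^-1.
  by apply: cvgMr_tmp; exact: H.
by rewrite mulfV ?gt_eqF in lim.
Unshelve. all: by end_near. Qed.

(** The average of the excess over two radii, with both balls centered at the
    given points, that is, with all positions equal to 0 in [excess_average]. *)
Lemma xi_th_cvg (z : nat -> 'rV[R]_n.+1) : enorm (z k) @[k --> \oo] --> +oo ->
  xi_th lam F G P Phi (z k) / rho (enorm (z k)) @[k --> \oo] --> lam * c_ad alpha n.+1.
Proof.
move=> zoo; pose z' k : 'rV[R]_n.+1 := enorm (z k) *: e1 R n.+1.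
have z'E k : enorm (z' k) = enorm (z k).
  by rewrite /z' enormZ enorm_e1 mulr1 ger0_norm ?enorm_ge0.
have pr (t : measurableTypeR R) : radii t -> enorm (0 : 'rV[R]_n.+1) <= t.
  by rewrite enorm0 /radii/= in_itv/= andbT.
have m0 : measurable_fun [set: measurableTypeR R] (fun _ => 0 : 'rV[R]_n.+1).
  exact: measurable_cst.
have z'oo : enorm (z' k) @[k --> \oo] --> +oo by under eq_fun do rewrite z'E.
have mid : measurable_fun [set: measurableTypeR R] (fun r => r : R) by exact: measurable_id.
have lim : (\int[F]_(t1 in radii) \int[F]_(t2 in radii) excess 0 t1 (z' k + 0) t2)
    / rho (enorm (z' k)) @[k --> \oo] --> lam * c_ad alpha n.+1 * J ^+ 2.
  exact: (excess_average F_Rplus F_power_law alpha_gt lam_gt0 measurable_radii radii_lty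
    m0 mid pr z'oo).
have lim2 : (lam ^+ 2 / lam_th lam F G P Phi ^+ 2) *
    ((\int[F]_(t1 in radii) \int[F]_(t2 in radii) excess 0 t1 (z' k + 0) t2)
       / rho (enorm (z' k))) @[k --> \oo] --> lam * c_ad alpha n.+1.
  have -> : lam * c_ad alpha n.+1 =
      (lam ^+ 2 / lam_th lam F G P Phi ^+ 2) * (lam * c_ad alpha n.+1 * J ^+ 2).
    rewrite lam_thE; move: J J_gt0 (c_ad _ _) => j j0 c.
    by field; rewrite !gt_eqF.
  by apply: cvgMl_tmp; exact: lim.
apply: near_cvg lim2; near=> k.
have z0 : 0 < enorm (z k) by near: k; exact: (cvgry_gt zoo).
have regroup (a i j r : R) : i = j -> a * (i / r) = a * j / r by move=> ->; rewrite mulrA.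
rewrite /xi_th z'E; apply: regroup.
rewrite (null_complement_Rintegral _ measurable_radii F_radiiC).
apply: eq_Rintegral => r1; rewrite inE /radii/= in_itv/= andbT => r10.
rewrite (null_complement_Rintegral _ measurable_radii F_radiiC).
apply: eq_Rintegral => r2; rewrite inE /radii/= in_itv/= andbT => r20.
rewrite addr0 /q (h2_retain F_Rplus F_power_law alpha_gt lam_gt0 G_dirac1 Phi_poisson)//.
by rewrite !(h_retain F_Rplus F_power_law alpha_gt lam_gt0 G_dirac1 Phi_poisson).
Unshelve. all: by end_near. Qed.

End thinned_statistics.

(** * Covariance of the cover *)

Lemma EFin_Rintegral {R : realType} {d : measure_display} {T : measurableType d}
    (kappa : {measure set T -> \bar R}) (D : set T) (f : T -> R) : measurable D ->
  kappa.-integrable D (EFin \o f) ->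
  (\int[kappa]_(t in D) (f t)%:E)%E = (\int[kappa]_(t in D) f t)%:E.
Proof. by move=> mD fi; rewrite /Rintegral fineK//; exact: integrable_fin_num. Qed.

Lemma scaled_bound {R : realFieldType} (n : nat) (l C m e t u s : R) :
  0 <= l -> 0 <= C -> 0 <= m -> 1 <= u -> 0 < t ->
  s <= l * (e * m) -> e <= C * t -> s <= l * (C * m) * u^-1 * (u ^+ n.+1 * t).
Proof.
move=> l0 C0 m0 u1 t0 sl eC; have u0 : 0 < u by apply: lt_le_trans u1.
have -> : l * (C * m) * u^-1 * (u ^+ n.+1 * t) = l * (C * t * m) * u ^+ n.
  by rewrite exprS; field; rewrite gt_eqF.
apply: le_trans sl _; apply: (@le_trans _ _ (l * (C * t * m))).
  by apply: ler_wpM2l => //; apply: ler_wpM2r.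
by rewrite ler_peMr ?exprn_ege1// !mulr_ge0// ltW.
Qed.

Section mark_measure.
Context {R : realType} {n : nat}.
Local Notation lebn := (lebesgue_rV R n.+1).
Local Notation markT := ('rV[R]_n.+1 * measurableTypeR R)%type.
Variables (F : probability (measurableTypeR R) R) (alpha : R).
Hypothesis F_Rplus : F `]-oo, 0[%classic = 0%E.
Hypothesis F_power_law : power_law F alpha.
Hypothesis alpha_gt : n.+1%:R < alpha.

Local Notation mu := (@mark_law R n F).

Definition move_mark (a : 'rV[R]_n.+1) (p : markT) : markT := (p.1 + a, p.2).

Lemma measurable_move_mark a : measurable_fun setT (move_mark a).
Proof.
apply/measurable_fun_pairP; split; last exact: measurable_snd.
by apply: measurable_rVD; [exact: measurable_fst|exact: measurable_cst].
Qed.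

Lemma mu_move a X : measurable X -> mu (move_mark a @^-1` X) = mu X.
Proof.
move=> mX; have mX' := measurable_preim (measurable_move_mark a) mX.
rewrite (mu_swap F mX') (mu_swap F mX); apply: eq_integral => s _.
rewrite -(lebesgue_rV_shift a (measurable_ysection s mX)); congr (lebn _).
Qed.

Lemma integral_mu_move a (X : set markT) (f : markT -> \bar R) : measurable X ->
  measurable_fun setT f -> (forall p, 0 <= f p)%E ->
  (\int[mu]_(p in X) f p =
   \int[mu]_(p in move_mark a @^-1` X) f (move_mark a p))%E.
Proof.
move=> mX mf f0.
transitivity (\int[image_measure mu (measurable_move_mark a)]_(p in X) f p)%E.
  apply: (eq_measure_integral (image_measure mu (measurable_move_mark a))) => A mA _.
  exact: esym (mu_move a mA).
rewrite (ge0_integral_pushforward (measurable_move_mark a))//.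
exact: measurable_funTS.
Qed.

Definition covers (y : 'rV[R]_n.+1) : set markT := [set p | enorm (y - p.1) <= p.2].

Lemma measurable_covers y : measurable (covers y).
Proof.
apply: measurable_set_le; last exact: measurable_snd.
by apply: measurable_dist; [exact: measurable_cst|exact: measurable_fst].
Qed.

Lemma covers_move z : move_mark z @^-1` (covers z) = covers 0.
Proof.
apply/seteqP; split=> p; rewrite /covers/=;
by rewrite (_ : z - (p.1 + z) = 0 - p.1) // opprD addrCA subrr addr0 sub0r.
Qed.

Lemma covers_rad y p : covers y p -> 0 <= p.2.
Proof. exact: le_trans (enorm_ge0 _). Qed.

Lemma mu_covers : mu (covers 0) = @disc_mass R n F 0.
Proof.
rewrite -(mu_disc F 0); congr (mu _); apply/seteqP; split=> p; rewrite /covers/reach/= addr0 => h.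
  by rewrite enormB.
by rewrite enormB.
Qed.

Lemma mu_covers_lty : (mu (covers 0) < +oo)%E.
Proof. by rewrite mu_covers; exact: (disc_mass_lty F_Rplus F_power_law alpha_gt). Qed.

Lemma mu_covers_gt0 : (0 < mu (covers 0))%E.
Proof.
have [t t0 ht] := tail_gt0_near F_power_law.
apply: (@lt_le_trans _ _ (lebn (cball 0 t) * F `]t, +oo[%classic)%E).
  rewrite -tail_itv//; [|exact: ltW]; apply: mule_gt0; first exact: lebesgue_cball_gt0.
  by rewrite lte_fin; apply: ht.
have <- : mu (cball 0 t `*` `]t, +oo[%classic) = (lebn (cball 0 t) * F `]t, +oo[%classic)%E.
  by rewrite /mark_law product_measure1E//; exact: measurable_cball.
apply: le_measure; rewrite ?inE.
- by apply: measurableX => //; exact: measurable_cball.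
- exact: measurable_covers.
move=> [x r] /= [xt]; rewrite in_itv/= andbT => tr.
by rewrite /covers/= enormB; exact: le_trans xt (ltW tr).
Qed.

End mark_measure.

Section covariance.
Context {R : realType} {n : nat}.
Local Notation graind := (grain R n.+1).
Local Notation markT := ('rV[R]_n.+1 * measurableTypeR R)%type.
Variables (F : probability (measurableTypeR R) R) (alpha lam : R).
Variable G : R.-pker (measurableTypeR R) ~> (measurableTypeR R).
Context {disp : measure_display} {Omega : measurableType disp}.
Variables (P : probability Omega R) (Phi : Omega -> set graind).
Hypothesis F_Rplus : F `]-oo, 0[%classic = 0%E.
Hypothesis F_power_law : power_law F alpha.
Hypothesis alpha_gt : n.+1%:R < alpha.
Hypothesis lam_gt0 : 0 < lam.
Hypothesis G_dirac1 : forall (r : R) (A : set (measurableTypeR R)),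
  measurable A -> G r A = \d_(1 : measurableTypeR R) A.
Hypothesis Phi_poisson : poisson_grain_model lam F G P Phi.

Local Notation retain := (@retain R n F lam).
Local Notation retain2 := (@retain2 R n F lam).
Local Notation excess := (@excess R n F lam).
Local Notation rho := (@rho R n F).
Local Notation mu := (@mark_law R n F).
Local Notation Lam := (@grain_intensity R n F lam lam_gt0).
Local Notation D := (@covers R n 0).

Let mD : measurable D. Proof. exact: measurable_covers. Qed.
Let D_lty : (mu D < +oo)%E. Proof. exact: (mu_covers_lty F_Rplus F_power_law alpha_gt). Qed.

Let window_fin w m : finite_set (Phi w `&` @window R n m).
Proof. by case: Phi_poisson => + _ => /(_ w) [_]; exact. Qed.

Let poisson := grain_poisson lam_gt0 G_dirac1 Phi_poisson.

Let nbhood_lty N k : (Lam (nbhood (@cell R n) (@blocks R n) N k) < +oo)%E.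
Proof. exact: (Lam_nbhood_lty F_Rplus F_power_law alpha_gt). Qed.

Let iso := isolated_in Phi (@blocks R n).

Let iso_prob B := @P_isolated_in _ _ _ _ _ P Phi Lam poisson (@window R n)
  (@measurable_window R n) (@window_nd R n) (@window_cover R n) window_fin
  (@cell R n) (@measurable_cell R n) (@cell_nested R n) (@blocks R n)
  (@blocks_closed R n) nbhood_lty B.

Let iso_pair B1 B2 := @P_isolated_pair _ _ _ _ _ P Phi Lam poisson (@window R n)
  (@measurable_window R n) (@window_nd R n) (@window_cover R n) window_fin
  (@cell R n) (@measurable_cell R n) (@cell_nested R n) (@blocks R n)
  (@blocks_closed R n) nbhood_lty B1 B2.

Let iso_measurable B := @measurable_isolated_in _ _ _ _ _ P Phi Lam poisson (@window R n)
  (@measurable_window R n) (@window_nd R n) (@window_cover R n) window_fin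
  (@cell R n) (@measurable_cell R n) (@cell_nested R n) (@blocks R n)
  (@blocks_closed R n) B.

Lemma X_thE y w : X_th Phi w y <-> iso (covering y) w.
Proof.
split=> [[g [pg h] gy]|[g [gy [pg h]]]].
  exists g; split=> //; split=> // g' pg' /blocksP[meet]; apply: contraNP => ne.
  exact: h.
exists g => //; split=> // g' pg' ne meet; apply: contrapT => /negP w'.
by apply: ne; apply: h => //; apply/blocksP.
Qed.

Let mretain : measurable_fun [set: markT] (fun p => retain p.2).
Proof. by apply: measurable_retain; exact: measurable_snd. Qed.

(** Grains that cover the same point form a clique. *)
Lemma P_isolated_covering y (B : set graind) : measurable B -> B `<=` covering y ->
  P (iso B) = (lam%:E * \int[mu]_(p in mark1 @^-1` B) (retain p.2)%:E)%E.
Proof.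
move=> mB By; rewrite iso_prob//; first last.
- by move=> g h Bg Bh; apply: (covering_clique (By _ Bg) (By _ Bh)).
- by move=> g Bg; exact: (covering_refl (By _ Bg)).
apply: integral_Lam => //; last by move=> p; rewrite lee_fin ltW// retain_gt0.
  move=> p /By By'; congr EFin; apply: (void_blocks F_Rplus) => //.
  exact: le_trans (enorm_ge0 _) By'.
by apply/measurable_EFinP; exact: mretain.
Qed.

Let J : R := \int[mu]_(p in D) retain p.2.

Let retain_integrable : mu.-integrable D (EFin \o (fun p => retain p.2)).
Proof.
apply: (bounded_integrable mD D_lty (C := 1)); first exact: measurable_funTS.
by move=> p _; rewrite gtr0_norm ?retain_gt0// retain_le1.
Qed.

Lemma P_X_th y : P [set w | X_th Phi w y] = (lam * J)%:E.
Proof.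
rewrite (_ : [set _ | _] = iso (covering y)); last first.
  by apply/funext => w; apply/propext; exact: X_thE.
rewrite (P_isolated_covering (y := y))//; last exact: measurable_covering.
rewrite (@integral_mu_move R n F y (covers y)); first last.
- by move=> p; rewrite lee_fin ltW// retain_gt0.
- by apply/measurable_EFinP; exact: mretain.
- exact: measurable_covers.
by rewrite covers_move EFinM -(EFin_Rintegral mD retain_integrable).
Qed.

Let J_gt0 : 0 < J.
Proof.
apply: (@Rintegral_gt0 _ _ _ mu D (fun p => retain p.2) 1) => //.
- exact: (mu_covers_gt0 F_Rplus F_power_law).
- exact: measurable_funTS.
- by move=> p _; exact: retain_gt0.
- by move=> p _; exact: retain_le1.
Qed.

Lemma p_thE : p_th P Phi = lam * J.
Proof. by rewrite /p_th P_X_th. Qed.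

Lemma p_th_gt0 : 0 < p_th P Phi.
Proof. by rewrite p_thE mulr_gt0. Qed.

Let pair z (p1 p2 : markT) : R := retain2 p1.1 p1.2 (z + p2.1) p2.2.

Let pairs z (p1 : markT) : R := \int[mu]_(p2 in D) pair z p1 p2.

Let measurable_pair z : measurable_fun setT (fun pp : markT * markT => pair z pp.1 pp.2).
Proof.
apply: measurable_retain2.
- exact: (measurableT_comp measurable_fst measurable_fst).
- exact: (measurableT_comp measurable_snd measurable_fst).
- apply: measurable_rVD; first exact: measurable_cst.
  exact: (measurableT_comp measurable_fst measurable_snd).
- exact: (measurableT_comp measurable_snd measurable_snd).
Qed.

Let measurable_pair2 z p1 : measurable_fun setT (pair z p1).
Proof. exact: (measurableT_comp (measurable_pair z) (pair1_measurable p1)). Qed.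

Let pair_ge0 z p1 p2 : 0 <= pair z p1 p2. Proof. exact: retain2_ge0. Qed.

Let pair_le1 z p1 p2 : pair z p1 p2 <= 1.
Proof.
have [h _] := retain2_le F_Rplus F_power_law alpha_gt lam_gt0 p1.1 p1.2 (z + p2.1) p2.2.
by apply: le_trans h _; exact: retain_le1.
Qed.

Let pair_integrable z p1 : mu.-integrable D (EFin \o pair z p1).
Proof.
apply: (bounded_integrable mD D_lty (C := 1)); first exact: measurable_funTS.
by move=> p2 _; rewrite ger0_norm.
Qed.

Let measurable_pairs z : measurable_fun setT (pairs z).
Proof.
apply: (measurableT_comp (@fine_measurable R setT measurableT)).
apply: (@measurable_integral_snd _ _ _ mu D mD _ _
  (fun pp : markT * markT => (pair z pp.1 pp.2)%:E)).
by apply/measurable_EFinP; exact: measurable_pair.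
Qed.

Let pairs_ge0 z p1 : 0 <= pairs z p1.
Proof. by apply: Rintegral_ge0 => p2 _; exact: pair_ge0. Qed.

Let pairs_integrable z : mu.-integrable D (EFin \o pairs z).
Proof.
apply: (bounded_integrable mD D_lty (C := 1 * fine (mu D))); first exact: measurable_funTS.
move=> p1 _; apply: norm_Rintegral_le => //; first exact: measurable_funTS.
by move=> p2 _; rewrite ger0_norm.
Qed.

Let pairs_move z p1 :
  (\int[mu]_(p2 in covers z) (retain2 p1.1 p1.2 p2.1 p2.2)%:E = (pairs z p1)%:E)%E.
Proof.
have mf : measurable_fun setT (fun p2 : markT => (retain2 p1.1 p1.2 p2.1 p2.2)%:E).
  apply/measurable_EFinP; apply: measurable_retain2;
  by [exact: measurable_cst|exact: measurable_fst|exact: measurable_snd].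
have f0 (p2 : markT) : (0 <= (retain2 p1.1 p1.2 p2.1 p2.2)%:E)%E.
  by rewrite lee_fin retain2_ge0.
rewrite (integral_mu_move F z (measurable_covers z) mf f0) covers_move.
rewrite -(EFin_Rintegral mD (pair_integrable z p1)).
by apply: eq_integral => p2 _; rewrite /pair (addrC z).
Qed.

(** Moving the second mark by [z] brings both marks into the balls that cover the
    origin. *)
Lemma P_isolated_two z :
  P ((iso (covering 0) `&` iso (covering z)) `\` iso (covering 0 `&` covering z)) =
  (lam ^+ 2 * \int[mu]_(p1 in D) pairs z p1)%:E.
Proof.
have rad (y : 'rV[R]_n.+1) (g : graind) : covering y g -> 0 <= radius g by exact: le_trans (enorm_ge0 _).
rewrite iso_pair; [|exact: measurable_covering|exact: measurable_covering
  |by move=> g; exact: covering_refl|by move=> g; exact: covering_refl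
  |exact: covering_clique|exact: covering_clique].
rewrite (@integral_Lam R n F lam lam_gt0 _ _ (fun p => (lam * pairs z p)%:E)); first last.
- by move=> p; rewrite lee_fin mulr_ge0 ?(ltW lam_gt0).
- by apply/measurable_EFinP; apply: measurable_funM => //; exact: measurable_pairs.
- move=> p1 c1.
  rewrite (@integral_Lam R n F lam lam_gt0 _ _
    (fun p2 => (retain2 p1.1 p1.2 p2.1 p2.2)%:E)); first last.
  + by move=> p; rewrite lee_fin retain2_ge0.
  + apply/measurable_EFinP; apply: measurable_retain2;
    by [exact: measurable_cst|exact: measurable_fst|exact: measurable_snd].
  + move=> p2 c2; have r1 := rad _ _ c1; have r2 := rad _ _ c2.
    have far12 := blocks_far r1 r2 (erefl : weight (mark1 p1) = weight (mark1 p2)).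
    have far21 := blocks_far r2 r1 (erefl : weight (mark1 p2) = weight (mark1 p1)).
    rewrite /retain2; case: asboolP => [[/far12 h _]|h].
      rewrite ifT//; congr EFin.
      exact: (void_blocksU F_Rplus F_power_law alpha_gt lam_gt0 r1 (lexx 1) r2 (lexx 1)).
    rewrite ifF//; apply/negP => h'; apply: h; split; first exact/far12.
    by apply/far21; rewrite enormB (addrC (radius _)).
  + exact: measurable_covering.
  by rewrite EFinM -(pairs_move z p1).
- exact: measurable_covering.
have pi : mu.-integrable D (EFin \o (fun p => lam * pairs z p)).
  have := integrableZl mD lam (pairs_integrable z); congr (_.-integrable _ _).
rewrite -[mark1 @^-1` _]/D (EFin_Rintegral mD pi) -EFinM RintegralZl//.
by rewrite expr2 mulrA.
Qed.

Let measurable_iso B y : measurable B -> B `<=` covering y -> measurable (iso B).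
Proof. by move=> mB By; apply: iso_measurable => // g /By; exact: covering_refl. Qed.

Let overlap_measurable z : measurable (covering 0 `&` covering z : set graind).
Proof. by apply: measurableI; exact: measurable_covering. Qed.

(** One grain covering both points is the negligible case; the rest of the
    covariance is an average of the excess over pairs of marks. *)
Lemma k_thE z : k_th P Phi z = fine (P (iso (covering 0 `&` covering z))) +
  lam ^+ 2 * \int[mu]_(p1 in D) \int[mu]_(p2 in D) excess p1.1 p1.2 (z + p2.1) p2.2.
Proof.
have m0 : measurable (iso (covering 0)).
  by apply: (measurable_iso (y := 0)) => //; exact: measurable_covering.
have mz : measurable (iso (covering z)).
  by apply: (measurable_iso (y := z)) => //; exact: measurable_covering.
have m0z : measurable (iso (covering 0 `&` covering z)).
  by apply: (measurable_iso (y := 0)) => //; exact: subIsetl.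
have both : P [set w | X_th Phi w 0 /\ X_th Phi w z] =
    ((lam ^+ 2 * \int[mu]_(p1 in D) pairs z p1)%:E +
    P (iso (covering 0 `&` covering z)))%E.
  rewrite (_ : [set _ | _] = iso (covering 0) `&` iso (covering z)); last first.
    by apply/funext => w; apply/propext; rewrite /= !X_thE.
  have eqI : iso (covering 0) `&` iso (covering z) `&` iso (covering 0 `&` covering z) =
      iso (covering 0 `&` covering z).
    by apply: setIidr => w [g [[c0 cz] ig]]; split; exists g.
  rewrite (measureDI P (measurableI _ _ m0 mz) m0z) eqI.
  by congr (_ + _)%E; exact: P_isolated_two.
have inner p1 : \int[mu]_(p2 in D) excess p1.1 p1.2 (z + p2.1) p2.2 =
    pairs z p1 - retain p1.2 * J.
  have ri : mu.-integrable D (EFin \o (fun p2 => retain p1.2 * retain p2.2)).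
    have := integrableZl mD (retain p1.2) retain_integrable; congr (_.-integrable _ _).
  by rewrite -RintegralZl// -RintegralB.
have ri : mu.-integrable D (EFin \o (fun p1 => retain p1.2 * J)).
  have := integrableZr mD J retain_integrable; congr (_.-integrable _ _).
under [in RHS]eq_Rintegral do rewrite inner.
rewrite RintegralB// RintegralZr// -/J /k_th both !P_X_th fineD ?fin_num_measure//=.
move: (fine _) (\int[mu]_(p1 in D) pairs z p1) => a b; ring.
Qed.

(** A ball that covers both points has a radius of at least half their
    distance. *)
Lemma P_isolated_both_le z : 1 <= enorm z ->
  fine (P (iso (covering 0 `&` covering z))) <=
  lam * (expR (- (lam * vol (cball (0 : 'rV[R]_n.+1) 1) / 2 ^+ n.+1 * enorm z)) * fine (mu D)).
Proof.
move=> z1; set e := expR _.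
have mC : measurable (D `&` covers z) by apply: measurableI => //; exact: measurable_covers.
have le_mu : (mu (D `&` covers z) <= mu D)%E.
  by apply: le_measure; rewrite ?inE// => p [].
have C_lty := le_lt_trans le_mu D_lty.
have ri : mu.-integrable (D `&` covers z) (EFin \o (fun p => retain p.2)).
  apply: (bounded_integrable mC C_lty (C := 1)); first exact: measurable_funTS.
  by move=> p _; rewrite gtr0_norm ?retain_gt0// retain_le1.
rewrite (P_isolated_covering (y := 0)); [|exact: overlap_measurable|exact: subIsetl].
rewrite -[mark1 @^-1` _]/(D `&` covers z) (EFin_Rintegral mC ri) -EFinM.
apply: ler_wpM2l; first exact: ltW.
apply: le_trans (ler_norm _) _.
apply: (@le_trans _ _ (e * fine (mu (D `&` covers z)))).
  apply: norm_Rintegral_le => //; first exact: measurable_funTS.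
    exact: expR_ge0.
  move=> p [p0 pz]; rewrite gtr0_norm ?retain_gt0//.
  have r0 := covers_rad p0.
  apply: le_trans (retain_exp F_Rplus F_power_law alpha_gt lam_gt0 r0) _.
  rewrite ler_expR lerN2 -!mulrA; apply: ler_wpM2l; first exact: ltW.
  apply: ler_wpM2l; first by apply/ltW; exact: v1_gt0.
  have half : enorm z / 2 <= p.2.
    have t := enorm_triangle p.1 z 0; rewrite subr0 in t.
    have p0' : enorm (p.1 - 0) <= p.2 by rewrite enormB.
    have pz' : enorm (z - p.1) <= p.2 by [].
    rewrite ler_pdivrMr//; apply: le_trans t _; rewrite mulr_natr mulr2n; exact: lerD.
  apply: (@le_trans _ _ ((enorm z / 2) ^+ n.+1)).
    rewrite expr_div_n mulrC ler_pM2r ?invr_gt0 ?exprn_gt0//.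
    by rewrite exprS ler_peMr ?exprn_ege1// enorm_ge0.
  by rewrite lerXn2r ?nnegrE// divr_ge0// enorm_ge0.
apply: ler_wpM2l; first exact: expR_ge0.
apply: fine_le => //; rewrite ge0_fin_numE//.
Qed.

Lemma P_isolated_both_cvg (z : nat -> 'rV[R]_n.+1) : enorm (z k) @[k --> \oo] --> +oo ->
  fine (P (iso (covering 0 `&` covering (z k)))) / rho (enorm (z k)) @[k --> \oo] --> 0.
Proof.
move=> zoo; pose c := lam * vol (cball (0 : 'rV[R]_n.+1) 1) / 2 ^+ n.+1.
have c0 : 0 < c by rewrite divr_gt0 ?exprn_gt0// mulr_gt0//; exact: v1_gt0.
have [C [u0 [C0 u00 hC]]] := exp_tail F_Rplus F_power_law c0.
have [t0 t00 ht] := tail_gt0_near F_power_law.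
pose B := lam * (C * fine (mu D)).
have lim : B * enorm (z k) `^ (- 1) @[k --> \oo] --> (0 : R).
  have p0 : enorm (z k) `^ (- 1) @[k --> \oo] --> (0 : R).
    apply: (@cvg_comp _ _ _ (fun k => enorm (z k)) (fun x : R => x `^ (- 1)) _ _ _ zoo).
    by apply: powR_cvg0y; exact: ltr01.
  by rewrite -(mulr0 B); apply: cvgMl_tmp; exact: p0.
apply: (squeeze_cvgr _ (cvg_cst (0 : R)) lim); near=> k.
have u1 : 1 <= enorm (z k) by near: k; exact: (cvgry_ge zoo).
have uu0 : u0 <= enorm (z k) by near: k; exact: (cvgry_ge zoo).
have ut0 : t0 <= enorm (z k) by near: k; exact: (cvgry_ge zoo).
have := P_isolated_both_le u1; rewrite -/c.
have : 0 <= fine (P (iso (covering 0 `&` covering (z k)))) by rewrite fine_ge0.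
move: (fine (P _)) (enorm (z k)) u1 uu0 ut0 => s u u1 uu0 ut0 s0 su.
have up : 0 < u by apply: lt_le_trans u1.
have tp : 0 < tail F u by exact: ht.
have rp : 0 < rho u by rewrite /rho mulr_gt0// exprn_gt0.
have muD0 : 0 <= fine (mu D) by exact: fine_ge0.
rewrite powR_inv1; last exact: ltW.
apply/andP; split; first exact: divr_ge0 s0 (ltW rp).
rewrite ler_pdivrMr; last exact: rp.
rewrite /rho /B; have := scaled_bound n (ltW lam_gt0) C0 muD0 u1 tp su (hC u uu0).
exact.
Unshelve. all: by end_near. Qed.

Lemma k_th_cvg (z : nat -> 'rV[R]_n.+1) : enorm (z k) @[k --> \oo] --> +oo ->
  k_th P Phi (z k) / rho (enorm (z k)) @[k --> \oo] -->
  lam * c_ad alpha n.+1 * p_th P Phi ^+ 2.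
Proof.
move=> zoo; have small := P_isolated_both_cvg zoo.
have large : lam ^+ 2 * ((\int[mu]_(p1 in D) \int[mu]_(p2 in D)
    excess p1.1 p1.2 (z k + p2.1) p2.2) / rho (enorm (z k))) @[k --> \oo] -->
    lam ^+ 2 * (lam * c_ad alpha n.+1 * J ^+ 2).
  apply: cvgMl_tmp.
  apply: (excess_average F_Rplus F_power_law alpha_gt lam_gt0 mD D_lty _ _ _ zoo).
  - exact: measurable_fst.
  - exact: measurable_snd.
  - by move=> p h; rewrite -[p.1]subr0 enormB.
have sum : fine (P (iso (covering 0 `&` covering (z k)))) / rho (enorm (z k)) +
    lam ^+ 2 * ((\int[mu]_(p1 in D) \int[mu]_(p2 in D)
      excess p1.1 p1.2 (z k + p2.1) p2.2) / rho (enorm (z k))) @[k --> \oo] -->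
    0 + lam ^+ 2 * (lam * c_ad alpha n.+1 * J ^+ 2).
  exact: cvgD small large.
rewrite add0r in sum.
rewrite p_thE (_ : _ * (lam * J) ^+ 2 = lam ^+ 2 * (lam * c_ad alpha n.+1 * J ^+ 2)); last by ring.
apply: near_cvg sum; apply: nearW => k.
by rewrite k_thE [RHS]mulrDl -[in RHS]mulrA.
Qed.

End covariance.

Theorem theorem5p1 (R : realType) (d : nat) (lam alpha : R)
    (F : probability (measurableTypeR R) R) (ell : R -> R)
    (G : R.-pker (measurableTypeR R) ~> (measurableTypeR R))
    (disp : measure_display) (Omega : measurableType disp)
    (P : probability Omega R) (Phi : Omega -> set (grain R d))
    (d_ge1 : (1 <= d)%N) (lam_gt0 : 0 < lam)
    (F_Rplus : F `]-oo, 0[%classic = 0%E)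
    (alpha_gt : d%:R < alpha) (F_power_law : power_law F alpha)
    (ell_slow : slowly_varying ell)
    (tailE : forall r, 0 < r -> tail F r = ell r * r `^ (- alpha))
    (G_dirac1 : forall (r : R) (A : set (measurableTypeR R)),
       measurable A -> G r A = \d_(1 : measurableTypeR R) A)
    (Phi_poisson : poisson_grain_model lam F G P Phi) :
  [/\ forall r : R, 0 <= r ->
        tail_th lam F G P Phi r <=
        lam / lam_th lam F G P Phi *
          expR (- (lam * vol (cball (0 : 'rV[R]_d) 1) * r ^+ d)),
      asymp_equiv (k_th P Phi)
        (fun z => lam * c_ad alpha d * p_th P Phi ^+ 2 *
           ell (enorm z) * enorm z `^ (- (alpha - d%:R))) &
      asymp_equiv (xi_th lam F G P Phi)
        (fun z => lam * c_ad alpha d *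
           ell (enorm z) * enorm z `^ (- (alpha - d%:R)))].
Proof.
case: d Phi d_ge1 alpha_gt Phi_poisson => [//|n] Phi _ alpha_gt Phi_poisson.
have c0 : 0 < lam * c_ad alpha n.+1 by rewrite mulr_gt0//; exact: c_ad_gt0.
split.
- move=> r r0.
  exact: (tail_th_le F_Rplus F_power_law alpha_gt lam_gt0 G_dirac1 Phi_poisson r0).
- apply: (asymp_equiv_rho tailE) => [|z zoo].
    rewrite mulr_gt0// exprn_gt0//.
    exact: (p_th_gt0 F_Rplus F_power_law alpha_gt lam_gt0 G_dirac1 Phi_poisson).
  exact: (k_th_cvg F_Rplus F_power_law alpha_gt lam_gt0 G_dirac1 Phi_poisson zoo).
- apply: (asymp_equiv_rho tailE) => // z zoo.
  exact: (xi_th_cvg F_Rplus F_power_law alpha_gt lam_gt0 G_dirac1 Phi_poisson zoo).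
Qed.
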